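(* Let $R$ be a Noetherian domain containing $\mathbb{Q}$ and let $B=\operatorname{Sym}_R(M)$ for some finitely generated projective $R$-module $M$ of rank two. Let $D$ be a locally nilpotent $R$-derivation of $B$ and let $A=\operatorname{Ker}(D)$. Then the following are equivalent: (I) $\operatorname{grade}(D(B)B,B)\in\{2,\infty\}$. (II) $A$ is isomorphic as an $R$-algebra to $\operatorname{Sym}_R(I)$ for some invertible ideal $I$ of $R$, and $D_{\mathfrak p}$ is irreducible for each $\mathfrak p\in\operatorname{Spec}(R)$. Moreover, when $\operatorname{grade}(D(B)B,B)=\infty$, $B$ is isomorphic as an $A$-algebra to a polynomial ring in one variable over $A$.
   Context: All rings are commutative with unity. $\operatorname{Sym}_R(M)$ is the symmetric algebra of the $R$-module $M$. An $R$-derivation $D:B\to B$ is an $R$-linear map satisfying the Leibniz rule; it is locally nilpotent if for each $b\in B$ there is $n\ge 0$ with $D^n(b)=0$; $\operatorname{Ker}(D)=\{b\in B: D(b)=0\}$. $D(B)B$ is the ideal of $B$ generated by the image of $D$. For $\mathfrak p\in\operatorname{Spec}(R)$, $B_{\mathfrak p}$ is the localization of $B$ at $R\setminus\mathfrak p$, and $D_{\mathfrak p}$ is the extension of $D$ to $B_{\mathfrak p}$. A derivation $D$ of a ring $B$ is reducible if there is a non-unit $b\in B$ with $D(B)\subseteq bB$, and irreducible otherwise. For an ideal $I$ of a Noetherian ring $S$, $\operatorname{grade}(I,S)$ is the length of a maximal $S$-regular sequence contained in $I$ if $I\ne S$, and is $\infty$ if $I=S$. *)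

(* Defs.v *)
From HB Require Import structures.
From mathcomp Require Import all_boot all_order all_algebra.
From mathcomp Require Import generic_quotient ring_quotient.
From mathcomp Require Import boolp classical_sets.
From mathcomp Require Import xfinmap monalg ring.

Set Implicit Arguments.
Unset Strict Implicit.
Unset Printing Implicit Defensive.

Import GRing.Theory.

Local Open Scope ring_scope.
Local Open Scope quotient_scope.
Local Open Scope classical_set_scope.

Section Span.
Variables (R : comNzRingType) (V : lmodType R).

Definition span_set (X : set V) : set V :=
  [set v | exists s : seq (R * V), (forall q, q \in s -> X q.2) /\
                                   v = \sum_(q <- s) q.1 *: q.2].

Lemma span_set_incl (X : set V) v : X v -> span_set X v.
Proof.
move=> Xv; exists [:: (1, v)]; split; last by rewrite big_seq1 scale1r.
by move=> q; rewrite inE => /eqP->.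
Qed.

Lemma span_set0 (X : set V) : span_set X 0.
Proof. by exists [::]; rewrite big_nil. Qed.

Lemma span_setP (X : set V) a u v :
  span_set X u -> span_set X v -> span_set X (a *: u + v).
Proof.
move=> [s [Xs ->]] [t [Xt ->]].
exists ([seq (a * q.1, q.2) | q <- s] ++ t); split.
  move=> q; rewrite mem_cat => /orP[/mapP[r /Xs Xr ->] //|]; exact: Xt.
rewrite big_cat big_map scaler_sumr; congr (_ + _).
by apply: eq_bigr => q _; rewrite scalerA.
Qed.

Definition fin_gen := exists s : seq V, span_set [set v | v \in s] = setT.

End Span.

Definition ideal_gen (S : comNzRingType) (X : set S) : set S :=
  span_set (X : set S^o).

Section SubModule.
Variables (R : comNzRingType) (V : lmodType R) (W : submodClosed V).

Record submod := Submod { submod_val : V; _ : submod_val \in W }.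
HB.instance Definition _ := [isSub for submod_val].
HB.instance Definition _ := [Choice of submod by <:].
HB.instance Definition _ := [SubChoice_isSubLmodule of submod by <:].
End SubModule.

Definition noetherian_ring (R : comNzRingType) :=
  forall I : submodClosed R^o, exists s : seq R,
    [set x | x \in I] = ideal_gen [set x | x \in s].

Definition projective (R : comNzRingType) (M : lmodType R) :=
  forall (N P : lmodType R) (g : {linear N -> P}) (f : {linear M -> P}),
    (forall y, exists x, g x = y) ->
    exists h : {linear M -> N}, forall m, g (h m) = f m.

Section Localization.
Variables (R : comNzRingType) (p : prime_idealr R).

Record denom := Denom { den : R; _ : den \notin p }.
HB.instance Definition _ := [isSub for den].
HB.instance Definition _ := [Choice of denom by <:].

Lemma denom1_subproof : 1 \notin p.
Proof. by rewrite idealr1. Qed.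
Definition denom1 : denom := Denom denom1_subproof.

Lemma denomM_subproof (s t : denom) : den s * den t \notin p.
Proof. by rewrite prime_idealrM negb_or (valP s) (valP t). Qed.
Definition denomM (s t : denom) : denom := Denom (denomM_subproof s t).

Variable V : lmodType R.

Definition loc_eq (x y : V * denom) : bool :=
  `[< exists u : denom, den u *: (den y.2 *: x.1 - den x.2 *: y.1) = 0 >].

Lemma loc_eqP (x y : V * denom) :
  reflect (exists u : denom,
             (den u * den y.2) *: x.1 = (den u * den x.2) *: y.1)
          (loc_eq x y).
Proof.
apply: (iffP (asboolP _)) => -[u]; last first.
  by move=> e; exists u; rewrite scalerBr !scalerA e subrr.
by rewrite scalerBr !scalerA => /subr0_eq e; exists u.
Qed.

Lemma loc_eq_equiv : equiv_class_of loc_eq.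
Proof.
split.
- by move=> x; apply/loc_eqP; exists denom1.
- by move=> x y; apply/loc_eqP/loc_eqP => -[u e]; exists u.
move=> y x z /loc_eqP[u exy] /loc_eqP[w eyz]; apply/loc_eqP.
exists (denomM (denomM u w) y.2) => /=.
move: (den u) (den w) (den x.2) (den y.2) (den z.2) exy eyz.
move=> a b sx sy sz exy eyz.
have -> : a * b * sy * sz = b * sz * (a * sy) by ring.
rewrite -scalerA exy scalerA.
have -> : b * sz * (a * sx) = a * sx * (b * sz) by ring.
by rewrite -scalerA eyz scalerA; congr (_ *: _); ring.
Qed.

Canonical loc_equiv := EquivRelPack loc_eq_equiv.
Canonical loc_encModRel := defaultEncModRel loc_eq.

Definition loc := {eq_quot loc_eq}.
HB.instance Definition _ := Choice.on loc.
HB.instance Definition _ := EqQuotient.on loc.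

Definition frac (v : V) (s : denom) : loc := \pi_loc (v, s).
Definition num_of (x : loc) : V := (repr x).1.
Definition den_of (x : loc) : denom := (repr x).2.

Lemma frac_repr x : frac (num_of x) (den_of x) = x.
Proof. by rewrite /frac -surjective_pairing reprK. Qed.

Lemma eq_frac v s w t :
  frac v s = frac w t <->
  exists u : denom, (den u * den t) *: v = (den u * den s) *: w.
Proof.
split=> [/eqmodP/loc_eqP //|e]; exact/eqmodP/loc_eqP.
Qed.

Lemma num_frac v s : exists u : denom,
  (den u * den s) *: num_of (frac v s) = (den u * den (den_of (frac v s))) *: v.
Proof. by apply/eq_frac; rewrite frac_repr. Qed.

Definition loc_zero : loc := frac 0 denom1.
Definition loc_opp (x : loc) : loc := frac (- num_of x) (den_of x).
Definition loc_add (x y : loc) : loc :=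
  frac (den (den_of y) *: num_of x + den (den_of x) *: num_of y)
       (denomM (den_of x) (den_of y)).

Lemma loc_oppE v s : loc_opp (frac v s) = frac (- v) s.
Proof.
have [u e] := num_frac v s; apply/eq_frac; exists u.
by rewrite !scalerN e.
Qed.

Lemma loc_addE v s w t :
  loc_add (frac v s) (frac w t) = frac (den t *: v + den s *: w) (denomM s t).
Proof.
have [u e] := num_frac v s; have [u' e'] := num_frac w t.
apply/eq_frac; exists (denomM u u') => /=; rewrite !scalerDr !scalerA.
move: (num_of (frac v s)) (num_of (frac w t)) (den_of (frac v s))
  (den_of (frac w t)) e e' => x y a b e e'.
move: (den s) (den t) (den u) (den u') (den a) (den b) e e'.
move=> {a b s t u u'} s t u u' a b e e'.
have -> : u * u' * (s * t) * b = u' * t * b * (u * s) by ring.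
have -> : u * u' * (s * t) * a = u * s * a * (u' * t) by ring.
rewrite -scalerA e -[(u * s * a * _) *: _]scalerA e' !scalerA.
by congr (_ *: _ + _ *: _); ring.
Qed.

Lemma loc_addA : associative loc_add.
Proof.
move=> x y z; rewrite -(frac_repr x) -(frac_repr y) -(frac_repr z) !loc_addE.
apply/eq_frac; exists denom1 => /=; rewrite !scalerDr !scalerA -!addrA.
by congr (_ *: _ + (_ *: _ + _ *: _)); ring.
Qed.

Lemma loc_addC : commutative loc_add.
Proof.
move=> x y; rewrite -(frac_repr x) -(frac_repr y) !loc_addE.
apply/eq_frac; exists denom1 => /=; rewrite !scalerDr !scalerA addrC.
by congr (_ *: _ + _ *: _); ring.
Qed.

Lemma loc_add0 : left_id loc_zero loc_add.
Proof.
move=> x; rewrite -(frac_repr x) loc_addE; apply/eq_frac; exists denom1 => /=.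
by rewrite scaler0 add0r scalerA; congr (_ *: _); ring.
Qed.

Lemma loc_addN : left_inverse loc_zero loc_opp loc_add.
Proof.
move=> x; rewrite -(frac_repr x) loc_oppE loc_addE.
by apply/eq_frac; exists denom1; rewrite scalerN addNr !scaler0.
Qed.

HB.instance Definition _ :=
  GRing.isZmodule.Build loc loc_addA loc_addC loc_add0 loc_addN.

Lemma frac_add v s w t :
  frac v s + frac w t = frac (den t *: v + den s *: w) (denomM s t).
Proof. exact: loc_addE. Qed.

Lemma frac_add1 v w s : frac v s + frac w s = frac (v + w) s.
Proof.
rewrite frac_add; apply/eq_frac; exists denom1 => /=.
by rewrite -scalerDr scalerA; congr (_ *: _); ring.
Qed.

End Localization.

Section LocRing.
Variables (R : comNzRingType) (p : prime_idealr R) (B : comAlgType R).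
Local Notation Bp := (loc p B).

Definition loc_one : Bp := frac (1 : B) (denom1 p).
Definition loc_mul (x y : Bp) : Bp :=
  frac (num_of x * num_of y : B) (denomM (den_of x) (den_of y)).

Lemma loc_mulE (v : B) s (w : B) t :
  loc_mul (frac v s) (frac w t) = frac (v * w : B) (denomM s t).
Proof.
have [u e] := num_frac v s; have [u' e'] := num_frac w t.
apply/eq_frac; exists (denomM u u') => /=.
move: (num_of (frac v s)) (num_of (frac w t)) (den_of (frac v s))
  (den_of (frac w t)) e e' => x y a b e e'.
move: (den s) (den t) (den u) (den u') (den a) (den b) e e'.
move=> {a b s t u u'} s t u u' a b e e'.
have -> : u * u' * (s * t) = u' * t * (u * s) by ring.
rewrite -scalerA scalerAl e scalerAr e'.
by rewrite -scalerAl -scalerAr scalerA; congr (_ *: _); ring.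
Qed.

Lemma loc_mulA : associative loc_mul.
Proof.
move=> x y z; rewrite -(frac_repr x) -(frac_repr y) -(frac_repr z) !loc_mulE.
by apply/eq_frac; exists (denom1 p); rewrite mulrA /= !mulrA.
Qed.

Lemma loc_mulC : commutative loc_mul.
Proof.
move=> x y; rewrite -(frac_repr x) -(frac_repr y) !loc_mulE.
by apply/eq_frac; exists (denom1 p) => /=;
  rewrite [num_of x * _]mulrC; congr (_ *: _); ring.
Qed.

Lemma loc_mul1 : left_id loc_one loc_mul.
Proof.
move=> x; rewrite -(frac_repr x) loc_mulE; apply/eq_frac; exists (denom1 p).
by rewrite /= !mul1r.
Qed.

Lemma loc_mulDl : left_distributive loc_mul +%R.
Proof.
move=> x y z; rewrite -(frac_repr x) -(frac_repr y) -(frac_repr z).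
rewrite frac_add !loc_mulE frac_add; apply/eq_frac; exists (denom1 p) => /=.
rewrite mulrDl -!scalerAl !scalerDr !scalerA.
by congr (_ *: _ + _ *: _); ring.
Qed.

(* only a comPzRingType: the localization of an algebra can be the zero ring *)
HB.instance Definition _ :=
  GRing.Zmodule_isComPzRing.Build (loc p B) loc_mulA loc_mulC loc_mul1 loc_mulDl.

Lemma frac_mul (v : B) s (w : B) t :
  (frac v s : Bp) * frac w t = frac (v * w : B) (denomM s t).
Proof. exact: loc_mulE. Qed.

End LocRing.



Section LocModule.
Variables (R : comNzRingType) (p : prime_idealr R) (V : lmodType R).
Local Notation Rp := (loc p R^o).
Local Notation Vp := (loc p V).

Definition loc_scale (a : Rp) (x : Vp) : Vp :=
  frac ((num_of a : R) *: num_of x) (denomM (den_of a) (den_of x)).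

Lemma loc_scaleE (r : R^o) s (v : V) t :
  loc_scale (frac r s) (frac v t) = frac ((r : R) *: v) (denomM s t).
Proof.
have [u e] := num_frac r s; have [u' e'] := num_frac v t.
apply/eq_frac; exists (denomM u u') => /=.
set x : R := num_of (frac r s); set y := num_of (frac v t).
have {}e : den u * den s * x = den u * den (den_of (frac r s)) * r := e.
rewrite !scalerA.
have -> : den u * den u' * (den s * den t) * x =
          (den u * den s * x) * (den u' * den t) by ring.
rewrite -scalerA e' scalerA e.
by congr (_ *: _); ring.
Qed.

Lemma loc_scaleA a b x : loc_scale a (loc_scale b x) = loc_scale (a * b) x.
Proof.
rewrite -(frac_repr a) -(frac_repr b) -(frac_repr x) frac_mul.
rewrite (loc_scaleE _ _ (num_of x)) !loc_scaleE.
apply/eq_frac; exists (denom1 p) => /=.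
set r : R := num_of a; set q : R := num_of b.
have -> : (num_of a * num_of b : R^o) = @GRing.mul R r q by [].
by rewrite !scalerA; congr (_ *: _); ring.
Qed.

Lemma loc_scale1 : left_id 1 loc_scale.
Proof.
move=> x; rewrite -(frac_repr x) loc_scaleE; apply/eq_frac; exists (denom1 p).
by rewrite /= scale1r !mul1r.
Qed.

Lemma loc_scaleDr : right_distributive loc_scale +%R.
Proof.
move=> a x y; rewrite -(frac_repr a) -(frac_repr x) -(frac_repr y).
rewrite frac_add !loc_scaleE frac_add; apply/eq_frac; exists (denom1 p) => /=.
rewrite !scalerDr !scalerA.
by congr (_ *: _ + _ *: _); ring.
Qed.

Lemma loc_scaleDl x : {morph loc_scale^~ x : a b / a + b}.
Proof.
move=> a b; rewrite -(frac_repr a) -(frac_repr b) -(frac_repr x).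
rewrite frac_add !loc_scaleE frac_add; apply/eq_frac; exists (denom1 p) => /=.
set r : R := num_of a; set q : R := num_of b.
have -> : (den (den_of b) *: num_of a + den (den_of a) *: num_of b : R^o) =
          @GRing.add R (den (den_of b) * r) (den (den_of a) * q) by [].
rewrite !scalerDl !scalerDr !scalerA.
by congr (_ *: _ + _ *: _); ring.
Qed.

HB.instance Definition _ := GRing.Zmodule_isLmodule.Build Rp Vp
  loc_scaleA loc_scale1 loc_scaleDr loc_scaleDl.

Lemma frac_scale (r : R) s (v : V) t :
  (frac (r : R^o) s : Rp) *: (frac v t : Vp) = frac (r *: v) (denomM s t).
Proof. exact: loc_scaleE. Qed.

End LocModule.

Section LocMap.
Variables (R : comNzRingType) (p : prime_idealr R) (V W : lmodType R).

Definition loc_map (f : V -> W) (x : loc p V) : loc p W :=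
  frac (f (num_of x)) (den_of x).

Lemma loc_map_frac (f : {linear V -> W}) v s :
  loc_map f (frac v s) = frac (f v) s.
Proof.
have [u e] := num_frac v s; apply/eq_frac; exists u.
by rewrite -!linearZ /= e linearZ.
Qed.

End LocMap.

Definition free_of_rank (R : comPzRingType) (V : lmodType R) (n : nat) :=
  exists f : {linear 'rV[R]_n -> V}, bijective f.

Definition has_rank (R : comNzRingType) (M : lmodType R) (n : nat) :=
  forall p : prime_idealr R, free_of_rank (loc p M : lmodType (loc p R^o)) n.

Section QuotientAlgebra.
Variables (R : comNzRingType) (A : comAlgType R) (I : idealr A).

Definition quot_alg := {ideal_quot I}.
HB.instance Definition _ := GRing.ComNzRing.on quot_alg.

Definition quot_proj (x : A) : quot_alg := \pi_({ideal_quot I}) x.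
HB.instance Definition _ := GRing.RMorphism.copy quot_proj
  (\pi_({ideal_quot I}) : A -> {ideal_quot I}).

Lemma quot_projP (x y : A) : quot_proj x = quot_proj y <-> x - y \in I.
Proof.
rewrite (Quotient.idealrBE I x y).
by split=> [e|/eqP]; [apply/eqP|].
Qed.

Lemma quot_proj_surj (y : quot_alg) : exists x, y = quot_proj x.
Proof. by exists (repr y); rewrite /quot_proj reprK. Qed.

Definition quot_scale (a : R) (x : quot_alg) : quot_alg := quot_proj a%:A * x.

Lemma quot_scaleA a b x : quot_scale a (quot_scale b x) = quot_scale (a * b) x.
Proof. by rewrite /quot_scale mulrA -rmorphM -scalerAl mul1r scalerA. Qed.

Lemma quot_scale1 : left_id 1 quot_scale.
Proof. by move=> x; rewrite /quot_scale scale1r rmorph1 mul1r. Qed.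

Lemma quot_scaleDr : right_distributive quot_scale +%R.
Proof. by move=> a x y; rewrite /quot_scale mulrDr. Qed.

Lemma quot_scaleDl x : {morph quot_scale^~ x : a b / a + b}.
Proof. by move=> a b; rewrite /quot_scale scalerDl rmorphD mulrDl. Qed.

HB.instance Definition _ := GRing.Zmodule_isLmodule.Build R quot_alg
  quot_scaleA quot_scale1 quot_scaleDr quot_scaleDl.

Lemma quot_scaleAl (a : R) (x y : quot_alg) : a *: (x * y) = (a *: x) * y.
Proof. exact: mulrA. Qed.

HB.instance Definition _ := GRing.Lmodule_isLalgebra.Build R quot_alg quot_scaleAl.
HB.instance Definition _ := GRing.Lalgebra_isComAlgebra.Build R quot_alg.

Lemma quot_projZ : scalable quot_proj.
Proof.
move=> a x; rewrite -[RHS]/(quot_proj a%:A * quot_proj x) -rmorphM.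
by rewrite -scalerAl mul1r.
Qed.
HB.instance Definition _ :=
  GRing.isScalable.Build R A quot_alg *:%R quot_proj quot_projZ.

Section Lift.
Variables (C : comAlgType R) (f : {lrmorphism A -> C}).
Hypothesis f0 : forall x, x \in I -> f x = 0.

Definition quot_lift (y : quot_alg) : C := f (repr y).

Lemma quot_lift_proj x : quot_lift (quot_proj x) = f x.
Proof.
apply: subr0_eq; rewrite -[LHS](rmorphB f); apply/f0/quot_projP.
by rewrite /quot_proj reprK.
Qed.

Lemma quot_lift_lrmorphism :
  exists g : {lrmorphism quot_alg -> C}, forall x, g (quot_proj x) = f x.
Proof.
have gP : linear quot_lift.
  move=> a y z; have [x ->] := quot_proj_surj y; have [t ->] := quot_proj_surj z.
  by rewrite -linearP !quot_lift_proj linearP.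
have gM : monoid_morphism quot_lift.
  split=> [|y z]; first by rewrite -(rmorph1 quot_proj) quot_lift_proj rmorph1.
  have [x ->] := quot_proj_surj y; have [t ->] := quot_proj_surj z.
  by rewrite -rmorphM !quot_lift_proj rmorphM.
pose gL := GRing.isLinear.Build R quot_alg C *:%R quot_lift gP.
pose gR := GRing.isMonoidMorphism.Build quot_alg C quot_lift gM.
pose g : {lrmorphism quot_alg -> C} := HB.pack quot_lift gL gR.
by exists g => x; apply: quot_lift_proj.
Qed.

End Lift.
End QuotientAlgebra.

Section PolynomialAlgebra.

Lemma malgUZ (R : comNzRingType) (K : conomType) (c : R) (k : K) :
  << c *g k >> = c *: << k >> :> {malg R[K]}.
Proof.
apply/malgP => l; rewrite mcoeffZ !mcoeffU.
by case: eqP; rewrite ?mulr1n ?mulr1 // mulr0n mulr0.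
Qed.

Variables (R : comNzRingType) (I : choiceType).
Local Notation K := (cmonom I : conomType).

Lemma malg_eval (C : comAlgType R) (f : I -> C) :
  exists g : {lrmorphism {malg R[K]} -> C}, forall i, g << ucm i >> = f i.
Proof.
pose h (k : K) : C := \prod_(i <- finsupp (k : cmonom I)) f i ^+ (k : cmonom I) i.
have hw (k : K) (d : {fset I}) : fsubset (finsupp (k : cmonom I)) d ->
    h k = \prod_(i <- d) f i ^+ (k : cmonom I) i.
  move=> le; rewrite /h (big_fset_incl _ le) // => i _.
  by rewrite -cmE_neq0 negbK => /eqP ->.
have h_mm : mmorphism h.
  split=> [k l|]; last by rewrite /h mdom1 big_seq_fset0.
  rewrite (hw (mmul k l) _ (fsubset_refl _)) mdomD.
  rewrite (hw k _ (fsubsetUl _ (finsupp (l : cmonom I)))).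
  rewrite (hw l _ (fsubsetUr (finsupp (k : cmonom I)) _)).
  by rewrite -big_split /=; apply: eq_bigr => i _; rewrite cmM exprD.
pose hM : {mmorphism K -> C} := HB.pack h (isMultiplicative.Build K C h h_mm).
pose g : {malg R[K]} -> C := mmap (in_alg C) hM.
have gZ : scalable g.
  by move=> a x; rewrite /g mmapZ /= -scalerAl mul1r.
pose gS := GRing.isScalable.Build R {malg R[K]} C *:%R g gZ.
pose gL : {lrmorphism {malg R[K]} -> C} := HB.pack g gS
  (GRing.RMorphism.on (mmap (in_alg C) hM)).
exists gL => i; rewrite /= /g mmapU /= scale1r mul1r /h.
by rewrite mdomU big_seq_fset1 cmUU.
Qed.

Lemma malg_eval_uniq (C : comAlgType R) (g h : {lrmorphism {malg R[K]} -> C}) :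
  (forall i, g << ucm i >> = h << ucm i >>) -> g =1 h.
Proof.
move=> gh; have ghk k : g << k >> = h << k >>.
  have [n] := ubnP (mdeg k); elim: n k => // n IH k.
  have [->|] := eqVneq k mone; first by move=> _; rewrite !rmorph1.
  move=> k1; have [i ki] : exists i, k i != 0%N.
    apply: contrapT => k0; case/eqP: k1; apply/eqP/cmP => i; rewrite cm1.
    by apply/eqP/negPn/negP => ki; apply: k0; exists i.
  have -> : k = mmul (ucm i) (divcm k (ucm i)).
    apply/eqP/cmP => j; rewrite cmM divcmE ucmE.
    by case: eqVneq => [<-|_]; rewrite ?subn0 // subnKC // lt0n.
  set l := divcm _ _; rewrite mdegM mdegU ltnS => /IH IHl.
  have UM (u v : K) : << mmul u v >> = << u >> * << v >> :> {malg R[K]}.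
    by rewrite malgM_def fgmulUU mulr1.
  by rewrite UM [LHS]rmorphM [RHS]rmorphM; congr (_ * _); [apply: gh|apply: IHl].
move=> x; rewrite [x]monalgE !rmorph_sum; apply: eq_bigr => k _.
by rewrite malgUZ [LHS]linearZ [RHS]linearZ; congr (_ *: _); apply: ghk.
Qed.

End PolynomialAlgebra.

Section SymmetricAlgebra.
Variables (R : comNzRingType) (M : lmodType R).
Local Notation P := {malg R[{cmonom M}]}.

Definition sym_var (m : M) : P := << ucm m >>.

Definition sym_relations : set P :=
  [set x | exists a m n,
     x = sym_var (a *: m + n) - (a *: sym_var m + sym_var n)].

Definition sym_ideal : {pred P} := fun x => `[< ideal_gen sym_relations x >].

Lemma sym_var_eval0 m : mcoeff (@mone {cmonom M}) (sym_var m) = 0.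
Proof.
rewrite mcoeffU; case: eqP => // /(congr1 mdeg).
by rewrite mdegU mdeg1.
Qed.

Lemma sym_relations_eval0 x :
  sym_relations x -> mcoeff (@mone {cmonom M}) x = 0.
Proof.
have aux (K : conomType) (a : R) (u v w : {malg R[K]}) :
    mcoeff mone u = 0 -> mcoeff mone v = 0 -> mcoeff mone w = 0 ->
    mcoeff mone (u - (a *: v + w)) = 0.
  by move=> u0 v0 w0; rewrite mcoeffB mcoeffD mcoeffZ u0 v0 w0 mulr0 addr0 subr0.
by move=> [a [m [n ->]]]; apply: aux; apply: sym_var_eval0.
Qed.

Lemma sym_ideal_eval0 x : x \in sym_ideal -> mcoeff (@mone {cmonom M}) x = 0.
Proof.
move=> /asboolP[s [rel_s ->]]; rewrite rmorph_sum big_seq big1 //= => q.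
by move=> /rel_s/sym_relations_eval0 q0; rewrite rmorphM /= q0 mulr0.
Qed.

Lemma sym_ideal_closed : idealr_closed sym_ideal.
Proof.
split.
- by apply/asboolP; apply: span_set0.
- apply/negP => /sym_ideal_eval0 /eqP; rewrite rmorph1.
  by apply/negP; apply: oner_neq0.
by move=> a x y /asboolP Ix /asboolP Iy; apply/asboolP/(span_setP a Ix Iy).
Qed.
HB.instance Definition _ := isIdealr.Build P sym_ideal sym_ideal_closed.

Definition Sym := quot_alg sym_ideal.
HB.instance Definition _ := GRing.ComAlgebra.on Sym.

Definition sym_in (m : M) : Sym := quot_proj sym_ideal (sym_var m).

Lemma sym_in_linear : linear sym_in.
Proof.
move=> a m n; rewrite /sym_in -linearP; apply/quot_projP/asboolP.
by apply: span_set_incl; exists a, m, n.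
Qed.
HB.instance Definition _ := GRing.isLinear.Build R M Sym *:%R sym_in sym_in_linear.

Theorem sym_universal (C : comAlgType R) (f : {linear M -> C}) :
  exists g : {lrmorphism Sym -> C}, (forall m, g (sym_in m) = f m) /\
    forall h : {lrmorphism Sym -> C}, (forall m, h (sym_in m) = f m) -> h =1 g.
Proof.
have [g0 g0E] := malg_eval f.
have g0rel x : sym_relations x -> g0 x = 0.
  move=> [a [m [n ->]]].
  transitivity (g0 (sym_var (a *: m + n)) -
                (a *: g0 (sym_var m) + g0 (sym_var n))).
    by rewrite [LHS]rmorphB; congr (_ - _); apply: linearP.
  transitivity (f (a *: m + n) - (a *: f m + f n)).
    by congr (_ - (_ *: _ + _)); apply: g0E.
  by rewrite linearP subrr.
have g0I x : x \in sym_ideal -> g0 x = 0.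
  move=> /asboolP[s [rel_s ->]]; rewrite [LHS]rmorph_sum big_seq big1 // => q.
  move=> /rel_s/g0rel q0; transitivity (g0 q.1 * g0 q.2); first exact: rmorphM.
  by rewrite q0 mulr0.
have [g gE] := quot_lift_lrmorphism g0I.
exists g; split=> [m|h hE y]; first by rewrite [LHS]gE g0E.
have [x ->] := quot_proj_surj y.
pose hp : {lrmorphism P -> C} := h \o quot_proj sym_ideal.
pose gp : {lrmorphism P -> C} := g \o quot_proj sym_ideal.
apply: (malg_eval_uniq (g := hp) (h := gp)) => m.
by rewrite [LHS]hE -(g0E m); rewrite [RHS]gE.
Qed.

End SymmetricAlgebra.

Record derivation (R : comNzRingType) (B : comAlgType R) := Derivation {
  der_map :> {linear B -> B};
  der_leibniz : forall x y, der_map (x * y) = der_map x * y + x * der_map y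
}.

Section Derivation.
Variables (R : comNzRingType) (B : comAlgType R) (D : derivation B).

Definition locally_nilpotent := forall b, exists n, iter n D b = 0.

Definition der_ker : {pred B} := fun b => D b == 0.

Lemma der1 : D 1 = 0.
Proof.
by apply: (addrI (D 1)); rewrite addr0 -{3}[1]mulr1 der_leibniz mulr1 mul1r.
Qed.

Lemma der_ker_subalg : GRing.subalg_closed der_ker.
Proof.
split; first by rewrite unfold_in der1.
- move=> a x y; rewrite !unfold_in => /eqP Dx /eqP Dy.
  by rewrite linearP /= Dx Dy scaler0 addr0.
- move=> x y; rewrite !unfold_in => /eqP Dx /eqP Dy.
  by rewrite der_leibniz Dx Dy mulr0 mul0r addr0.
Qed.
HB.instance Definition _ := GRing.isSubalgClosed.Build R B der_ker der_ker_subalg.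

Record ker_alg := KerAlg { ker_val : B; _ : ker_val \in der_ker }.
HB.instance Definition _ := [isSub for ker_val].
HB.instance Definition _ := [Choice of ker_alg by <:].
HB.instance Definition _ := [SubChoice_isSubComNzRing of ker_alg by <:].
HB.instance Definition _ := [SubZmodule_isSubLmodule of ker_alg by <:].
HB.instance Definition _ := [SubNzRing_SubLmodule_isSubLalgebra of ker_alg by <:].
HB.instance Definition _ := [SubLalgebra_isSubAlgebra of ker_alg by <:].

Lemma loc_map_leibniz (p : prime_idealr R) (x y : loc p B) :
  loc_map D (x * y) = loc_map D x * y + x * loc_map D y.
Proof.
rewrite -(frac_repr x) -(frac_repr y) frac_mul !loc_map_frac !frac_mul frac_add1.
by rewrite der_leibniz.
Qed.

End Derivation.

Definition der_reducible (S : comPzRingType) (d : S -> S) :=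
  exists b : S, ~ (exists c, b * c = 1) /\ forall x, exists y, d x = b * y.

Definition der_irreducible (S : comPzRingType) (d : S -> S) := ~ der_reducible d.

Section Grade.
Variable S : comNzRingType.

Definition regular_seq (s : seq S) :=
  ideal_gen [set` s] <> setT /\
  forall i, (i < size s)%N -> forall y,
    ideal_gen [set` take i s] (s`_i * y) -> ideal_gen [set` take i s] y.

Definition max_regular_seq (I : set S) (s : seq S) :=
  [/\ [set` s] `<=` I, regular_seq s &
      forall x, I x -> ~ regular_seq (rcons s x)].

(* [None] stands for the value infinity.  When S is Noetherian all maximal
   regular sequences in I have the same length (Rees), so this is functional. *)
Definition grade_is (I : set S) (g : option nat) :=
  match g with
  | Some n => I <> setT /\ exists s, max_regular_seq I s /\ size s = n
  | None => I = setT
  end.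

End Grade.

Section Invertible.
Variable R : idomainType.

Definition frac_submodule (J : set {fraction R}) :=
  J 0 /\ forall (a : R) x y, J x -> J y -> J (tofrac a * x + y).

Definition frac_mul_set (I : set R) (J : set {fraction R}) : set {fraction R} :=
  [set z | exists s : seq (R * {fraction R}),
     (forall q, q \in s -> I q.1 /\ J q.2) /\
     z = \sum_(q <- s) tofrac q.1 * q.2].

Definition invertible_ideal (I : submodClosed R^o) :=
  exists J, frac_submodule J /\ frac_mul_set [set` I] J = range (@tofrac R).

End Invertible.

(* Main.v *)
(**
  Locally M is free, so B becomes S[X, Y] with S = R_p and K = Frac R.  A locally
  nilpotent derivation D = a d/dX + b d/dY has divergence zero: the operator
  g |-> D g + div(D) g is locally nilpotent, as it comes from the action of D on
  2-forms, and comparing D-degrees forces div(D) = 0.  Hence D is Hamiltonian,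
  a = dG/dY and b = - dG/dX.

  (I) => (II).  If grade(D(B)B) >= 2, a relation u a + v b = 0 makes (u, v) a
  multiple of (- b, a).  For P in A the gradient of P is then Q times that of G;
  again Q is in A, of smaller degree, and by induction P is in S[G].  So A is
  locally R_p[G], with G unique up to a unit once its constant term is zero, and
  the lines spanned by these generators glue to an invertible ideal.

  (II) => (I).  If A is locally S[F], then G = g(F) and irreducibility makes g'(F)
  a unit.  An element w of Frac B with w D(B) in B is in K[X, Y], since a and b have
  no common factor there, and by McCoy's theorem for the module K/S it is in S[X, Y]
  unless some x in K \ S satisfies x G in S[X, Y]; but then x G is in S[F] and
  x is in S.  Together with Hilbert's basis theorem this gives a regular sequence of
  length two in D(B)B.  There is none of length three because D(B)B is locally
  generated by two elements.

  Slice.  Let D(B)B = B.  Over K, write e as the curl of a 1-form and contract this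
  form with D: this induces on B/DB an inverse of d/dG.  As B/DB is torsion over
  K[G], it vanishes, so D s = r for some s in B and some nonzero r in R.  The
  degree argument modulo primes shows ker(D mod p) = A + pB, Noetherian induction
  extends this to all ideals, and for the ideal rR it turns s into a slice.
*)
Require Import Defs.
From HB Require Import structures.
From mathcomp Require Import all_boot all_order all_algebra polyXY.
From mathcomp Require Import ring_quotient boolp classical_sets monalg xfinmap ring.

Set Implicit Arguments.
Unset Strict Implicit.
Unset Printing Implicit Defensive.

Import GRing.Theory.

Local Open Scope ring_scope.
Local Notation frac := Defs.frac.

(** * Locally nilpotent derivations of K[X, Y] *)

(** R need not be normal, so R_p[X, Y] is in general not factorial and divisibility there cannot be
    read off irreducible factors. Factorization is used over K only; the descent from K to R_p rests
    on McCoy's theorem and on regular elements. All the R_p are subsets of the one field K, and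
    polynomials over them are subsets of K[X, Y], so a chart at p serves at the generic point as
    well. A statement about a localization is phrased in B itself with a multiplier t outside p; it
    becomes global because the admissible multipliers form an ideal contained in no prime. The
    inverses of the integers enter three times: primitives keep their coefficients in R_p, a
    vanishing gradient modulo an ideal forces a constant, and integer combinations of generators
    replace prime avoidance. *)

Section DerivationDegree.
Variables (B : idomainType) (D : B -> B).
Hypothesis (DD : {morph D : x y / x + y}).
Hypothesis (DM : forall x y, D (x * y) = D x * y + x * D y).
Hypothesis char0 : forall n, n.+1%:R != 0 :> B.

Lemma der0 : D 0 = 0.
Proof. by apply: (addrI (D 0)); rewrite -DD !addr0. Qed.

Lemma der_iterD n x y : iter n D (x + y) = iter n D x + iter n D y.
Proof. by elim: n => //= n ->; rewrite DD. Qed.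

Lemma der_iter0 n : iter n D 0 = 0.
Proof. by elim: n => //= n ->; rewrite der0. Qed.

Lemma der_iter_eq0 n k x : iter n D x = 0 -> (n <= k)%N -> iter k D x = 0.
Proof. by move=> e /subnK <-; rewrite iterD e der_iter0. Qed.

(** In the Leibniz expansion of D^(m+n)(xy), every other term differentiates x more than m times or
    y more than n times. Pascal's rule produces the binomial coefficient. *)
Lemma der_iter_mul m n x y : iter m.+1 D x = 0 -> iter n.+1 D y = 0 ->
  iter (m + n) D (x * y) = (iter m D x * iter n D y) *+ 'C(m + n, m).
Proof.
have [k] := ubnP (m + n); elim: k m n x y => // k IH m n x y.
case: m => [|m] lt ex ey.
  rewrite bin0 mulr1n add0n /=; elim: (n) => //= j ->.
  by rewrite DM [D x]ex mul0r add0r.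
case: n lt ey => [|n] lt ey.
  rewrite addn0 binn mulr1n; elim: (m.+1) => //= j ->.
  by rewrite DM [D y]ey mulr0 addr0.
have e1 : iter (m + n.+1) D (D x * y) =
    (iter m.+1 D x * iter n.+1 D y) *+ 'C(m + n.+1, m).
  by have := IH m n.+1 (D x) y; rewrite -!iterSr => -> //; move: lt; rewrite addSn.
have e2 : iter (m.+1 + n) D (x * D y) =
    (iter m.+1 D x * iter n.+1 D y) *+ 'C(m.+1 + n, m.+1).
  by have := IH m.+1 n x (D y); rewrite -!iterSr => -> //; move: lt; rewrite addnS.
rewrite addSn iterSr DM der_iterD e1 -addSnnS e2 -mulrnDr.
by rewrite binS addnC.
Qed.

(** The degree attached to a locally nilpotent derivation; it behaves like the degree in a variable
    t with D = d/dt. It is a relation because 0 has no degree. *)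
Definition der_deg x n := iter n D x <> 0 /\ iter n.+1 D x = 0.

Lemma der_degM x y m n : der_deg x m -> der_deg y n -> der_deg (x * y) (m + n).
Proof.
move=> [x0 x1] [y0 y1]; split; last first.
  rewrite iterS der_iter_mul // -mulr_natr DM DM.
  rewrite -!iterS x1 y1 mul0r mulr0 addr0 mul0r add0r.
  suff -> : D ('C(m + n, m)%:R) = 0 by rewrite mulr0.
  have D1 : D 1 = 0.
    by apply: (addrI (D 1)); rewrite addr0 -{3}[1]mulr1 DM mulr1 mul1r.
  by elim: ('C(_, _)) => [|j IH]; rewrite ?der0 // -natr1 DD IH D1 addr0.
rewrite der_iter_mul // -mulr_natr => /eqP; rewrite !mulf_eq0 => /orP[/orP[]|].
- by move/eqP.
- by move/eqP.
have : (0 < 'C(m + n, m))%N by rewrite bin_gt0 leq_addr.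
by case: ('C(_, _)) => // j _; apply/negP/char0.
Qed.

Lemma der_deg_exists x : x <> 0 -> (exists n, iter n D x = 0) ->
  exists n, der_deg x n.
Proof.
move=> x0 [n]; elim: n => [//|n IH] e.
by have [/IH //|nz] := pselect (iter n D x = 0); exists n.
Qed.

(** If c had degree m, then for g of degree k the product c g would have degree m + k while D g has
    smaller degree. The twisted operator would thus send nonzero elements to nonzero elements and
    never kill 1. *)
Lemma der_twist_nilp c : (forall x, exists n, iter n D x = 0) ->
  (exists n, iter n (fun g => D g + c * g) 1 = 0) -> c = 0.
Proof.
move=> lnD [N eN]; apply: contrapT => c0.
have [m dc] := der_deg_exists c0 (lnD c).
pose T g := D g + c * g.
suff /(_ N) [k] : forall n, exists k, der_deg (iter n T 1) k.
  by rewrite [iter N T 1]eN => -[]; rewrite der_iter0.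
elim=> [|n [k [k0 k1]]].
  by apply: der_deg_exists; [apply/eqP/oner_neq0|apply: lnD].
have [h0 h1] := der_degM dc (conj k0 k1).
exists (m + k)%N; split.
  rewrite /= {1}/T der_iterD -iterSr (der_iter_eq0 k1) ?ltnS ?leq_addl //.
  by rewrite add0r.
rewrite [iter n.+1 T 1]/= {1}/T der_iterD -iterSr (der_iter_eq0 k1).
  by rewrite add0r.
by rewrite ltnS (leq_trans (leq_addl m k)).
Qed.

End DerivationDegree.

Section BivariateCalculus.
Variable K : fieldType.
Local Notation P := {poly {poly K}}.
Hypothesis char0 : forall n, n.+1%:R != 0 :> K.

(** The outer indeterminate is Y and the inner one is X, so the coordinate X is ['X%:P] and the
    coordinate Y is ['X]. *)
Definition dY : P -> P := @deriv {poly K}.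
Definition dX : P -> P := map_poly (@deriv K).
HB.instance Definition _ := GRing.Additive.copy dY (@deriv {poly K}).
HB.instance Definition _ := GRing.Additive.copy dX (map_poly (@deriv K)).

Lemma coef_dX f i : (dX f)`_i = deriv f`_i.
Proof. exact: coef_map. Qed.

Lemma coef_dY f i : (dY f)`_i = f`_i.+1 *+ i.+1.
Proof. exact: coef_deriv. Qed.

Lemma dXB f g : dX (f - g) = dX f - dX g. Proof. exact: raddfB. Qed.
Lemma dYB f g : dY (f - g) = dY f - dY g. Proof. exact: raddfB. Qed.

Lemma dXN f : dX (- f) = - dX f. Proof. exact: raddfN. Qed.
Lemma dYN f : dY (- f) = - dY f. Proof. exact: raddfN. Qed.
Lemma dX_polyC p : dX p%:P = (p^`())%:P. Proof. exact: map_polyC. Qed.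
Lemma dX_X : dX 'X = 0.
Proof.
by apply/polyP => i; rewrite coef_dX coefX coef0; case: eqP; rewrite ?deriv0 // derivC.
Qed.
Lemma dY_X : dY 'X = 1. Proof. exact: derivX. Qed.

Lemma dXM f g : dX (f * g) = dX f * g + f * dX g.
Proof.
apply/polyP => i; rewrite coefD coef_dX !coefM raddf_sum -big_split /=.
by apply: eq_bigr => j _; rewrite derivM !coef_dX.
Qed.

Lemma dYM f g : dY (f * g) = dY f * g + f * dY g.
Proof. exact: derivM. Qed.

Lemma dXY f : dX (dY f) = dY (dX f).
Proof. by apply/polyP => i; rewrite coef_dX !coef_dY coef_dX derivMn. Qed.

Lemma dXC c : dX c%:P%:P = 0.
Proof. by rewrite /dX map_polyC /= derivC. Qed.

Lemma dYC (c : {poly K}) : dY c%:P = 0.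
Proof. exact: derivC. Qed.

Definition vf (a b f : P) := a * dX f + b * dY f.

Lemma vf_zmod a b : {morph vf a b : x y / x + y}.
Proof. by move=> x y; rewrite /vf !raddfD !mulrDr addrACA. Qed.

Lemma vfM a b x y : vf a b (x * y) = vf a b x * y + x * vf a b y.
Proof. by rewrite /vf dXM dYM; ring. Qed.

Lemma vfB a b x y : vf a b (x - y) = vf a b x - vf a b y.
Proof. by rewrite /vf !raddfB !mulrBr; ring. Qed.

Lemma vfC a b c : vf a b c%:P%:P = 0.
Proof. by rewrite /vf dXC dYC !mulr0 addr0. Qed.

Lemma natP_neq0 n : n.+1%:R != 0 :> P.
Proof.
by rewrite -!polyC_natr !polyC_eq0.
Qed.

(* The vector field acts on 2-forms by g |-> D g + div(D) g, and this action is
   locally nilpotent because it comes from the action of D on functions. *)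
Lemma lnd_div0 a b : (forall f, exists n, iter n (vf a b) f = 0) ->
  dX a + dY b = 0.
Proof.
move=> ln; set c := _ + _; pose D := vf a b; pose T g := D g + c * g.
apply: (der_twist_nilp (vf_zmod a b) (vfM a b) natP_neq0 ln).
(* [J u v] is the coefficient of the 2-form du /\ dv, and T is the Lie derivative along D. By the
   Leibniz rule [TJ] each application of T applies D to u or to v, and dX /\ dY has coefficient
   1. *)
pose J u v := dX u * dY v - dY u * dX v.
have TJ u v : T (J u v) = J (D u) v + J u (D v).
  rewrite /T /J /D /c /vf !(raddfB, raddfD, dXM, dYM) /= !dXM !dYM !dXY; ring.
have J0 : J 'X%:P 'X = 1.
  rewrite /J /dX /dY derivX derivC map_polyC /= derivX mulr1 mul0r subr0.
  by [].
have TD : {morph T : x y / x + y}.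
  by move=> x y; rewrite /T /D vf_zmod; ring.
have T0 : T 0 = 0 by apply: (addrI (T 0)); rewrite -TD !addr0.
have D0 n : iter n D 0 = 0 by apply: (der_iter0 (vf_zmod a b)).
have J0l v : J 0 v = 0 by rewrite /J !raddf0 !mul0r subr0.
have J0r u : J u 0 = 0 by rewrite /J !raddf0 !mulr0 subr0.
have key m n u v : iter m D u = 0 -> iter n D v = 0 ->
    iter (m + n) T (J u v) = 0.
  have T0n k : iter k T 0 = 0 by elim: k => //= k ->.
  have TDn k x y : iter k T (x + y) = iter k T x + iter k T y.
    by elim: k => //= k ->; rewrite TD.
  have [k] := ubnP (m + n); elim: k m n u v => // k IH [|m] [|n] u v lt.
  - by move=> e _; rewrite [u]e J0l T0n.
  - by move=> e _; rewrite [u]e J0l T0n.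
  - by move=> _ e; rewrite [v]e J0r T0n.
  move=> eu ev; rewrite addSn iterSr TJ TDn.
  have -> : iter (m + n.+1) T (J (D u) v) = 0.
    by apply: IH; rewrite -?iterSr //; move: lt; rewrite addSn.
  have e2 : iter (m.+1 + n) T (J u (D v)) = 0.
    by apply: IH; rewrite -?iterSr //; move: lt; rewrite addnS.
  by rewrite add0r -addSnnS.
have [m em] := ln 'X%:P; have [n en] := ln 'X.
by exists (m + n)%N; rewrite -[X in iter _ _ X]J0; apply: key.
Qed.

End BivariateCalculus.

(** * McCoy's theorem and Gauss' lemma *)

Notation over2 S := (polyOver (polyOver_pred S)).

Definition prime_in (T : comNzRingType) (S Z : {pred T}) :=
  forall x y, x \in S -> y \in S -> x * y \in Z -> (x \in Z) || (y \in Z).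

Section McCoy.
Variables (T : comNzRingType).

(* McCoy's theorem for the T-module T/N, with several polynomials at once. *)
Lemma mccoy (N : zmodClosed T) (V : T -> Prop) (F : {poly T} -> Prop) :
  (forall f i x, F f -> x \in N -> f`_i * x \in N) ->
  (forall f i x, F f -> V x -> V (f`_i * x)) ->
  forall w : {poly T}, (forall i, V w`_i) -> w \isn't a polyOver N ->
    (forall f, F f -> f * w \is a polyOver N) ->
  exists x, [/\ V x, x \notin N & forall f i, F f -> f`_i * x \in N].
Proof.
move=> FN FV w.
have [n dw] : exists n, forall i, (n <= i)%N -> w`_i \in N.
  by exists (size w) => i le; rewrite nth_default // rpred0.
elim: n w dw => [|n IH] w dw Vw wN Fw.
  by case/negP: wN; apply/polyOverP => i; apply: dw.
have [wn|wn] := boolP (w`_n \in N).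
  by apply: IH Vw wN Fw => i; rewrite leq_eqVlt => /predU1P[<- //|/dw].
have [ok|] := pselect (forall f i, F f -> f`_i * w`_n \in N).
  by exists w`_n.
move=> /existsNP[f /existsNP[i0 /not_implyP[Ff /negP fw]]].
(* Take the last coefficient f_i that does not carry w into N. In the coefficient of f w at i + n
   all terms but f_i w_n lie in N, so f_i w is shorter than w modulo N while still outside N. *)
pose p i := ((f`_i)%:P * w \isn't a polyOver N).
have pE : exists i, p i.
  exists i0; apply/negP => /polyOverP /(_ n); rewrite coefCM; exact/negP.
have pB i : p i -> (i <= size f)%N.
  apply: contraLR; rewrite -ltnNge => lt; rewrite negbK nth_default 1?ltnW //.
  by rewrite polyC0 mul0r rpred0.
have [i pi imax] := ex_maxnP pE pB.
apply: (IH ((f`_i)%:P * w)) => //.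
- move=> j; rewrite leq_eqVlt coefCM => /predU1P[<-|lt]; last first.
    by apply: FN => //; apply: dw.
  have := polyOverP (Fw f Ff) (i + n)%N; rewrite coefM.
  have lt : (i < (i + n).+1)%N by rewrite ltnS leq_addr.
  rewrite (bigD1 (Ordinal lt)) //= addKn rpredDr // rpred_sum // => k.
  rewrite -val_eqE /= neq_ltn => /orP[ki|ki].
    by apply: FN => //; apply: dw; rewrite ltn_subRL ltn_add2r.
  have /negPn/polyOverP/(_ (i + n - k)%N) : ~~ p k.
    by apply: contraL ki => /imax; rewrite -leqNgt.
  by rewrite coefCM.
- by move=> j; rewrite coefCM; apply: FV.
move=> g Fg; rewrite mulrCA; apply/polyOverP => j; rewrite coefCM.
by apply: FN => //; apply: (polyOverP (Fw g Fg)).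
Qed.

Variables (S : subringClosed T) (Z : zmodClosed T).
Hypothesis ZS : forall x z, x \in S -> z \in Z -> x * z \in Z.

Hypothesis Zprime : prime_in S Z.

(** If g is not over Z, McCoy's theorem gives an x in S outside Z whose product with every
    coefficient of f lies in Z; primality then moves these coefficients into Z. *)
Lemma gauss f g : f \is a polyOver S -> g \is a polyOver S ->
  f * g \is a polyOver Z -> (f \is a polyOver Z) || (g \is a polyOver Z).
Proof.
move=> /polyOverP Sf /polyOverP Sg fg; have [//|gZ] := boolP (g \is a polyOver Z).
  by rewrite orbT.
have [|||||x [Sx xZ xf]] := @mccoy Z (fun x => x \in S) (fun h => h = f) _ _ g.
- by move=> h i x -> xZ; apply: ZS.
- by move=> h i x -> xS; apply: rpredM.
- by [].
- by [].
- by move=> h ->.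
rewrite orbF; apply/polyOverP => i.
by have /orP[//|] := Zprime (Sf i) Sx (xf f i erefl); rewrite (negPf xZ).
Qed.

(** Modulo a prime the leading coefficients multiply to a nonzero element, so degrees add up and a
    factor has no larger degree than the product. *)
Lemma degmod_factor f g n : f \is a polyOver S -> g \is a polyOver S ->
  g \isn't a polyOver Z -> (forall i, (n <= i)%N -> (f * g)`_i \in Z) ->
  forall i, (n <= i)%N -> f`_i \in Z.
Proof.
move=> /polyOverP Sf /polyOverP Sg gZ fgZ.
have maxc h k : h`_k \notin Z ->
    exists2 m, (k <= m)%N & h`_m \notin Z /\ forall i, (m < i)%N -> h`_i \in Z.
  move=> hk; pose p i := h`_i \notin Z.
  have pB i : p i -> (i <= size h)%N.
    by apply: contraLR; rewrite -ltnNge negbK => lt; rewrite nth_default ?rpred0 1?ltnW.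
  have [m pm mmax] := ex_maxnP (ex_intro p k hk) pB.
  exists m; first exact: mmax.
  split=> // i; apply: contraLR => /mmax; by rewrite -leqNgt.
move=> i0 ni0; apply/negPn/negP => /maxc[i /(leq_trans ni0) ni [fi imax]].
have [k0 gk0] : exists k, g`_k \notin Z.
  apply: contrapT => /forallNP gk; case/negP: gZ; apply/polyOverP => k.
  by apply/negPn/negP; apply: gk.
have [j _ [gj jmax]] := maxc _ _ gk0.
have := fgZ (i + j)%N (leq_trans ni (leq_addr _ _)); rewrite coefM.
have lt : (i < (i + j).+1)%N by rewrite ltnS leq_addr.
rewrite (bigD1 (Ordinal lt)) //= addKn rpredDr => [/Zprime|].
  by move/(_ (Sf i) (Sg j)); rewrite (negPf fi) (negPf gj).
apply: rpred_sum => k; rewrite -val_eqE /= neq_ltn => /orP[ki|ki].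
  by apply: ZS => //; apply: jmax; rewrite ltn_subRL ltn_add2r.
by rewrite mulrC; apply: ZS => //; apply: imax.
Qed.

End McCoy.

(** * Kernels and slices of Hamiltonian derivations *)

Section Evaluation.
Variable K : fieldType.
Local Notation P := {poly {poly K}}.

Definition ev (F : P) (a : {poly K}) : P := map_poly polyC a \Po F.
HB.instance Definition _ F :=
  GRing.RMorphism.copy (ev F) (comp_poly F \o map_poly polyC).

Lemma evD F a b : ev F (a + b) = ev F a + ev F b. Proof. exact: rmorphD. Qed.
Lemma evN F a : ev F (- a) = - ev F a. Proof. exact: rmorphN. Qed.
Lemma evM F a b : ev F (a * b) = ev F a * ev F b. Proof. exact: rmorphM. Qed.
Lemma ev0 F : ev F 0 = 0. Proof. exact: rmorph0. Qed.
Lemma ev1 F : ev F 1 = 1. Proof. exact: rmorph1. Qed.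

Lemma evC F c : ev F c%:P = c%:P%:P.
Proof. by rewrite /ev map_polyC comp_polyC. Qed.

Lemma evX F : ev F 'X = F.
Proof. by rewrite /ev map_polyX comp_polyX. Qed.

Lemma ev_chain (D : P -> P) (F : P) a :
  {morph D : x y / x + y} -> (forall x y, D (x * y) = D x * y + x * D y) ->
  (forall c : K, D c%:P%:P = 0) -> D (ev F a) = ev F a^`() * D F.
Proof.
move=> DD DM DC; elim/poly_ind: a => [|a c IH].
  by rewrite deriv0 !rmorph0 mul0r -[0]polyC0 -[0 in LHS]polyC0 DC polyC0.
rewrite rmorphD rmorphM /= evC evX DD DM DC IH derivD derivC derivM derivX.
by rewrite addr0 addr0 mulr1 rmorphD rmorphM /= evX; ring.
Qed.

Lemma dX_ev F a : dX (ev F a) = ev F a^`() * dX F.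
Proof. by apply: ev_chain; [exact: raddfD|exact: dXM|exact: dXC]. Qed.

Lemma dY_ev F a : dY (ev F a) = ev F a^`() * dY F.
Proof. by apply: ev_chain; [exact: raddfD|exact: dYM|move=> c; exact: dYC]. Qed.

Lemma ev_over (S : subringClosed K) F a :
  F \is a over2 S -> a \is a polyOver S ->
  ev F a \is a over2 S.
Proof.
move=> SF /polyOverP Sa; apply: polyOver_comp => //; apply/polyOverP => i.
by rewrite coef_map polyOverC.
Qed.

(** A nonzero derivative in Y forces a positive degree in Y, and substituting a nonconstant
    polynomial is injective. *)
Lemma ev_eq0 F a : dY F != 0 -> (ev F a == 0) = (a == 0).
Proof.
move=> F0; rewrite /ev comp_poly_eq0 ?map_polyC_eq0 //.
rewrite ltnNge; apply: contra F0 => /size1_polyC ->; by rewrite dYC.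
Qed.

Lemma ham_ev F a : vf (dY F) (- dX F) (ev F a) = 0.
Proof. by rewrite /vf dX_ev dY_ev; ring. Qed.

End Evaluation.

Section Primitives.
Variable K : fieldType.
Local Notation P := {poly {poly K}}.
Hypothesis char0 : forall n, n.+1%:R != 0 :> K.

(** At i = 0 the division by [0%:R] returns 0, so the constant of integration is 0. *)
Definition intK (p : {poly K}) := \poly_(i < (size p).+1) (p`_i.-1 / i%:R).

Lemma coef_intK p i : (intK p)`_i = p`_i.-1 / i%:R.
Proof.
rewrite coef_poly; case: ltnP => // lt; rewrite nth_default ?mul0r //.
by case: i lt.
Qed.

Lemma intK_zmod : zmod_morphism intK.
Proof. by move=> p q; apply/polyP => i; rewrite !(coefB, coef_intK) mulrBl. Qed.
HB.instance Definition _ :=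
  GRing.isZmodMorphism.Build {poly K} {poly K} intK intK_zmod.

Lemma intKK p : (intK p)^`() = p.
Proof.
apply/polyP => i; rewrite coef_deriv coef_intK /= -[LHS]mulr_natr.
by rewrite divfK.
Qed.

Definition intX (f : P) : P := map_poly intK f.

Lemma intXK f : dX (intX f) = f.
Proof. by apply/polyP => i; rewrite coef_dX coef_map intKK. Qed.

Definition intY (f : P) : P :=
  \poly_(i < (size f).+1) (f`_i.-1 * (i%:R^-1)%:P).

Lemma coef_intY f i : (intY f)`_i = f`_i.-1 * (i%:R^-1)%:P.
Proof.
rewrite coef_poly; case: ltnP => // lt; rewrite nth_default ?mul0r //.
by case: i lt.
Qed.

Lemma intYK f : dY (intY f) = f.
Proof.
apply/polyP => i; rewrite coef_dY coef_intY /= -[LHS]mulr_natr -mulrA -polyC_natr.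
by rewrite -polyCM mulVf // mulr1.
Qed.

Lemma dX_intY f : dX (intY f) = intY (dX f).
Proof.
apply/polyP => i; rewrite coef_dX !coef_intY coef_dX derivM derivC mulr0.
by rewrite addr0.
Qed.

(** The closed form u dX + v dY is integrated from the origin, along the X-axis and then parallel to
    the Y-axis. Only integers are inverted, so the coefficients stay in S. *)
Lemma primitive u v : dY u = dX v -> exists F,
  [/\ dX F = u, dY F = v, F`_0`_0 = 0 &
    forall S : subringClosed K, (forall n, n.+1%:R^-1 \in S) ->
    u \is a over2 S -> v \is a over2 S ->
    F \is a over2 S].
Proof.
move=> euv; exists (intY v + (intK u`_0)%:P); split.
- rewrite raddfD /= dX_intY -euv; apply/polyP => i.
  rewrite coefD coef_intY coef_dX coefC.
  case: i => [|i] /=; first by rewrite invr0 mulr0 add0r intKK.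
  rewrite raddf0 addr0 coef_dY -[X in X * _]mulr_natr -mulrA -polyC_natr -polyCM.
  by rewrite mulfV // mulr1.
- by rewrite raddfD /= intYK dYC addr0.
- rewrite coefD coefC /= coefD coef_intK coef_intY invr0 /= polyC0 !mulr0.
  by rewrite coef0 addr0.
move=> S SQ /polyOverP Su /polyOverP Sv.
have SV n : n%:R^-1 \in S by case: n => [|n]; rewrite ?invr0 ?rpred0.
rewrite rpredD ?polyOverC //; apply/polyOverP => i.
  by rewrite coef_intY rpredM // polyOverC.
by rewrite coef_intK rpredM //; apply: (polyOverP (Su 0%N)).
Qed.

Lemma lnd_hamiltonian a b : (forall f, exists n, iter n (vf a b) f = 0) ->
  exists F, [/\ a = dY F, b = - dX F, F`_0`_0 = 0 &
    forall S : subringClosed K, (forall n, n.+1%:R^-1 \in S) ->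
    a \is a over2 S -> b \is a over2 S ->
    F \is a over2 S].
Proof.
move=> ln; have div0 := lnd_div0 char0 ln.
have [|F [eX eY F0 FS]] := @primitive (- b) a.
  by apply: subr0_eq; rewrite raddfN /= -opprD addrC div0 oppr0.
exists F; split=> //; first by rewrite eX opprK.
by move=> S SQ Sa Sb; apply: FS => //; rewrite rpredN.
Qed.

End Primitives.

(* Otherwise [ring] unfolds the derivatives when it compares atoms. *)
#[global] Opaque dX dY ev intX intY.

Lemma polyOver_ideal (T : comNzRingType) (S : subringClosed T)
    (Z : zmodClosed T) :
  (forall x z, x \in S -> z \in Z -> x * z \in Z) ->
  forall f g : {poly T}, f \in polyOver_pred S -> g \in polyOver_pred Z ->
    f * g \in polyOver_pred Z.
Proof.
move=> ZS f g /polyOverP Sf /polyOverP Zg; apply/polyOverP => i.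
by rewrite coefM rpred_sum // => j _; apply: ZS.
Qed.

Section KernelModPrime.
Variables (K : fieldType) (S : subringClosed K) (Z : zmodClosed K).
Local Notation P := {poly {poly K}}.
Hypothesis char0 : forall n, n.+1%:R != 0 :> K.
Hypothesis SQ : forall n, n.+1%:R^-1 \in S.
Hypothesis ZS : forall x z, x \in S -> z \in Z -> x * z \in Z.
Hypothesis Zprime : prime_in S Z.

Lemma over2P (N : addrClosed K) (f : P) :
  reflect (forall i j, f`_i`_j \in N) (f \is a over2 N).
Proof.
apply: (iffP polyOverP) => h i; first by move=> j; apply: (polyOverP (h i)).
by apply/polyOverP.
Qed.

Lemma over2_ideal (f g : P) : f \is a over2 S -> g \is a over2 Z ->
  f * g \is a over2 Z.
Proof. exact: (polyOver_ideal (polyOver_ideal ZS)). Qed.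

Lemma dX_over (N : addrClosed K) (f : P) :
  f \is a over2 N -> dX f \is a over2 N.
Proof.
move=> /over2P Nf; apply/over2P => i j; rewrite coef_dX coef_deriv.
by rewrite rpredMn.
Qed.

Lemma dY_over (N : addrClosed K) (f : P) :
  f \is a over2 N -> dY f \is a over2 N.
Proof.
move=> /over2P Nf; apply/over2P => i j; rewrite coef_dY coefMn.
by rewrite rpredMn.
Qed.

Lemma divn_in x n : x *+ n.+1 \in Z -> x \in Z.
Proof.
move=> Zx; have := ZS (SQ n) Zx.
by rewrite -[x *+ _]mulr_natl mulKf.
Qed.

(** A nonconstant coefficient appears in the gradient multiplied by a positive integer, and such
    integers are invertible in S. *)
Lemma const_mod (f : P) : dX f \is a over2 Z -> dY f \is a over2 Z ->
  f - (f`_0`_0)%:P%:P \is a over2 Z.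
Proof.
move=> /over2P ZX /over2P ZY; apply/over2P => -[|i] j.
  rewrite coefB coefC /= coefB coefC; case: j => [|j] /=.
    by rewrite subrr rpred0.
  by rewrite subr0; apply: (@divn_in _ j); rewrite -coef_deriv -coef_dX.
rewrite coefB coefC subr0; apply: (@divn_in _ i); rewrite -coefMn -coef_dY.
exact: ZY.
Qed.

Variable F : P.
Local Notation D := (vf (dY F) (- dX F)).
Hypothesis SF : F \is a over2 S.
Hypothesis FZ : dY F \isn't a over2 Z.

(* On the kernel of D, the gradient of p is a multiple q of the gradient of F;
   q plays the role of dp/dF, it is in the kernel again and has smaller degree
   in Y. *)
Lemma kernel_mod :
  (forall p, p \is a over2 S -> D p \is a over2 Z -> exists q,
    [/\ q \is a over2 S, dX p - q * dX F \is a over2 Z &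
        dY p - q * dY F \is a over2 Z]) ->
  forall p, p \is a over2 S -> D p \is a over2 Z ->
    exists2 a, a \is a polyOver S & p - ev F a \is a over2 Z.
Proof.
move=> grad p Sp Dp.
have [n dp] : exists n, forall i, (n <= i)%N -> p`_i \is a polyOver Z.
  by exists (size p) => i le; rewrite nth_default // rpred0.
elim: n p dp Sp Dp => [|n IH] p dp Sp Dp.
  exists 0; rewrite ?rpred0 // rmorph0 subr0; apply/polyOverP => i; exact: dp.
have [q [Sq qX qY]] := grad p Sp Dp.
have ZSpoly := polyOver_ideal ZS.
(* Modulo Z the product q dF/dY is dp/dY, of degree below n in Y, and dF/dY is not zero; so q has
   degree below n. *)
have dq i : (n <= i)%N -> q`_i \is a polyOver Z.
  have Zp : prime_in (polyOver_pred S) (polyOver_pred Z).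
    by move=> x y; apply: (gauss ZS).
  move: i; apply: (degmod_factor ZSpoly Zp Sq (dY_over SF) FZ) => i le.
  rewrite -(subrK (dY p) (q * dY F)) coefD rpredD //.
    by apply: (polyOverP (_ : _ \is a over2 Z)); rewrite -rpredN opprB.
  by rewrite coef_dY rpredMn //; apply: dp.
(* Modulo Z the form q dF equals dp, hence is closed, and d(q dF) has coefficient D q. *)
have Dq : D q \is a over2 Z.
  have -> : D q = dY (dX p - q * dX F) - dX (dY p - q * dY F).
    rewrite dYB dXB dXY dXM dYM dXY /vf.
    by move: (dY (dX p)) (dY (dX F)) (dX q) (dY q) (dX F) (dY F) => *; ring.
  by rewrite rpredB // ?dX_over ?dY_over.
have [b Sb qb] := IH q dq Sq Dq.
(* With q congruent to b(F), the gradients of p and of the primitive of b evaluated at F agree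
   modulo Z; their difference is a constant. *)
pose p1 := p - ev F (intK b).
have Z1 : dX p1 \is a over2 Z.
  rewrite dXB dX_ev intKK //.
  have -> : dX p - ev F b * dX F = (dX p - q * dX F) + dX F * (q - ev F b).
    by ring.
  by rewrite rpredD // over2_ideal // dX_over.
have Z2 : dY p1 \is a over2 Z.
  rewrite dYB dY_ev intKK //.
  have -> : dY p - ev F b * dY F = (dY p - q * dY F) + dY F * (q - ev F b).
    by ring.
  by rewrite rpredD // over2_ideal // dY_over.
have Sb1 : intK b \is a polyOver S.
  apply/polyOverP => i; rewrite coef_intK rpredM ?(polyOverP Sb) //.
  by case: i => [|i]; rewrite ?invr0 ?rpred0.
have Sp1 : p1 \is a over2 S by rewrite rpredB // ev_over.
exists (intK b + (p1`_0`_0)%:P).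
  by rewrite rpredD // polyOverC; apply/over2P.
by rewrite rmorphD /= evC opprD addrA -/p1 const_mod.
Qed.

End KernelModPrime.

Section TrivialPredicates.
Variable T : comNzRingType.
(** The choices S = K and Z = 0 turn the results modulo a prime of S into results over the field and
    over S itself. *)
Definition full_pred : {pred T} := fun _ => true.
Definition zero_pred : {pred T} := fun x => x == 0.
Lemma full_pred_subring : GRing.subring_closed full_pred. Proof. by []. Qed.
Lemma zero_pred_zmod : zmod_closed zero_pred.
Proof.
split; first exact: eqxx.
by move=> x y /eqP -> /eqP ->; rewrite subr0; apply: eqxx.
Qed.
HB.instance Definition _ :=
  GRing.isSubringClosed.Build T full_pred full_pred_subring.
HB.instance Definition _ := GRing.isZmodClosed.Build T zero_pred zero_pred_zmod.
End TrivialPredicates.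
Arguments full_pred {T}.
Arguments zero_pred {T}.

Section KernelAndSlice.
Variables (K : fieldType).
Local Notation P := {poly {poly K}}.
Hypothesis char0 : forall n, n.+1%:R != 0 :> K.

Lemma over2_full (f : P) : f \is a over2 full_pred.
Proof. by apply/polyOverP => i; apply/polyOverP. Qed.

Lemma over2_zero (f : P) : (f \is a over2 zero_pred) = (f == 0).
Proof.
apply/idP/eqP => [/over2P h|->]; last exact: rpred0.
by apply/polyP => i; apply/polyP => j; rewrite !coef0; apply/eqP/h.
Qed.

(** The case Z = 0 of [kernel_mod]: D p = 0 is a relation between the components of D with the
    partial derivatives of p as coefficients, and the hypothesis makes the gradient of p a multiple
    of that of F. *)
Lemma kernel_over (S : subringClosed K) (F : P) :
  (forall n, n.+1%:R^-1 \in S) -> F \is a over2 S -> dY F != 0 ->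
  (forall u v, u \is a over2 S -> v \is a over2 S ->
     u * dY F + v * - dX F = 0 -> exists2 q, q \is a over2 S &
     u = q * dX F /\ v = q * dY F) ->
  forall p, p \is a over2 S -> vf (dY F) (- dX F) p = 0 ->
    exists2 a, a \is a polyOver S & p = ev F a.
Proof.
move=> SQ SF F0 grad p Sp Dp.
have ZS x z : x \in S -> z \in zero_pred -> x * z \in zero_pred.
  by move=> _ /eqP ->; rewrite mulr0; apply/eqP.
have Zp : prime_in S zero_pred.
  by move=> x y _ _; rewrite /zero_pred !unfold_in mulf_eq0.
have FZ : dY F \isn't a over2 zero_pred by rewrite over2_zero.
have [q Sq||a Sa] := kernel_mod char0 SQ ZS Zp SF FZ _ Sp.
- rewrite over2_zero => /eqP Dq.
  have [|||r Sr [eX eY]] := grad (dX q) (dY q); rewrite ?dX_over ?dY_over //.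
    by rewrite -[RHS]Dq /vf; ring.
  by exists r; rewrite !over2_zero -eX -eY !subrr eqxx.
- by rewrite over2_zero Dp.
by rewrite over2_zero subr_eq0 => /eqP; exists a.
Qed.

Lemma deriv_eq0 (p : {poly K}) : p^`() = 0 -> p = (p`_0)%:P.
Proof.
move=> e; apply/polyP => -[|i]; rewrite coefC //=.
have /eqP := congr1 (fun q : {poly K} => q`_i) e.
by rewrite coef_deriv coef0 -mulr_natr mulf_eq0 (negPf (char0 i)) orbF => /eqP.
Qed.

Variables (F u v : P).
Local Notation D := (vf (dY F) (- dX F)).
Hypothesis lnd : forall f, exists n, iter n D f = 0.
Hypothesis comax : u * dY F + v * - dX F = 1.
Hypothesis F0 : dY F != 0.

Let im e := exists g, D g = e.

Lemma imD e f : im e -> im f -> im (e + f).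
Proof. by move=> [g <-] [h <-]; exists (g + h); apply: vf_zmod. Qed.

Lemma im_ev a e : im e -> im (ev F a * e).
Proof. by move=> [g <-]; exists (ev F a * g); rewrite vfM ham_ev mul0r add0r. Qed.

Lemma im_evC c e : c != 0 -> im (ev F c%:P * e) -> im e.
Proof.
move=> c0 /(im_ev c^-1%:P); rewrite mulrA -evM -polyCM mulVf //.
by rewrite ev1 mul1r.
Qed.

(** Exactness of the Koszul complex of a unimodular pair: contraction with the Bezout coefficients
    (u, v) yields the multiplier. *)
Lemma comax_grad u' v' : u' * dY F + v' * - dX F = 0 ->
  u' = (u * v' - v * u') * dX F /\ v' = (u * v' - v * u') * dY F.
Proof.
move=> e; split.
  transitivity (u' * (u * dY F + v * - dX F)); first by rewrite comax mulr1.
  transitivity (u * (u' * dY F + v' * - dX F) + (u * v' - v * u') * dX F).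
    by ring.
  by rewrite e mulr0 add0r.
transitivity (v' * (u * dY F + v * - dX F)); first by rewrite comax mulr1.
transitivity (v * (u' * dY F + v' * - dX F) + (u * v' - v * u') * dY F).
  by ring.
by rewrite e mulr0 add0r.
Qed.

Lemma kernel_field p : D p = 0 -> exists a, p = ev F a.
Proof.
move=> Dp; have [||||a _ ea] := @kernel_over full_pred F _ _ F0 _ p _ Dp.
- by [].
- exact: over2_full.
- move=> u' v' _ _ /comax_grad e; exists (u * v' - v * u') => //; exact: over2_full.
- exact: over2_full.
by exists a.
Qed.

(** The element z is a local slice: D z = c is a nonzero element a(F) of the kernel. If D^m e = 0,
    then c^m e is in the image. *)
Lemma im_torsion e : exists2 a, a != 0 & im (ev F a * e).
Proof.
have DX : D 'X%:P = dY F.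
  by rewrite /vf dYC mulr0 addr0 dX_polyC derivX mulr1.
have [n [n0 n1]] : exists n, der_deg D (dY F) n.
  exact: (der_deg_exists (elimN eqP F0)).
pose z := iter n D 'X%:P; pose c := iter n D (dY F).
have Dz : D z = c by rewrite -[LHS]/(iter n.+1 D 'X%:P) iterSr DX.
have [a ea] : exists a, c = ev F a by apply: kernel_field; exact: n1.
have a0 : a != 0 by apply/eqP => a0; apply: n0; rewrite -/c ea a0 ev0.
have [m em] := lnd e; exists (a ^+ m); first exact: expf_neq0.
(* Integration by parts: (k+1) c^(m+1) z^k e differs from D(c^m z^(k+1) e) by c^m z^(k+1) D e, to
   which the induction applies. Hence the statement for all powers of z. *)
suff /(_ 0%N) : forall k, im (ev F (a ^+ m) * (z ^+ k * e)) by rewrite mul1r.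
elim: m e em => [|m IH] e em k; first by rewrite [e]em !mulr0; exists 0; apply: der0 (vf_zmod _ _).
have [|g eg] := IH (D e) _ k.+1; first by rewrite -iterSr.
apply: (@im_evC k.+1%:R) => //.
exists (ev F (a ^+ m) * (z ^+ k.+1 * e) - g).
have DzX : forall j, D (z ^+ j.+1) = (z ^+ j * c) *+ j.+1.
  elim=> [|j IHj]; first by rewrite !expr1 expr0 mul1r.
  rewrite exprS vfM IHj Dz -mulrnAr mulrA -exprS mulrnAr [RHS]mulrS.
  by rewrite [c * _]mulrC.
rewrite vfB eg vfM ham_ev mul0r add0r vfM DzX mulrDr addrK exprS !evM.
rewrite -ea evC !polyC_natr -/c.
by rewrite -[(z ^+ k * c) *+ _]mulr_natl; move: (_ %:R) => *; ring.
Qed.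

(* For a function [e], write [e] as the curl of a 1-form [w]; contracting [w]
   with D gives [e'].  Modulo the image of D this is an inverse of "d/dF". *)
Lemma antideriv e : exists e', forall b, im (ev F b * e') ->
  im (ev F b * e - ev F b^`() * e').
Proof.
pose w := intX e; exists (w * - dX F) => b [g Dg].
(* When D g = b(F) e', the form b(F) w dY - dg is killed by contraction with D, so it equals h dF.
   Comparing exterior derivatives gives D h = b(F) e - b'(F) e'. *)
have [|hX hY] := @comax_grad (- dX g) (ev F b * w - dY g).
  transitivity (ev F b * (w * - dX F) - D g); first by rewrite /vf; ring.
  by rewrite Dg subrr.
set h := _ - _ in hX hY; exists h; have e1 : dX (ev F b * w) - dX (dY g) = dX h * dY F + h * dX (dY F).
  by rewrite -dXB hY dXM.
have e2 : - dX (dY g) = dY h * dX F + h * dX (dY F).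
  by rewrite dXY -[LHS]dYN hX dYM -dXY.
have -> : D h = dX (ev F b * w) - dX (dY g) - - dX (dY g).
  by rewrite e1 e2 /vf; ring.
by rewrite dXM dX_ev intXK //; ring.
Qed.

(** The module B/DB over K[F] is torsion, and it has no torsion. Let g kill e, let e' be the
    antiderivative of e and b its minimal annihilator. Then b(F) e - b'(F) e' is in the image;
    multiplying by g shows that b divides g b'. In characteristic 0 this forces b to be constant or
    g to have a proper factor in common with b, on which one inducts. *)
Lemma ham_slice : exists f, D f = 1.
Proof.
suff key : forall n (g : {poly K}) e, (size g <= n)%N -> g != 0 -> im (ev F g * e) -> im e.
  have [a a0 ia] := im_torsion 1; exact: (key (size a) a 1 (leqnn _) a0 ia).
elim=> [|n IH] g e; first by rewrite leqn0 size_poly_eq0 => /eqP ->; rewrite eqxx.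
move=> le g0 ige.
have [le1|gt1] := leqP (size g) 1.
  by move: ige g0; rewrite (size1_polyC le1) polyC_eq0 => ige /im_evC; apply.
have [e' ee'] := antideriv e.
pose ann k := `[< exists b : {poly K}, [/\ b != 0, size b = k & im (ev F b * e')] >].
have annE : exists k, ann k.
  by have [b b0 ib] := im_torsion e'; exists (size b); apply/asboolP; exists b.
case: (ex_minnP annE) => k /asboolP[b [b0 sb ib]] kmin.
have bmin (c : {poly K}) : im (ev F c * e') -> (size c < size b)%N -> c = 0.
  move=> ic; apply: contraTeq => c0; rewrite -leqNgt sb; apply: kmin.
  by apply/asboolP; exists c.
(* If b' = 0, then b is a nonzero constant and e' is in the image, so the relation for the
   polynomial 1 in place of b puts e there. *)
suff [//|db0] : im e \/ b^`() = 0.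
  have eb := deriv_eq0 db0; have ie' : im e'.
    by move: ib b0; rewrite eb polyC_eq0 => ib /im_evC; apply.
  have := ee' 1; rewrite ev1 !mul1r derivC ev0 mul0r subr0; exact.
have db_lt : (size b^`() < size b)%N by rewrite lt_size_deriv.
have igdb : im (ev F (g * b^`()) * e').
  have -> : ev F (g * b^`()) * e' =
      ev F b * (ev F g * e) + ev F (- g) * (ev F b * e - ev F b^`() * e').
    by rewrite !evM evN; ring.
  by apply: imD; apply: im_ev => //; apply: ee'.
have b_dvd : b %| g * b^`().
  apply/eqP/bmin; last by rewrite ltn_modp.
  have -> : ev F ((g * b^`()) %% b) * e' =
      ev F (g * b^`()) * e' + ev F (- (g * b^`() %/ b)) * (ev F b * e').
    rewrite {2}(divp_eq (g * b^`()) b) evD evM evN; ring.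
  by apply: imD => //; apply: im_ev.
pose d := gcdp b g.
have dg : d %| g by rewrite dvdp_gcdr.
have d0 : d != 0 by rewrite gcdp_eq0 (negPf b0).
(* If g divides b, then b(F) e is in the image and with it b'(F) e', so minimality of b gives b' =
   0. *)
have [ed|] := eqVneq (size d) (size g).
  have gb : g %| b.
    by rewrite -(eqp_dvdl _ (_ : d %= g)) ?dvdp_gcdl // -(dvdp_size_eqp dg) ed.
  have /dvdpP[q eq] := gb; right; apply: (bmin _ _ db_lt).
  have -> : ev F b^`() * e' = ev F q * (ev F g * e) +
      ev F (-1)%:P * (ev F b * e - ev F b^`() * e').
    by rewrite eq !evM evC !polyCN; ring.
  by apply: imD; apply: im_ev => //; apply: ee'.
move=> ned; have ltd : (size d < size g)%N by rewrite ltn_neqAle ned dvdp_leq.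
have [d1|dn1] := eqVneq (size d) 1%N.
  have cop : coprimep b g by rewrite /coprimep -/d d1.
  rewrite Gauss_dvdpr // in b_dvd.
  right; apply: contraTeq db_lt => /dvdp_leq /(_ b_dvd); by rewrite -leqNgt.
have gt1d : (1 < size d)%N.
  by rewrite ltn_neqAle eq_sym dn1 size_poly_gt0.
have /dvdpP[g1 eg] := dg.
have g10 : g1 != 0 by apply: contraNneq g0 => g10; rewrite eg g10 mul0r.
have lt1 : (size g1 < size g)%N.
  rewrite eg size_mul // -(prednK (ltnW gt1d)) addnS /= -[X in (X < _)%N]addn0.
  by rewrite ltn_add2l -ltnS prednK // ltnW.
(* The factors g1 and d of g are removed separately: g1(F) (d(F) e) is in the image, hence d(F) e,
   hence e. *)
left; apply: (IH d) => //; first by rewrite -ltnS (leq_trans ltd).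
apply: (IH g1) => //; first by rewrite -ltnS (leq_trans lt1).
by rewrite mulrA -evM -eg.
Qed.

End KernelAndSlice.

(** * Common factors in K[X][Y] *)

Section CommonFactors.
Variable K : fieldType.
Local Notation P := {poly {poly K}}.

Lemma irreducible_factor (r : {poly K}) : (1 < size r)%N ->
  exists2 q, irreducible_poly q & q %| r.
Proof.
have [n] := ubnP (size r); elim: n r => // n IH r lt r1.
have [ir|] := pselect (irreducible_poly r); first by exists r.
move=> /not_andP[//|/existsNP[q /not_implyP[q1 /not_implyP[qr qn]]]].
have r0 : r != 0 by rewrite -size_poly_gt0 ltnW.
have q0 : q != 0 by apply: contraNneq r0 => q0; rewrite q0 dvd0p in qr.
have ltq : (size q < size r)%N.
  rewrite ltn_neqAle dvdp_leq // andbT.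
  by apply: contra_not_neq qn => e; rewrite -(dvdp_size_eqp qr) e.
have [||q' iq' q'q] := IH q.
- exact: leq_trans ltq _.
- by rewrite ltn_neqAle eq_sym q1 size_poly_gt0.
by exists q' => //; apply: dvdp_trans q'q qr.
Qed.

Definition dvd_pred (q : {poly K}) : {pred {poly K}} := fun x => q %| x.
Lemma dvd_pred_zmod q : zmod_closed (dvd_pred q).
Proof.
by split=> [|x y qx qy]; rewrite !unfold_in ?dvdp0 // dvdp_sub.
Qed.
HB.instance Definition _ q :=
  GRing.isZmodClosed.Build {poly K} (dvd_pred q) (dvd_pred_zmod q).

Lemma polyOver_dvdP (q : {poly K}) (f : P) :
  reflect (exists g, f = q%:P * g) (f \is a polyOver (dvd_pred q)).
Proof.
apply: (iffP polyOverP) => [h|[g ->] i]; last first.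
  by rewrite coefCM unfold_in dvdp_mulr.
exists (\poly_(i < size f) (f`_i %/ q)); apply/polyP => i.
rewrite coefCM coef_poly; case: ltnP => [_|le]; last by rewrite nth_default ?mulr0.
by rewrite mulrC divpK //; apply: h.
Qed.

Lemma gauss_irr q (f g h : P) : irreducible_poly q -> f * g = q%:P * h ->
  (exists f', f = q%:P * f') \/ (exists g', g = q%:P * g').
Proof.
move=> iq e.
have ZS x z : x \in full_pred -> z \in dvd_pred q -> x * z \in dvd_pred q.
  by move=> _; rewrite !unfold_in => /dvdp_mull.
have Zp : prime_in full_pred (dvd_pred q).
  move=> x y _ _; rewrite !unfold_in => qxy; apply/orP.
  have [qx|qx] := boolP (q %| x); first by left.
  by right; rewrite -(Gauss_dvdpr _ (_ : coprimep q x)) ?irreducible_poly_coprime.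
have full (u : P) : u \is a polyOver full_pred by apply/polyOverP.
have /orP[/polyOver_dvdP|/polyOver_dvdP] : (f \is a polyOver (dvd_pred q)) ||
    (g \is a polyOver (dvd_pred q)); [|by left|by right].
by apply: (gauss ZS Zp) => //; apply/polyOver_dvdP; exists h.
Qed.

Lemma mulfIP (q : {poly K}) (f g : P) : q != 0 -> q%:P * f = q%:P * g -> f = g.
Proof. by move=> q0; apply: mulfI; rewrite polyC_eq0. Qed.

Lemma size1_inv (r : {poly K}) : (size r <= 1)%N -> r != 0 ->
  exists r', r' * r = 1.
Proof.
move=> /size1_polyC ->; rewrite polyC_eq0 => r0; exists (r`_0)^-1%:P.
by rewrite -polyCM mulVf.
Qed.

(** A common factor over K(X) becomes one over K[X]: by Gauss' lemma each irreducible factor of the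
    denominator r divides h or both cofactors, and can be cancelled. Only elements of K[X] are
    removed from h, so its degree in Y is preserved. *)
Lemma primitive_common_factor (r : {poly K}) (f g h f1 g1 : P) :
  r != 0 -> r%:P * f = h * f1 -> r%:P * g = h * g1 ->
  exists h' f' g' : P, [/\ size h' = size h, f = h' * f' & g = h' * g'].
Proof.
have [n] := ubnP (size r); elim: n r f g h f1 g1 => // n IH r f g h f1 g1 lt r0.
move=> ef eg; have [r1|r1] := leqP (size r) 1.
  have [r' er] := size1_inv r1 r0.
  exists h, (r'%:P * f1), (r'%:P * g1); split=> //.
    by rewrite mulrCA -ef mulrA -polyCM er mul1r.
  by rewrite mulrCA -eg mulrA -polyCM er mul1r.
have [q iq /dvdpP[r2 er]] := irreducible_factor r1.
have q0 : q != 0 by apply: irredp_neq0.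
have r20 : r2 != 0 by apply: contraNneq r0 => e; rewrite er e mul0r.
have lt2 : (size r2 < n)%N.
  move: lt; rewrite er size_mul // ltnS; apply: leq_trans.
  have [gt1 _] := iq; rewrite -(prednK (ltnW gt1)) addnS /=.
  by rewrite -[X in (X < _)%N]addn0 ltn_add2l -ltnS prednK // ltnW.
have dropq (u h' u1 : P) : r%:P * u = h' * u1 ->
    forall w, h' * u1 = q%:P * w -> r2%:P * u = w.
  by move=> e w e'; apply: (mulfIP q0); rewrite -e' -e er polyCM; ring.
have qf : h * f1 = q%:P * (r2%:P * f) by rewrite -ef er polyCM; ring.
have qg : h * g1 = q%:P * (r2%:P * g) by rewrite -eg er polyCM; ring.
have [[h' eh]|nh] := pselect (exists h', h = q%:P * h').
  have [||h'' [f' [g' [sz e1 e2]]]] := IH r2 f g h' f1 g1 lt2 r20.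
  - by apply: (dropq _ _ _ ef); rewrite eh mulrA.
  - by apply: (dropq _ _ _ eg); rewrite eh mulrA.
  exists h'', f', g'; split=> //.
  by rewrite sz eh mul_polyC size_scale.
have [//|[f2 ef2]] := gauss_irr iq qf.
have [//|[g2 eg2]] := gauss_irr iq qg.
apply: (IH r2 f g h f2 g2 lt2 r20).
  by apply: (dropq _ _ _ ef); rewrite ef2 mulrCA.
by apply: (dropq _ _ _ eg); rewrite eg2 mulrCA.
Qed.

Definition no_common_factor (f g : P) :=
  forall c f' g', f = c * f' -> g = c * g' -> exists c', c * c' = 1.

(** The gcd over K(X)[Y] yields a common factor in K[X][Y] of the same degree in Y. That factor is a
    unit, so the gcd lies in K[X] and the Bezout identity eliminates Y. *)
Lemma no_common_factor_bezout (f g : P) : no_common_factor f g ->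
  exists r x y, r != 0 /\ r%:P = x * f + y * g.
Proof.
move=> nc; pose d := Pdiv.Idomain.gcdp f g.
have d0 : d != 0.
  apply/eqP => d0; have := Pdiv.Idomain.gcdp_eq0 f g.
  rewrite -/d d0 eqxx => /esym/andP[/eqP f0 /eqP g0].
  have [||c /eqP] := nc 0 0 0; rewrite ?mul0r //.
  by rewrite eq_sym oner_eq0.
have /Pdiv.Idomain.dvdpP[[r1 f1] /= r10 e1] := Pdiv.Idomain.dvdp_gcdl f g.
have /Pdiv.Idomain.dvdpP[[r2 g1] /= r20 e2] := Pdiv.Idomain.dvdp_gcdr f g.
have E1 : r1%:P * f = f1 * d by rewrite mul_polyC.
have E2 : r2%:P * g = g1 * d by rewrite mul_polyC.
have [|||h [f' [g' [sz ef eg]]]] :=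
  @primitive_common_factor (r1 * r2) f g d (r2%:P * f1) (r1%:P * g1).
- by rewrite mulf_neq0.
- by rewrite polyCM mulrAC E1; ring.
- by rewrite polyCM -mulrA E2; ring.
have [c' ec] := nc h f' g' ef eg.
have sd : size d = 1%N.
  rewrite -sz; apply/eqP.
  have : h \is a GRing.unit by apply/unitrPr; exists c'.
  by rewrite poly_unitE => /andP[].
have [[x y] /= /Pdiv.Idomain.eqpP[[k1 k2] /= /andP[k10 k20] ek]] :=
  Pdiv.Idomain.Bezoutp f g.
have ed : d = (d`_0)%:P by apply: size1_polyC; rewrite sd.
exists (k2 * d`_0), (k1%:P * x), (k1%:P * y); split.
  by rewrite mulf_neq0 // -polyC_eq0 -ed.
by rewrite polyCM -ed mul_polyC -ek -mul_polyC mulrDr !mulrA.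
Qed.

(** The Bezout identity shows that v divides r u for some nonzero r in K[X], with quotient q. The
    irreducible factors of r are then cancelled one by one. *)
Lemma no_common_factor_dvd (f g u v y1 y2 : P) : no_common_factor f g ->
  f * u = v * y1 -> g * u = v * y2 -> exists w, u = v * w.
Proof.
move=> nc ef eg; have [v0|v0] := eqVneq v 0.
  exists 0; rewrite mulr0; apply/eqP; apply/negPn/negP => u0.
  have f0 : f = 0 by apply: (mulIf u0); rewrite ef v0 !mul0r.
  have g0 : g = 0 by apply: (mulIf u0); rewrite eg v0 !mul0r.
  have [||c /eqP] := nc 0 0 0; rewrite ?mul0r //.
  by rewrite eq_sym oner_eq0.
have [r [x [y [r0 er]]]] := no_common_factor_bezout nc.
have : exists q, r%:P * u = v * q.
  exists (x * y1 + y * y2); rewrite er.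
  transitivity (x * (f * u) + y * (g * u)); first by ring.
  by rewrite ef eg; ring.
have [n] := ubnP (size r); elim: n r r0 {er} => // n IH r r0 lt [q eq].
have [r1|r1] := leqP (size r) 1.
  have [r' er] := size1_inv r1 r0; exists (r'%:P * q).
  by rewrite mulrCA -eq mulrA -polyCM er mul1r.
have [p ip /dvdpP[r2 er]] := irreducible_factor r1.
have p0 : p != 0 by apply: irredp_neq0.
have r20 : r2 != 0 by apply: contraNneq r0 => e; rewrite er e mul0r.
have lt2 : (size r2 < n)%N.
  move: lt; rewrite er size_mul // ltnS; apply: leq_trans.
  have [gt1 _] := ip; rewrite -(prednK (ltnW gt1)) addnS /=.
  by rewrite -[X in (X < _)%N]addn0 ltn_add2l -ltnS prednK // ltnW.
(* Cancelling v shows that p divides f q and g q. If it did not divide q, it would be a common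
   factor of f and g. *)
suff [q' eq'] : exists q', q = p%:P * q'.
  apply: (IH r2) => //; exists q'; apply: (mulfIP p0).
  transitivity (r%:P * u); first by rewrite er polyCM; ring.
  by rewrite eq eq'; ring.
have qdvd k z : k * u = v * z -> k * q = p%:P * (r2%:P * z).
  move=> e; apply: (mulfI v0); rewrite mulrCA -eq er polyCM.
  transitivity (r2%:P * p%:P * (k * u)); first by ring.
  by rewrite e; ring.
have [[f' ef']|//] := gauss_irr ip (qdvd _ _ ef).
have [[g' eg']|//] := gauss_irr ip (qdvd _ _ eg).
have [c' /eqP] := nc p%:P f' g' ef' eg'.
have [gt1 _] := ip => /eqP ec.
have : p%:P \is a @GRing.unit P by apply/unitrPr; exists c'.
rewrite poly_unitE coefC eqxx poly_unitE => /and3P[_ /eqP sp _].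
by rewrite sp in gt1.
Qed.

End CommonFactors.

(** * Depth two for an irreducible Hamiltonian derivation *)

Section LocalDepth.
Variables (K : fieldType) (S : subringClosed K).
Local Notation P := {poly {poly K}}.
Hypothesis char0 : forall n, n.+1%:R != 0 :> K.
Hypothesis SQ : forall n, n.+1%:R^-1 \in S.

Lemma unitP_const (h h' : P) : h * h' = 1 ->
  exists2 c, c != 0 & h = c%:P%:P /\ h' = c^-1%:P%:P.
Proof.
move=> e; have : h \is a GRing.unit by apply/unitrPr; exists h'.
rewrite poly_unitE => /andP[/eqP s1]; rewrite poly_unitE => /andP[/eqP s2 c0].
pose c := h`_0`_0; have eh : h = c%:P%:P.
  by rewrite [LHS]size1_polyC ?s1 // [h`_0 in LHS]size1_polyC ?s2.
have {}c0 : c != 0 by rewrite -unitfE.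
exists c => //; split=> //; apply: (@mulfI _ h).
  by apply: contra_eq_neq e => ->; rewrite mul0r eq_sym oner_neq0.
by rewrite e eh -!polyCM mulfV.
Qed.

Lemma hamiltonian_depth (F G : P) :
  F \is a over2 S -> G \is a over2 S -> G`_0`_0 = 0 -> dY G != 0 ->
  (forall p, p \is a over2 S -> vf (dY G) (- dX G) p = 0 ->
    exists2 q, q \is a polyOver S & p = ev F q) ->
  no_common_factor (dY G) (- dX G) ->
  (forall c y1 y2, c \is a over2 S -> y1 \is a over2 S -> y2 \is a over2 S ->
     dY G = c * y1 -> - dX G = c * y2 ->
     exists2 c', c' \is a over2 S & c * c' = 1) ->
  forall z u y1 y2, u != 0 -> y1 \is a over2 S -> y2 \is a over2 S ->
    dY G * z = u * y1 -> - dX G * z = u * y2 ->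
    exists2 w, w \is a over2 S & z = u * w.
Proof.
move=> SF SG G0 nzG ker ncf irr z u y1 y2 u0 Sy1 Sy2 e1 e2.
have [w ew] := no_common_factor_dvd ncf e1 e2.
exists w => //; apply/negPn/negP => Sw.
have ey1 : dY G * w = y1 by apply: (mulfI u0); rewrite -e1 ew; ring.
have ey2 : - dX G * w = y2 by apply: (mulfI u0); rewrite -e2 ew; ring.
have SY := dY_over SG; have SX : - dX G \is a over2 S by rewrite rpredN dX_over.
(* McCoy's theorem is applied twice, to polynomials in Y over K[X] and then to their coefficients in
   X. The outcome is a scalar y outside S that multiplies the gradient of G into S[X, Y]. *)
have [||||x [_ xS xf]] := @mccoy _ _ (fun _ => True)
  (fun h => h = dY G \/ h = - dX G) _ _ w _ Sw _.
- move=> h i x [->|->] Sx; apply: rpredM => //.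
    exact: (polyOverP SY).
  exact: (polyOverP SX).
- by [].
- by [].
- by move=> h [->|->]; rewrite ?ey1 ?ey2.
have [||||y [_ yS yf]] := @mccoy _ _ (fun _ => True)
  (fun h => exists i, h = (dY G)`_i \/ h = (- dX G)`_i) _ _ x _ xS _.
- move=> h j y [i [->|->]] Sy; apply: rpredM => //.
    by move/over2P : SY.
  by move/over2P : SX.
- by [].
- by [].
- by move=> h [i [->|->]]; apply: xf; [left|right].
have yY : dY (y%:P%:P * G) \is a over2 S.
  rewrite dYM dYC mul0r add0r; apply/over2P => i j.
  by rewrite !coefCM mulrC; apply: yf; exists i; left.
have yX : dX (y%:P%:P * G) \is a over2 S.
  rewrite dXM dXC mul0r add0r; apply/over2P => i j.
  rewrite !coefCM mulrC -[dX G]opprK coefN coefN mulNr rpredN.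
  by apply: yf; exists i; right.
(* Since G has no constant term, [const_mod] with Z = S turns the integrality of the gradient of y G
   into that of y G. *)
have SS x' z' : x' \in S -> z' \in S -> x' * z' \in S by apply: rpredM.
have yG := const_mod char0 SQ SS yX yY.
rewrite coefCM coefCM G0 mulr0 !polyC0 subr0 in yG.
have [|q Sq eq] := ker _ yG; first by rewrite vfM vfC mul0r add0r /vf; ring.
have [|g Sg eg] := ker _ SG; first by rewrite /vf; ring.
have F0 : dY F != 0.
  by apply: contraNneq nzG => F0; rewrite eg dY_ev F0 mulr0.
have yq : y%:P * g = q.
  apply/eqP; rewrite -subr_eq0 -(ev_eq0 _ F0) evD evN evM evC -eg -eq.
  by rewrite subrr.
(* By the chain rule g'(F) divides both components of the derivation, so it is a unit, hence a
   constant c with inverse in S. The linear coefficient of y g = q is y c, which puts y in S. *)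
have [||||| h' Sh' hh'] := irr (ev F g^`()) (dY F) (- dX F).
- by rewrite ev_over // polyOver_deriv.
- exact: dY_over.
- by rewrite rpredN dX_over.
- by rewrite {1}eg dY_ev.
- by rewrite {1}eg dX_ev mulrN.
have [c c0 [eh eh']] := unitP_const hh'.
have eg' : g^`() = c%:P.
  by apply/eqP; rewrite -subr_eq0 -(ev_eq0 _ F0) evD evN evC -eh subrr.
have g1 : g`_1 = c.
  by have := congr1 (fun p : {poly K} => p`_0) eg'; rewrite coef_deriv coefC mulr1n.
have Scinv : c^-1 \in S by move/over2P: Sh' => /(_ 0 0); rewrite eh' !coefC.
have Syc : y * c \in S.
  by rewrite -g1 -coefCM yq; apply: (polyOverP Sq).
by case/negP: yS; rewrite -[y](mulfK c0) rpredM.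
Qed.

End LocalDepth.

(** * Ideals of Noetherian rings *)

Section Ideals.
Variable R : comNzRingType.

Record ideal := Ideal {
  id_mem :> R -> Prop;
  id_mem0 : id_mem 0;
  id_memP : forall a x y, id_mem x -> id_mem y -> id_mem (a * x + y) }.

Lemma idD (J : ideal) x y : J x -> J y -> J (x + y).
Proof. by move=> Jx Jy; rewrite -[x]mul1r; apply: id_memP. Qed.

Lemma idM (J : ideal) a x : J x -> J (a * x).
Proof. by move=> Jx; rewrite -[_ * _]addr0; apply: id_memP => //; apply: id_mem0. Qed.

Lemma idN (J : ideal) x : J x -> J (- x).
Proof. by move=> Jx; rewrite -mulN1r; apply: idM. Qed.

Lemma idB (J : ideal) x y : J x -> J y -> J (x - y).
Proof. by move=> Jx Jy; apply: idD => //; apply: idN. Qed.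

Definition full_ideal : ideal :=
  @Ideal (fun _ => True) I (fun _ _ _ _ _ => I).

Definition subideal (I J : ideal) := forall x, I x -> J x.
Definition ltideal (I J : ideal) := subideal I J /\ exists x, J x /\ ~ I x.

Lemma ideal_gen_min (J : ideal) (X : set R) :
  (forall x, X x -> J x) -> forall x, ideal_gen X x -> J x.
Proof.
move=> XJ x [s [sX ->]]; elim: s sX => [|q s IH] sX.
  by rewrite big_nil; apply: id_mem0.
rewrite big_cons; apply: id_memP.
  by apply/XJ/sX; rewrite inE eqxx.
by apply: IH => r rs; apply: sX; rewrite inE rs orbT.
Qed.

Lemma ideal_gen_cons (g : R) s x :
  ideal_gen [set` g :: s] x <-> exists a y, ideal_gen [set` s] y /\ x = a * g + y.
Proof.
split=> [[r [rs ->]]|[a [y [[r [rs ->]] ->]]]]; last first.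
  exists ((a, g) :: r); split; last by rewrite big_cons.
  move=> q; rewrite inE => /predU1P[->|/rs qs]; first by rewrite /= inE eqxx.
  by rewrite /= inE (qs : q.2 \in s) orbT.
elim: r rs => [|q r IH] rs.
  exists 0, 0; split; first exact: span_set0.
  by rewrite big_nil mul0r addr0.
have [|a [y [sy ey]]] := IH; first by move=> z zr; apply: rs; rewrite inE zr orbT.
rewrite big_cons ey; have := rs q (mem_head _ _).
rewrite /= inE => /predU1P[->|qs].
  by exists (q.1 + a), y; split=> //; rewrite mulrDl addrA.
exists a, (q.1 * q.2 + y); split; last by rewrite addrCA.
by apply: (span_setP (V := R^o)) => //; apply: (span_set_incl (V := R^o)).
Qed.

Lemma ideal_gen_nil x : ideal_gen [set` [::] : seq R] x <-> x = 0.
Proof.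
split=> [[[|q r] [rs ->]]|->]; first by rewrite big_nil.
  by have := rs q (mem_head _ _); rewrite /= in_nil.
exact: span_set0.
Qed.

Definition gen_ideal (X : set R) : ideal := Ideal (span_set0 (V := R^o) X)
  (fun a x y Xx Xy => span_setP (V := R^o) a Xx Xy).

Lemma add_principalP (J : ideal) (g : R) : exists J' : ideal,
  forall x, J' x <-> exists a y, J y /\ x = a * g + y.
Proof.
have m0 : exists a y, J y /\ 0 = a * g + y.
  by exists 0, 0; rewrite mul0r addr0; split=> //; apply: id_mem0.
have mP a x y : (exists b z, J z /\ x = b * g + z) ->
    (exists b z, J z /\ y = b * g + z) ->
    exists b z, J z /\ a * x + y = b * g + z.
  move=> [b [z [Jz ->]]] [c [w [Jw ->]]]; exists (a * b + c), (a * z + w).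
  by split; [apply: id_memP|ring].
by exists (Ideal m0 mP).
Qed.

Lemma colonP (J : ideal) (g : R) : exists J' : ideal,
  forall x, J' x <-> J (x * g).
Proof.
have m0 : J (0 * g) by rewrite mul0r; apply: id_mem0.
have mP a x y : J (x * g) -> J (y * g) -> J ((a * x + y) * g).
  by move=> Jx Jy; rewrite mulrDl -mulrA; apply: id_memP.
by exists (Ideal m0 mP).
Qed.

Definition noeth_ideals := forall J : ideal, exists s : seq R, forall x,
  J x <-> ideal_gen [set` s] x.

Lemma noeth_fg : noetherian_ring R -> noeth_ideals.
Proof.
move=> noeth J.
pose W : {pred R^o} := fun x => `[< J x >].
have Wc : submod_closed W.
  split=> [|a x y /asboolP Jx /asboolP Jy]; apply/asboolP; first exact: id_mem0.
  exact: id_memP.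
pose I : submodClosed R^o := HB.pack W (GRing.isSubmodClosed.Build R R^o W Wc).
have [s es] := noeth I; exists s => x.
have := congr1 (fun A : set R => A x) es => /= <-.
by split=> /asboolP.
Qed.

Lemma noeth_chain (J : nat -> ideal) : noeth_ideals -> (forall n, subideal (J n) (J n.+1)) ->
  exists N, forall n, subideal (J n) (J N).
Proof.
move=> fg mono; have le m n : (m <= n)%N -> subideal (J m) (J n).
  by move=> /subnK <-; elim: (n - m)%N => // k IH x /IH; apply: mono.
have m0 : exists n, J n 0 by exists 0%N; apply: id_mem0.
have mP a x y : (exists n, J n x) -> (exists n, J n y) ->
    exists n, J n (a * x + y).
  move=> [m xm] [n yn]; exists (maxn m n); apply: id_memP.
    exact: (le _ _ (leq_maxl m n)).
  exact: (le _ _ (leq_maxr m n)).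
have [s es] := fg (Ideal m0 mP).
have [N sN] : exists N, forall x, x \in s -> J N x.
  have : forall x, x \in s -> exists n, J n x.
    by move=> x xs; apply/es; apply: (span_set_incl (V := R^o)).
  elim: s {es} => [|x s IH] sJ; first by exists 0%N.
  have [|N sN] := IH; first by move=> y ys; apply: sJ; rewrite inE ys orbT.
  have [n xn] := sJ x (mem_head _ _); exists (maxn n N) => y.
  rewrite inE => /predU1P[->|ys]; first exact: (le _ _ (leq_maxl n N)).
  by apply: (le _ _ (leq_maxr n N)); apply: sN.
exists N => n x Jx; have : ideal_gen [set` s] x by apply/es; exists n.
exact: ideal_gen_min.
Qed.

Hypothesis noeth : noetherian_ring R.

Lemma noeth_ind (Q : ideal -> Prop) :
  (forall J, (forall J', ltideal J J' -> Q J') -> Q J) -> forall J, Q J.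
Proof.
move=> step J0; apply: contrapT => nQ0.
pose T := {J : ideal | ~ Q J}.
have next (J : T) : exists J' : T, ltideal (sval J) (sval J').
  case: J => J nQ /=; apply: contrapT => none; apply/nQ/step => J' lt.
  by apply: contrapT => nQ'; apply: none; exists (exist _ J' nQ').
have [f fP] := choice next.
pose J n := sval (iter n f (exist _ J0 nQ0)).
have lt n : ltideal (J n) (J n.+1) by apply: fP.
have [|N JN] := @noeth_chain J (noeth_fg noeth); first by move=> n; case: (lt n).
by have [_ [x [xN nx]]] := lt N; apply/nx/(JN N.+1).
Qed.

(** Noetherian induction: if x y is in J but x and y are not, then J + (x) is still proper, since 1
    = a x + z with z in J would give y in J. *)
Lemma prime_ideal_above (J : ideal) : ~ J 1 ->
  exists p : prime_idealr R, forall x, J x -> x \in p.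
Proof.
elim/noeth_ind: J => J IH J1.
have [pr|npr] := pselect (forall x y, J (x * y) -> J x \/ J y).
  pose W : {pred R} := fun x => `[< J x >].
  have Wc : idealr_closed W.
    split; first by apply/asboolP/id_mem0.
    - by apply/asboolP.
    by move=> a x y /asboolP Jx /asboolP Jy; apply/asboolP/id_memP.
  have Wp : prime_idealr_closed W.
    by move=> x y /asboolP /pr[|] Jz; apply/orP; [left|right]; apply/asboolP.
  pose p : prime_idealr R := HB.pack W (isIdealr.Build R W Wc)
    (isPrimeIdealrClosed.Build R W Wp).
  by exists p => x Jx; apply/asboolP.
have [x [y [xy [nx ny]]]] : exists x y, J (x * y) /\ ~ J x /\ ~ J y.
  apply: contrapT => none; apply: npr => x y Jxy; apply: contrapT => /not_orP[nx ny].
  by apply: none; exists x, y.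
have [J' J'P] := add_principalP J x.
have lt : ltideal J J'.
  split=> [z Jz|]; first by apply/J'P; exists 0, z; rewrite mul0r add0r.
  exists x; split=> //; apply/J'P; exists 1, 0; rewrite mul1r addr0.
  by split=> //; apply: id_mem0.
have [|p pJ'] := IH J' lt; last by exists p => z Jz; apply/pJ'/(proj1 lt).
move=> /J'P[a [z [Jz e]]]; apply: ny.
have -> : y = a * (x * y) + z * y by rewrite -[LHS]mul1r e; ring.
by apply: idD; [apply: idM|rewrite mulrC; apply: idM].
Qed.

Lemma local_global (J : ideal) :
  (forall p : prime_idealr R, exists2 t, t \notin p & J t) -> J 1.
Proof.
move=> loc; apply: contrapT => /prime_ideal_above[p Jp].
by have [t tp /Jp] := loc p; rewrite (negPf tp).
Qed.

End Ideals.

(** * Symmetric algebras and localizations *)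

Section RestrictScalars.
Variables (R C : comNzRingType).

(** A copy of C, on which the R-algebra structure through [phi] does not compete with one that C
    already carries. *)
Definition restr (phi : {rmorphism R -> C}) : Type := C.
Variable phi : {rmorphism R -> C}.
HB.instance Definition _ := GRing.ComNzRing.copy (restr phi) C.

Definition restr_scale (a : R) (x : restr phi) : restr phi := phi a * x.
Lemma restr_scaleA a b x :
  restr_scale a (restr_scale b x) = restr_scale (a * b) x.
Proof. by rewrite /restr_scale rmorphM mulrA. Qed.
Lemma restr_scale1 : left_id 1 restr_scale.
Proof. by move=> x; rewrite /restr_scale rmorph1 mul1r. Qed.
Lemma restr_scaleDr : right_distributive restr_scale +%R.
Proof. by move=> a x y; rewrite /restr_scale mulrDr. Qed.
Lemma restr_scaleDl x : {morph restr_scale^~ x : a b / a + b}.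
Proof. by move=> a b; rewrite /restr_scale rmorphD mulrDl. Qed.
HB.instance Definition _ := GRing.Zmodule_isLmodule.Build R (restr phi)
  restr_scaleA restr_scale1 restr_scaleDr restr_scaleDl.
Lemma restr_scaleAl (a : R) (x y : restr phi) : a *: (x * y) = (a *: x) * y.
Proof. exact: mulrA. Qed.
HB.instance Definition _ :=
  GRing.Lmodule_isLalgebra.Build R (restr phi) restr_scaleAl.
HB.instance Definition _ := GRing.Lalgebra_isComAlgebra.Build R (restr phi).

End RestrictScalars.

Section SymTheory.
Variables (R : comNzRingType) (M : lmodType R).
Local Notation B := (Sym M).

Lemma sym_eval (C : comNzRingType) (phi : {rmorphism R -> C}) (f : M -> C) :
  (forall a m n, f (a *: m + n) = phi a * f m + f n) ->
  exists psi : {rmorphism B -> C}, (forall m, psi (sym_in m) = f m) /\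
    forall a x, psi (a *: x) = phi a * psi x.
Proof.
move=> lin; have f_lin : linear (f : M -> restr phi) by move=> a m n; apply: lin.
pose fL : {linear M -> restr phi} :=
  HB.pack (f : M -> restr phi) (GRing.isLinear.Build R M (restr phi) *:%R f f_lin).
have [g [gf _]] := sym_universal fL.
have gB : zmod_morphism (g : B -> C) by move=> x y; apply: (rmorphB g).
have gM : monoid_morphism (g : B -> C).
  by split=> [|x y]; [apply: (rmorph1 g)|apply: (rmorphM g)].
pose psi : {rmorphism B -> C} := HB.pack (g : B -> C)
  (GRing.isZmodMorphism.Build B C g gB) (GRing.isMonoidMorphism.Build B C g gM).
exists psi; split=> [m|a x]; first exact: gf.
exact: (linearZ_LR g).
Qed.

Lemma malg_ind (Q : {malg R[{cmonom M}]} -> Prop) :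
  Q 0 -> Q 1 -> (forall a x, Q x -> Q (a *: x)) -> (forall m, Q << ucm m >>) ->
  (forall x y, Q x -> Q y -> Q (x + y)) ->
  (forall x y, Q x -> Q y -> Q (x * y)) -> forall x, Q x.
Proof.
move=> Q0 Q1 QZ QM QD QMul x.
have Qk (k : cmonom M) : Q << k >>.
  have [n] := ubnP (mdeg k); elim: n k => [k|n IH k].
    rewrite ltn0 => no; discriminate no.
  have [-> _|k1] := eqVneq k mone; [exact: Q1|].
  have [i ki] : exists i, k i != 0%N.
    apply: contrapT => k0; case/eqP: k1; apply/eqP/cmP => i; rewrite cm1.
    by apply/eqP/negPn/negP => ki; apply: k0; exists i.
  have -> : k = mmul (ucm i) (divcm k (ucm i)).
    apply/eqP/cmP => j; rewrite cmM divcmE ucmE.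
    by case: eqVneq => [<-|_]; rewrite ?subn0 // subnKC // lt0n.
  set l := divcm _ _; rewrite mdegM mdegU ltnS => /IH IHl.
  have -> : << mmul (ucm i) l >> =
      << ucm i >> * << l >> :> {malg R[{cmonom M}]}.
    by rewrite malgM_def fgmulUU mulr1.
  by apply: QMul; [exact: QM|exact: IHl].
rewrite [x]monalgE; apply: (big_ind Q); [exact: Q0|exact: QD|move=> k _].
by rewrite malgUZ; apply: QZ; exact: Qk.
Qed.

Lemma sym_ind (Q : B -> Prop) :
  (forall a : R, Q a%:A) -> (forall m, Q (sym_in m)) ->
  (forall x y, Q x -> Q y -> Q (x + y)) ->
  (forall x y, Q x -> Q y -> Q (x * y)) -> forall x, Q x.
Proof.
move=> QC QM QD QMul x; have [y ->] := quot_proj_surj x.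
have Q1 : Q 1 by rewrite -(scale1r (1 : B)); apply: QC.
have Q0 : Q 0 by rewrite -(scale0r (1 : B)); apply: QC.
pose q : {lrmorphism {malg R[{cmonom M}]} -> B} := quot_proj (@sym_ideal R M).
change (Q (q y)); elim/malg_ind: y => [||a y Qy|m|y z Qy Qz|y z Qy Qz].
- by have -> : q 0 = 0 by exact: (raddf0 q).
- by have -> : q 1 = 1 by exact: (rmorph1 q).
- have -> : q (a *: y) = a%:A * q y.
    transitivity (a *: q y); first exact: (linearZ_LR q).
    by rewrite -scalerAl mul1r.
  exact: QMul.
- exact: QM.
- have -> : q (y + z) = q y + q z by exact: (raddfD q).
  exact: QD.
have -> : q (y * z) = q y * q z by exact: (rmorphM q).
exact: QMul.
Qed.

End SymTheory.

(* The properties of Sym M used below; they are applied to abstract algebras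
   because the quotient Sym M unfolds too eagerly under unification. *)
Record is_symalg (R : comNzRingType) (M : lmodType R) (B : comAlgType R)
    (sy : {linear M -> B}) : Prop := IsSymalg {
  symalg_ind : forall Q : B -> Prop,
    (forall a : R, Q a%:A) -> (forall m, Q (sy m)) ->
    (forall x y, Q x -> Q y -> Q (x + y)) ->
    (forall x y, Q x -> Q y -> Q (x * y)) -> forall x, Q x;
  symalg_eval : forall (C : comNzRingType) (phi : {rmorphism R -> C})
      (f : M -> C),
    (forall a m n, f (a *: m + n) = phi a * f m + f n) ->
    exists psi : {rmorphism B -> C}, (forall m, psi (sy m) = f m) /\
      forall a x, psi (a *: x) = phi a * psi x }.

Lemma Sym_is_symalg (R : comNzRingType) (M : lmodType R) :
  is_symalg (@sym_in R M : {linear M -> Sym M}).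
Proof. by split; [exact: sym_ind|exact: sym_eval]. Qed.

Lemma algM (R : comNzRingType) (B : comAlgType R) (a : R) (x : B) :
  a%:A * x = a *: x.
Proof. by rewrite -scalerAl mul1r. Qed.

(** An abstract field of fractions, from which the arguments use only these properties and not the
    construction of [{fraction R}]. *)
Record frac_field (R : idomainType) := FracFieldOf {
  ff_sort : fieldType;
  ff_in : {rmorphism R -> ff_sort};
  ff_inj : injective ff_in;
  ff_surj : forall x, exists a b, b != 0 /\ x = ff_in a / ff_in b }.

Lemma fraction_field (R : idomainType) (x : {fraction R}) :
  exists a b : R, b != 0 /\ x = tofrac a / tofrac b.
Proof.
elim/quotW: x => x; exists \n_x, \d_x; split; first exact: denom_ratioP.
rewrite -[x in LHS]Ratio_numden.
have d0 : \d_x != 0 by exact: denom_ratioP.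
apply: (mulIf (_ : tofrac \d_x != 0)); first by rewrite tofrac_eq0.
rewrite divfK ?tofrac_eq0 // !piE; apply/eqP; rewrite FracField.equivf_def.
rewrite /FracField.mulf /FracField.equivf /=.
by rewrite !numden_Ratio ?mulr1 ?oner_neq0 // mulrC.
Qed.

Definition fraction_frac (R : idomainType) : frac_field R :=
  FracFieldOf (ff_in := @tofrac R : {rmorphism R -> {fraction R}})
    (fun x y e => (elimT eqP (etrans (esym (tofrac_eq x y)) (introT eqP e))))
    (@fraction_field R).

Section LocalFractions.
Variables (R : idomainType) (Q : frac_field R) (p : prime_idealr R).
Local Notation K := (ff_sort Q).
Local Notation "x %:F" := (ff_in Q x).

Lemma ff_eq0 a : (a%:F == 0) = (a == 0).
Proof. by rewrite -(rmorph0 (ff_in Q)) (inj_eq (@ff_inj _ Q)). Qed.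

Lemma notin_prime_neq0 t : t \notin p -> t != 0.
Proof. by apply: contraNneq => ->; apply: rpred0. Qed.

Lemma prime_notinM s t : s \notin p -> t \notin p -> s * t \notin p.
Proof. by move=> sp tp; rewrite prime_idealrM negb_or sp. Qed.

Lemma prime_notin1 : 1 \notin p. Proof. by rewrite idealr1. Qed.

Definition loc_ideal (J : ideal R) : {pred K} := fun x =>
  `[< exists a b, [/\ J a, b \notin p & x = a%:F / b%:F] >].
Definition loc_ring : {pred K} := fun x =>
  `[< exists a b, b \notin p /\ x = a%:F / b%:F >].

Lemma loc_idealP (J : ideal R) x : reflect (exists a b, [/\ J a, b \notin p & x = a%:F / b%:F])
  (x \in loc_ideal J).
Proof. exact: asboolP. Qed.
Lemma loc_ringP x : reflect (exists a b, b \notin p /\ x = a%:F / b%:F)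
  (x \in loc_ring).
Proof. exact: asboolP. Qed.

Lemma fracB (a b c d : R) : b != 0 -> d != 0 ->
  a%:F / b%:F - c%:F / d%:F = (a * d - c * b)%:F / (b * d)%:F.
Proof.
move=> b0 d0; by rewrite -mulNr addf_div ?ff_eq0 // mulNr rmorphB !rmorphM.
Qed.

Lemma fracM (a b c d : R) :
  (a%:F / b%:F) * (c%:F / d%:F) = (a * c)%:F / (b * d)%:F.
Proof. by rewrite mulf_div !rmorphM. Qed.

Lemma loc_ring_subring : GRing.subring_closed loc_ring.
Proof.
split=> [|x y|x y].
- by apply/loc_ringP; exists 1, 1; rewrite prime_notin1 rmorph1 divr1.
- move=> /loc_ringP[a [b [bp ->]]] /loc_ringP[c [d [dp ->]]].
  apply/loc_ringP; exists (a * d - c * b), (b * d).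
  by rewrite fracB ?notin_prime_neq0 // prime_notinM.
move=> /loc_ringP[a [b [bp ->]]] /loc_ringP[c [d [dp ->]]].
by apply/loc_ringP; exists (a * c), (b * d); rewrite fracM prime_notinM.
Qed.
HB.instance Definition _ :=
  GRing.isSubringClosed.Build K loc_ring loc_ring_subring.

Lemma loc_ideal_zmod (J : ideal R) : zmod_closed (loc_ideal J).
Proof.
split=> [|x y].
  apply/loc_idealP; exists 0, 1; rewrite prime_notin1 rmorph0 mul0r; split=> //.
  exact: id_mem0.
move=> /loc_idealP[a [b [Ja bp ->]]] /loc_idealP[c [d [Jc dp ->]]].
apply/loc_idealP; exists (a * d - c * b), (b * d).
rewrite fracB ?notin_prime_neq0 // prime_notinM //; split=> //.
by apply: idB; rewrite mulrC; apply: idM.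
Qed.
HB.instance Definition _ (J : ideal R) :=
  GRing.isZmodClosed.Build K (loc_ideal J) (loc_ideal_zmod J).

Lemma loc_idealM (J : ideal R) x z : x \in loc_ring -> z \in loc_ideal J ->
  x * z \in loc_ideal J.
Proof.
move=> /loc_ringP[a [b [bp ->]]] /loc_idealP[c [d [Jc dp ->]]].
apply/loc_idealP; exists (a * c), (b * d); rewrite fracM prime_notinM //.
by split=> //; apply: idM.
Qed.

Lemma tofrac_loc a : a%:F \in loc_ring.
Proof. by apply/loc_ringP; exists a, 1; rewrite prime_notin1 rmorph1 divr1. Qed.

Lemma inv_loc t : t \notin p -> (t%:F)^-1 \in loc_ring.
Proof. by move=> tp; apply/loc_ringP; exists 1, t; rewrite tp rmorph1 div1r. Qed.

Lemma loc_clear (J : ideal R) (f : {poly K}) : f \is a polyOver (loc_ideal J) ->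
  exists t (g : {poly R}), [/\ t \notin p, forall i, J g`_i &
     (t%:F)%:P * f = map_poly (ff_in Q) g].
Proof.
elim/poly_ind: f => [_|f c IH /polyOverP Jf].
  exists 1, 0; split=> [||]; first exact: prime_notin1.
    by move=> i; rewrite coef0; apply: id_mem0.
  by rewrite mulr0 rmorph0.
have [|t [g [tp Jg e]]] := IH.
  by apply/polyOverP => i; have := Jf i.+1; rewrite coefD coefMX coefC addr0.
have := Jf 0; rewrite coefD coefMX coefC add0r /= => /loc_idealP[a [b [Ja bp ec]]].
exists (t * b), (b%:P * g * 'X + (t * a)%:P); split.
- exact: prime_notinM.
- move=> i; rewrite coefD coefMX coefC coefCM; case: i => [|i] /=.
    by rewrite add0r; apply: idM.
  by rewrite addr0; apply: idM.
have ea : a%:F = c * b%:F by rewrite ec divfK // ff_eq0 notin_prime_neq0.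
rewrite rmorphD !rmorphM /= map_polyX !map_polyC /= -e ?rmorphM /= ea.
by rewrite !polyCM; ring.
Qed.

Lemma loc_clear2 (J : ideal R) (f : {poly {poly K}}) : f \is a over2 (loc_ideal J) ->
  exists t (g : {poly {poly R}}), [/\ t \notin p, forall i j, J g`_i`_j &
     (t%:F)%:P%:P * f = map_poly (map_poly (ff_in Q)) g].
Proof.
elim/poly_ind: f => [_|f c IH /polyOverP Jf].
  exists 1, 0; split=> [||]; first exact: prime_notin1.
    by move=> i j; rewrite !coef0; apply: id_mem0.
  by rewrite mulr0 rmorph0.
have [|t [g [tp Jg e]]] := IH.
  by apply/polyOverP => i; have := Jf i.+1; rewrite coefD coefMX coefC addr0.
have := Jf 0; rewrite coefD coefMX coefC add0r /= => /loc_clear[b [a [bp Ja ec]]].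
exists (t * b), (b%:P%:P * g * 'X + (t%:P * a)%:P); split.
- exact: prime_notinM.
- move=> i j; rewrite coefD coefMX coefC coefCM; case: i => [|i] /=.
    by rewrite add0r coefCM; apply: idM.
  by rewrite addr0 coefCM; apply: idM.
rewrite rmorphD !rmorphM /= map_polyX !map_polyC /= ?map_polyC ?rmorphM /=.
by rewrite -e -ec !polyCM; ring.
Qed.

Lemma loc_ring_full x : (x \in loc_ring) = (x \in loc_ideal (full_ideal R)).
Proof.
apply/loc_ringP/loc_idealP => [[a [b [bp e]]]|[a [b [_ bp e]]]].
  by exists a, b; split.
by exists a, b.
Qed.

End LocalFractions.

(** * Charts *)

Section Charts.
Variables (R : idomainType) (Q : frac_field R) (M : lmodType R).
Local Notation K := (ff_sort Q).
Local Notation "x %:F" := (ff_in Q x).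
Variables (B : comAlgType R) (sy : {linear M -> B}).
Hypothesis symB : is_symalg sy.
Local Notation P := {poly {poly K}}.
Local Notation S := (@loc_ring R Q).

Definition cst (a : R) : P := (a%:F)%:P%:P.
HB.instance Definition _ := GRing.RMorphism.copy cst
  (polyC \o polyC \o ff_in Q).

Lemma cstM a b : cst (a * b) = cst a * cst b. Proof. exact: rmorphM. Qed.
Lemma cst0 : cst 0 = 0. Proof. exact: rmorph0. Qed.

Lemma cst_eq0 a : (cst a == 0) = (a == 0).
Proof. by rewrite !polyC_eq0 ff_eq0. Qed.

(* A chart at p identifies the localization of Sym M at p with the polynomial
   ring R_p[X, Y] inside K[X, Y]. *)
Record is_prechart (p : prime_idealr R) (iota : {rmorphism B -> P}) : Prop := {
  chartZ : forall a x, iota (a *: x) = cst a * iota x;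
  chart_ker : forall x, iota x = 0 -> exists2 t, t \notin p & t *: x = 0;
  chart_loc : forall x, iota x \is a over2 (S p);
  chart_onto : forall f, f \is a over2 (S p) ->
    exists2 t, t \notin p & exists x, iota x = cst t * f;
  chart_der : forall D : derivation B, exists a b,
    forall x, iota (D x) = vf a b (iota x);
  chart_coef : forall i j, exists2 r, r != 0 &
    exists l : B -> R, forall x, (l x)%:F = r%:F * (iota x)`_i`_j }.

Section Basis.
Variables (p : prime_idealr R) (s : R) (m1 m2 : M) (la mu : M -> R).
Hypothesis sp : s \notin p.
Hypothesis sm : forall m, s *: m = la m *: m1 + mu m *: m2.
Hypothesis indep : forall a b, a *: m1 + b *: m2 = 0 -> a = 0 /\ b = 0.

Let s0 : s%:F != 0. Proof. by rewrite ff_eq0 (notin_prime_neq0 sp). Qed.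

Lemma basis_eq a b c d : a *: m1 + b *: m2 = c *: m1 + d *: m2 ->
  a = c /\ b = d.
Proof.
move=> e; have [|/subr0_eq -> /subr0_eq -> //] := @indep (a - c) (b - d).
by rewrite !scalerBl addrACA e -opprD subrr.
Qed.

Lemma basis_lin a m n :
  la (a *: m + n) = a * la m + la n /\ mu (a *: m + n) = a * mu m + mu n.
Proof.
apply: basis_eq; rewrite -sm scalerDr scalerA [s * a]mulrC -scalerA !sm.
by rewrite scalerDr !scalerA !scalerDl addrACA.
Qed.

Lemma basis1 : la m1 = s /\ mu m1 = 0.
Proof. by apply: basis_eq; rewrite -sm scale0r addr0. Qed.

Lemma basis2 : la m2 = 0 /\ mu m2 = s.
Proof. by apply: basis_eq; rewrite -sm scale0r add0r. Qed.

Definition bev (g : {poly {poly R}}) : B :=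
  (map_poly (horner_alg (sy m1)) g).[sy m2].

Lemma bevD g h : bev (g + h) = bev g + bev h.
Proof. by rewrite /bev rmorphD hornerD. Qed.
Lemma bevM g h : bev (g * h) = bev g * bev h.
Proof. by rewrite /bev rmorphM hornerM. Qed.
Lemma bevC a : bev a%:P%:P = a%:A.
Proof. by rewrite /bev map_polyC hornerC /= horner_algC. Qed.
Lemma bevX : bev 'X%:P = sy m1.
Proof. by rewrite /bev map_polyC hornerC /= horner_algX. Qed.
Lemma bevY : bev 'X = sy m2.
Proof. by rewrite /bev map_polyX hornerX. Qed.

Lemma bev_onto x : exists n g, s ^+ n *: x = bev g.
Proof.
elim/(symalg_ind symB): x => [a|m|x y [n [g eg]] [k [h eh]]|x y [n [g eg]] [k [h eh]]].
- by exists 0, a%:P%:P; rewrite bevC scale1r.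
- exists 1, ((la m)%:P%:P * 'X%:P + (mu m)%:P%:P * 'X).
  by rewrite expr1 bevD !bevM !bevC bevX bevY !algM -!linearZ -linearD /= -sm.
- exists (n + k)%N, ((s ^+ k)%:P%:P * g + (s ^+ n)%:P%:P * h).
  rewrite bevD !bevM !bevC !algM -eg -eh !scalerA -!exprD.
  by rewrite scalerDr [(k + n)%N]addnC.
exists (n + k)%N, (g * h).
by rewrite bevM -eg -eh -scalerAl -scalerAr scalerA -exprD.
Qed.

Definition coord (m : M) : P :=
  ((la m)%:F / s%:F)%:P%:P * 'X%:P + ((mu m)%:F / s%:F)%:P%:P * 'X.

Lemma coord_lin a m n : coord (a *: m + n) = cst a * coord m + coord n.
Proof.
rewrite /coord /cst; have [-> ->] := basis_lin a m n.
by rewrite !(rmorphD, rmorphM) /=; ring.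
Qed.

Lemma coordS m : cst s * coord m = cst (la m) * 'X%:P + cst (mu m) * 'X.
Proof.
by rewrite /coord mulrDr !mulrA -!polyCM ![s%:F * _]mulrC !divfK.
Qed.

Lemma coord1 : coord m1 = 'X%:P.
Proof.
rewrite /coord; have [-> ->] := basis1.
by rewrite rmorph0 mul0r polyC0 mul0r addr0 divff // !polyC1 mul1r.
Qed.

Lemma coord2 : coord m2 = 'X.
Proof.
rewrite /coord; have [-> ->] := basis2.
by rewrite rmorph0 mul0r !polyC0 mul0r add0r divff // !polyC1 mul1r.
Qed.

Lemma map_cst_eq0 (g : {poly {poly R}}) :
  map_poly (map_poly (ff_in Q)) g = 0 -> g = 0.
Proof.
move=> e; apply/polyP => i; apply/polyP => j; apply/eqP.
rewrite !coef0 -(ff_eq0 Q); apply/eqP.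
by have := congr1 (fun h : P => h`_i`_j) e; rewrite !coef_map /= !coef0.
Qed.

Lemma chart_exists : exists iota, is_prechart p iota.
Proof.
have [iota [im iZ]] := symalg_eval symB coord_lin.
have iA a : iota a%:A = cst a by rewrite iZ rmorph1 mulr1.
(* On R[X, Y] the map is the inclusion of coefficients. Together with [bev_onto] this makes its
   kernel s-power torsion. *)
have ibev g : iota (bev g) = map_poly (map_poly (ff_in Q)) g.
  have iP (c : {poly R}) : iota (bev c%:P) = (map_poly (ff_in Q) c)%:P.
    elim/poly_ind: c => [|c a IH].
      by rewrite -[0]polyC0 bevC iA cst0 rmorph0.
    rewrite !polyCD !polyCM bevD bevM bevX bevC rmorphD rmorphM /= im IH iA.
    by rewrite coord1 rmorphD rmorphM /= map_polyX map_polyC polyCD polyCM.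
  elim/poly_ind: g => [|g c IH].
    by rewrite -[0]polyC0 -[0]polyC0 bevC iA cst0 rmorph0.
  rewrite bevD bevM bevY rmorphD rmorphM /= im IH iP.
  by rewrite coord2 rmorphD rmorphM /= map_polyX map_polyC.
exists iota; split=> //.
- move=> x ix; have [n [g eg]] := bev_onto x.
  exists (s ^+ n).
    by elim: (n) => [|k IH]; rewrite ?prime_notin1 // exprS prime_notinM.
  rewrite eg (_ : g = 0); last by apply: map_cst_eq0; rewrite -ibev -eg iZ ix mulr0.
  by rewrite -[0]polyC0 -[0]polyC0 bevC scale0r.
- elim/(symalg_ind symB) => [a|m|x y Sx Sy|x y Sx Sy].
  + by rewrite iA !polyOverC; apply: tofrac_loc.
  + have SC a : (a%:F / s%:F)%:P%:P \is a over2 (S p).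
      by rewrite !polyOverC rpredM ?tofrac_loc ?inv_loc.
    by rewrite im rpredD // rpredM // ?polyOverX // polyOverC polyOverX.
  + by rewrite rmorphD rpredD.
  + by rewrite rmorphM rpredM.
- move=> f Sf.
  have [|t [g [tp _ e]]] := @loc_clear2 _ Q p (full_ideal R) f.
    by apply/over2P => i j; rewrite -loc_ring_full; move/over2P: Sf.
  by exists t => //; exists (bev g); rewrite ibev.
- move=> D; exists (iota (D (sy m1))), (iota (D (sy m2))).
  set a := iota _; set b := iota _.
  elim/(symalg_ind symB) => [c|m|x y ex ey|x y ex ey].
  + by rewrite linearZ /= der1 scaler0 rmorph0 iA vfC.
  + apply: (@mulfI _ (cst s)); first by rewrite cst_eq0 (notin_prime_neq0 sp).
    have vfcM c u : vf a b (cst c * u) = cst c * vf a b u.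
      by rewrite vfM vfC mul0r add0r.
    have vX : vf a b 'X%:P = a by rewrite /vf dX_polyC derivX dYC mulr1 mulr0 addr0.
    have vY : vf a b 'X = b by rewrite /vf dX_X dY_X mulr1 mulr0 add0r.
    rewrite im -vfcM coordS vf_zmod !vfcM vX vY -iZ -linearZ /=.
    have -> : s *: sy m = la m *: sy m1 + mu m *: sy m2.
      by rewrite -!linearZ -linearD /= sm.
    by rewrite linearD !linearZ /= rmorphD /= !iZ.
  + by rewrite linearD /= !rmorphD /= vf_zmod ex ey.
  by rewrite der_leibniz rmorphD !rmorphM /= vfM ex ey.
(* Elements of M have coordinates with denominator s, so the coefficient at a monomial of degree i +
   j has denominator dividing s^(i+j). *)
have int x : forall i j, exists c, c%:F = (s ^+ (i + j))%:F * (iota x)`_i`_j.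
  pose int z := exists c, c%:F = z.
  have int0 : int 0 by exists 0; rewrite rmorph0.
  have intD y z : int y -> int z -> int (y + z).
    by move=> [c <-] [d <-]; exists (c + d); rewrite rmorphD.
  have intM y z : int y -> int z -> int (y * z).
    by move=> [c <-] [d <-]; exists (c * d); rewrite rmorphM.
  change (forall i j, int ((s ^+ (i + j))%:F * (iota x)`_i`_j)).
  elim/(symalg_ind symB): x => [a|m|x y Ix Iy|x y Ix Iy] i j.
  + rewrite iA coefC; case: i => [|i]; last by rewrite /= coef0 mulr0.
    rewrite coefC; case: j => [|j]; last by rewrite /= mulr0.
    by rewrite /= expr0 rmorph1 mul1r; exists a.
  + rewrite im /coord coefD !coefCM !coefX coefC coefD !coefCM.
    case: i => [|[|i]]; rewrite /= ?mulr0 ?addr0 ?add0r.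
    - rewrite coefX coef0 mulr0 addr0; case: eqP => [->|_] /=; last first.
        by rewrite !mulr0.
      by rewrite mulr1 mulrC divfK //; exists (la m).
    - rewrite coef0 mulr0 add0r coef1; case: eqP => [->|_] /=; last first.
        by rewrite !mulr0.
      by rewrite mulr1 mulrC divfK //; exists (mu m).
    by rewrite !coef0 !mulr0 addr0 mulr0.
  + by rewrite rmorphD !coefD mulrDr; apply: intD.
  rewrite rmorphM coefM coef_sum mulr_sumr; apply: (big_ind int) => // k _.
  rewrite coefM mulr_sumr; apply: (big_ind int) => // l _.
  have -> : (i + j)%N = ((k + l) + ((i - k) + (j - l)))%N.
    rewrite addnACA !subnKC //; [by rewrite -ltnS|by rewrite -ltnS].
  rewrite exprD rmorphM mulrACA; apply: intM; [exact: Ix|exact: Iy].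
move=> i j; exists (s ^+ (i + j)).
  by rewrite expf_neq0 // (notin_prime_neq0 sp).
have [l lP] := choice (fun x => int x i j).
by exists l.
Qed.

End Basis.
End Charts.

Section LocalBasis.
Variables (R : idomainType) (M : lmodType R) (p : prime_idealr R).

Lemma frac_eq0 (V : lmodType R) (v : V) (s : denom p) :
  frac v s = 0 -> exists2 t, t \notin p & t *: v = 0.
Proof.
move=> /eq_frac[u]; rewrite scaler0 => e.
exists (den u * den (denom1 p)) => //.
by rewrite prime_idealrM negb_or (valP u) (valP (denom1 p)).
Qed.

Lemma frac_zero (V : lmodType R) (s : denom p) : frac (0 : V) s = 0.
Proof. by apply/eq_frac; exists s; rewrite !scaler0. Qed.

Lemma row2E (S : pzRingType) (v : 'rV[S]_2) :
  v = v 0 0 *: delta_mx 0 0 + v 0 1 *: delta_mx 0 1.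
Proof.
apply/rowP => i; rewrite !mxE !eqxx /=.
case: (unliftP 0 i) => [j ->|->].
  by rewrite ord1 /= !mulr0 add0r mulr1; congr (v _ _); apply: val_inj.
by rewrite /= mulr1 mulr0 addr0.
Qed.

(** The elements m1 and m2 are numerators of a basis of M_p. Each m needs its own denominator, and
    finite generation yields a common one. *)
Lemma rank2_basis : fin_gen M ->
  free_of_rank (loc p M : lmodType (loc p R^o)) 2 ->
  exists s m1 m2 (la mu : M -> R), [/\ s \notin p,
    forall m, s *: m = la m *: m1 + mu m *: m2 &
    forall a b, a *: m1 + b *: m2 = 0 -> a = 0 /\ b = 0].
Proof.
move=> [gs gsP] [f f_bij].
pose x0 := f (delta_mx 0 0); pose x1 := f (delta_mx 0 1).
pose m1 : M := num_of x0; pose m2 : M := num_of x1.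
have fE v : f v = v 0 0 *: frac m1 (den_of x0) + v 0 1 *: frac m2 (den_of x1).
  by rewrite {1}[v]row2E linearD !linearZ /= !frac_repr.
pose comb t m := exists a b, t *: m = a *: m1 + b *: m2.
have spanL m : exists2 t, t \notin p & comb t m.
  have [g fK gK] := f_bij; pose v := g (frac m (denom1 p)).
  have : f v = frac m (denom1 p) by exact: gK.
  rewrite fE -[v 0 0]frac_repr -[v 0 1]frac_repr.
  rewrite (frac_scale _ _ m1) (frac_scale _ _ m2) frac_add.
  set d := denomM (denomM _ _) (denomM _ _); set a := num_of _; set b := num_of _.
  move=> /eq_frac[u]; rewrite scalerDr !scalerA => e.
  exists (den u * den d).
    by rewrite prime_idealrM negb_or (valP u) (valP d).
  by eexists; eexists; apply: esym e.
have [s sp sP] : exists2 s, s \notin p & forall m, comb s m.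
  have [s sp sg] : exists2 s, s \notin p & forall m, m \in gs -> comb s m.
    elim: gs {gsP} => [|m l [s sp sl]]; first by exists 1; rewrite ?idealr1.
    have [t tp [a [b e]]] := spanL m; exists (t * s).
      by rewrite prime_idealrM negb_or tp.
    move=> n; rewrite inE => /predU1P[->|/sl[c [d ec]]].
      exists (s * a), (s * b).
      by rewrite mulrC -scalerA e scalerDr !scalerA.
    by exists (t * c), (t * d); rewrite -scalerA ec scalerDr !scalerA.
  exists s => // m; have : span_set [set` gs] m by rewrite gsP.
  move=> [l [lP ->]]; elim: l lP => [|q l IH] lP.
    by exists 0, 0; rewrite big_nil scaler0 !scale0r addr0.
  have [|a [b e]] := IH; first by move=> r rl; apply: lP; rewrite inE rl orbT.
  have [|c [d e']] := sg q.2; first exact: (lP q (mem_head _ _)).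
  exists (q.1 * c + a), (q.1 * d + b).
  rewrite big_cons scalerDr e scalerA [s * _]mulrC -scalerA e'.
  by rewrite scalerDr !scalerA !scalerDl addrACA.
have [la laP] := choice sP; have [mu muP] := choice laP.
exists s, m1, m2, la, mu; split=> // a b e.
pose c0 : loc p R^o := frac (a * den (den_of x0) : R^o) (denom1 p).
pose c1 : loc p R^o := frac (b * den (den_of x1) : R^o) (denom1 p).
pose v : 'rV[loc p R^o]_2 := c0 *: delta_mx 0 0 + c1 *: delta_mx 0 1.
have v0 : v 0 0 = c0 by rewrite !mxE /= mulr1 mulr0 addr0.
have v1 : v 0 1 = c1 by rewrite !mxE /= mulr1 mulr0 add0r.
have fracK (c : R) (y : denom p) (n : M) :
    frac (c * den y : R^o) (denom1 p) *: frac n y = frac (c *: n) (denom1 p).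
  rewrite (frac_scale _ _ n); apply/eq_frac; exists (denom1 p) => /=.
  by rewrite !scalerA; congr (_ *: _); ring.
have fv : f v = 0.
  by rewrite fE v0 v1 !fracK frac_add1 e frac_zero.
have vz : v = 0 by apply: (bij_inj f_bij); rewrite fv linear0.
have z (c : R) (y : denom p) : frac (c * den y : R^o) (denom1 p) = 0 -> c = 0.
  move=> /frac_eq0[t tp] /eqP; rewrite -[t *: _]/(t * (c * den y)).
  rewrite !mulf_eq0 => /or3P[/eqP t0|/eqP //|/eqP y0].
    by rewrite t0 rpred0 in tp.
  by have := valP y; rewrite /= y0 rpred0.
split; first by apply: (z _ (den_of x0)); rewrite -/c0 -v0 vz mxE.
by apply: (z _ (den_of x1)); rewrite -/c1 -v1 vz mxE.
Qed.

End LocalBasis.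

Section ZeroPrime.
Variable R : idomainType.
Definition zero_ideal_pred : {pred R} := fun x => x == 0.
Lemma zero_ideal_closed : idealr_closed zero_ideal_pred.
Proof.
split; rewrite ?unfold_in ?eqxx ?oner_eq0 // => a x y.
by rewrite !unfold_in => /eqP -> /eqP ->; rewrite mulr0 addr0.
Qed.
Lemma zero_ideal_prime : prime_idealr_closed zero_ideal_pred.
Proof. by move=> x y; rewrite !unfold_in mulf_eq0. Qed.
HB.instance Definition _ := isIdealr.Build R zero_ideal_pred zero_ideal_closed.
HB.instance Definition _ :=
  isPrimeIdealrClosed.Build R zero_ideal_pred zero_ideal_prime.
(** Localizing here gives K, so the statements over K are instances of those at a prime. *)
Definition zero_prime : prime_idealr R := zero_ideal_pred.
Lemma zero_primeE x : (x \in zero_prime) = (x == 0). Proof. by []. Qed.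
End ZeroPrime.

(** * Hamiltonian charts *)

Section Swap.
Variable K : fieldType.
Local Notation P := {poly {poly K}}.

Lemma swapM (f g : P) : swapXY (f * g) = swapXY f * swapXY g.
Proof. exact: rmorphM. Qed.
Lemma swapD (f g : P) : swapXY (f + g) = swapXY f + swapXY g.
Proof. exact: rmorphD. Qed.
Lemma swapN (f : P) : swapXY (- f) = - swapXY f. Proof. exact: (raddfN swapXY). Qed.
Lemma swapC (c : K) : swapXY (c%:P%:P : P) = c%:P%:P.
Proof. by rewrite swapXY_polyC map_polyC. Qed.

Lemma dX_swap (f : P) : dX (swapXY f) = swapXY (dY f).
Proof.
apply/polyP => i; apply/polyP => j.
by rewrite coef_dX coef_deriv !coef_swapXY coef_dY coefMn.
Qed.

Lemma dY_swap (f : P) : dY (swapXY f) = swapXY (dX f).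
Proof. by rewrite -[f in RHS]swapXYK dX_swap swapXYK. Qed.

Lemma swap_over (N : addrClosed K) (f : P) :
  f \is a over2 N -> swapXY f \is a over2 N.
Proof. by move=> /over2P Nf; apply/over2P => i j; rewrite coef_swapXY. Qed.

Lemma ev_comp (F : P) (p q : {poly K}) : ev F (p \Po q) = ev (ev F q) p.
Proof.
elim/poly_ind: p => [|p c IH]; first by rewrite comp_poly0 !ev0.
by rewrite comp_poly_MXaddC !evD !evM IH !evC evX.
Qed.
End Swap.

Section HamiltonianCharts.
Variables (R : idomainType) (Q : frac_field R) (M : lmodType R).
Variables (B : comAlgType R) (sy : {linear M -> B}).
Hypothesis symB : is_symalg sy.
Variable D : derivation B.
Local Notation K := (ff_sort Q).
Local Notation "x %:F" := (ff_in Q x).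
Local Notation P := {poly {poly K}}.
Local Notation S := (@loc_ring R Q).
Local Notation cst := (@cst R Q).

Hypothesis noeth : noetherian_ring R.
Hypothesis RQ : forall n, exists y : R, n.+1%:R * y = 1.
Hypothesis lnd : locally_nilpotent D.
Hypothesis basis : forall p : prime_idealr R,
  exists s m1 m2 (la mu : M -> R), [/\ s \notin p,
    forall m, s *: m = la m *: m1 + mu m *: m2 &
    forall a b, a *: m1 + b *: m2 = 0 -> a = 0 /\ b = 0].

Lemma prechart_exists p : exists iota : {rmorphism B -> P},
  is_prechart p iota.
Proof.
have [s [m1 [m2 [la [mu [sp sm ind]]]]]] := basis p.
exact: (chart_exists Q symB sp sm ind).
Qed.

Lemma ffQ n : exists2 y : R, n.+1%:R != 0 :> R & (n.+1%:R : K)^-1 = y%:F.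
Proof.
have [y ey] := RQ n.
have n0 : n.+1%:R != 0 :> R.
  by apply: contra_eq_neq ey => ->; rewrite mul0r eq_sym oner_neq0.
exists y => //; apply: (@mulfI _ (n.+1%:R)).
  by rewrite -(rmorph_nat (ff_in Q)) ff_eq0.
rewrite mulfV; last by rewrite -(rmorph_nat (ff_in Q)) ff_eq0.
by rewrite -(rmorph_nat (ff_in Q)) -rmorphM ey rmorph1.
Qed.

Lemma K_char0 n : n.+1%:R != 0 :> K.
Proof.
by have [_ n0 _] := ffQ n; rewrite -(rmorph_nat (ff_in Q)) ff_eq0.
Qed.

Lemma loc_SQ p n : (n.+1%:R)^-1 \in S p.
Proof. by have [y _ ->] := ffQ n; apply: tofrac_loc. Qed.

(** For fixed x, the t with G (t x) form an ideal, and the assumption says that no prime contains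
    it. *)
Lemma loc_global (G : B -> Prop) : G 0 ->
  (forall a x y, G x -> G y -> G (a *: x + y)) ->
  forall x, (forall p : prime_idealr R, exists2 t, t \notin p & G (t *: x)) -> G x.
Proof.
move=> G0 GP x loc.
have m0 : G (0 *: x) by rewrite scale0r.
have mP a t u : G (t *: x) -> G (u *: x) -> G ((a * t + u) *: x).
  by rewrite scalerDl -scalerA; apply: GP.
have := @local_global R noeth (@Ideal R (fun t => G (t *: x)) m0 mP) loc.
by rewrite /= scale1r.
Qed.

(** An element killed by some t <> 0 maps to 0 in the chart at every prime q, because K[X, Y] is
    torsion-free; so it vanishes locally everywhere. *)
Lemma prechart_inj p (iota : {rmorphism B -> P}) :
  is_prechart p iota -> injective iota.
Proof.
move=> ch; suff ker x : iota x = 0 -> x = 0.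
  by move=> x y e; apply/subr0_eq/ker; rewrite rmorphB /= e subrr.
move=> ix; have [t tp tx] := chart_ker ch ix.
apply: (loc_global (G := fun y => y = 0)) => // [a y z -> ->|q].
  by rewrite scaler0 addr0.
have [iq chq] := prechart_exists q; apply: (chart_ker chq).
apply/eqP; have /eqP := congr1 iq tx.
rewrite (chartZ chq) rmorph0 mulf_eq0 cst_eq0.
by rewrite (negPf (notin_prime_neq0 tp)).
Qed.

Lemma B_domain (x y : B) : x * y = 0 -> x = 0 \/ y = 0.
Proof.
have [i ch] := prechart_exists (zero_prime R); have inj := prechart_inj ch.
move=> /(congr1 i) /eqP; rewrite rmorphM rmorph0 mulf_eq0.
by move=> /orP[] /eqP e; [left|right]; apply: inj; rewrite e rmorph0.
Qed.

Lemma B_tf a (x : B) : a *: x = 0 -> a = 0 \/ x = 0.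
Proof.
have [i ch] := prechart_exists (zero_prime R); have inj := prechart_inj ch.
move=> /(congr1 i) /eqP; rewrite (chartZ ch) rmorph0 mulf_eq0 cst_eq0.
by move=> /orP[] /eqP e; [left|right]; last by apply: inj; rewrite e rmorph0.
Qed.

Lemma B_cancel (z x y : B) : z != 0 -> z * x = z * y -> x = y.
Proof.
move=> z0 e; apply: subr0_eq.
have [] := @B_domain z (x - y); [by rewrite mulrBr e subrr| |by []].
by move/eqP; rewrite (negPf z0).
Qed.

Lemma B_tfI t (x y : B) : t != 0 -> t *: x = t *: y -> x = y.
Proof.
move=> t0 e; apply: subr0_eq.
have [] := @B_tf t (x - y); [by rewrite scalerBr e subrr| |by []].
by move/eqP; rewrite (negPf t0).
Qed.

Lemma loc_zero x : x \in S (zero_prime R).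
Proof.
have [a [b [b0 ->]]] := ff_surj x; apply/loc_ringP; exists a, b.
by rewrite zero_primeE.
Qed.

Lemma over2_loc_zero (f : P) : f \is a over2 (S (zero_prime R)).
Proof. by apply/over2P => i j; apply: loc_zero. Qed.

Lemma chart_onto0 p (iota : {rmorphism B -> P}) : is_prechart p iota ->
  forall f : P, exists2 t, t != 0 & exists x, iota x = cst t * f.
Proof.
move=> ch f.
have [|t [g [tp _ e]]] := @loc_clear2 _ Q (zero_prime R) (full_ideal R) f.
  by apply/over2P => i j; rewrite -loc_ring_full; apply: loc_zero.
have [|t' t'p [x ex]] := chart_onto ch (_ : cst t * f \is a over2 (S p)).
  by rewrite e; apply/over2P => i j; rewrite !coef_map tofrac_loc.
exists (t' * t); first by rewrite mulf_neq0 // ?(notin_prime_neq0 t'p) // -zero_primeE.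
by exists x; rewrite ex cstM mulrA.
Qed.

Lemma prechart_zero p (iota : {rmorphism B -> P}) : is_prechart p iota ->
  is_prechart (zero_prime R) iota.
Proof.
move=> ch; split.
- exact: chartZ ch.
- move=> x /(chart_ker ch)[t tp tx]; exists t => //.
  by rewrite zero_primeE (notin_prime_neq0 tp).
- by move=> x; apply: over2_loc_zero.
- move=> f _; have [t t0 [x ex]] := chart_onto0 ch f; exists t => //.
  by exists x.
- exact: chart_der ch.
exact: chart_coef ch.
Qed.

Lemma cst_inv_over (p : prime_idealr R) t (f : P) : t \notin p -> cst t * f \is a over2 (S p) ->
  f \is a over2 (S p).
Proof.
move=> tp /over2P Sf; apply/over2P => i j.
have := Sf i j; rewrite !coefCM => /(rpredM (inv_loc Q tp)).
by rewrite mulKf // ff_eq0 (notin_prime_neq0 tp).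
Qed.

Lemma cst_over p t : cst t \is a over2 (S p).
Proof. by rewrite !polyOverC tofrac_loc. Qed.

(** The zero constant term fixes the Hamiltonian, and makes a multiple of G integral as soon as its
    gradient is. *)
Record hchart (p : prime_idealr R) (iota : {rmorphism B -> P}) (G : P) : Prop := {
  hc_pre : is_prechart p iota;
  hc_inj : injective iota;
  hc_der : forall x, iota (D x) = vf (dY G) (- dX G) (iota x);
  hc_over : G \is a over2 (S p);
  hc_0 : G`_0`_0 = 0;
  hc_lnd : forall f, exists n, iter n (vf (dY G) (- dX G)) f = 0 }.

Lemma vf_cst a b c f : vf a b (cst c * f) = cst c * vf a b f.
Proof. by rewrite vfM vfC mul0r add0r. Qed.

Lemma hchart_exists p : exists iota G, hchart p iota G.
Proof.
have [i ch] := prechart_exists p; have [a [b der]] := chart_der ch D.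
have inj := prechart_inj ch.
have lndP f : exists n, iter n (vf a b) f = 0.
  have [t t0 [x ex]] := chart_onto0 ch f.
  have [n en] := lnd x; exists n.
  apply: (@mulfI _ (cst t)); first by rewrite cst_eq0.
  rewrite mulr0; have <- : i (iter n D x) = cst t * iter n (vf a b) f.
    elim: (n) => [|k IH] //=; by rewrite der IH vf_cst.
  by rewrite en rmorph0.
have Sab : a \is a over2 (S p) /\ b \is a over2 (S p).
  split.
    have [|t tp [x ex]] := chart_onto ch (_ : 'X%:P \is a over2 (S p)).
      by rewrite polyOverC polyOverX.
    apply: (cst_inv_over tp); have -> : cst t * a = i (D x).
      by rewrite der ex vf_cst /vf dX_polyC derivX dYC mulr1 mulr0 addr0.
    exact: (chart_loc ch).
  have [|t tp [x ex]] := chart_onto ch (_ : 'X \is a over2 (S p)).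
    exact: polyOverX.
  apply: (cst_inv_over tp); have -> : cst t * b = i (D x).
    by rewrite der ex vf_cst /vf dX_X dY_X mulr1 mulr0 add0r.
  exact: (chart_loc ch).
have [G [ea eb G0 GS]] := lnd_hamiltonian K_char0 lndP.
exists i, G; split=> //.
- by rewrite -ea -eb.
- by apply: GS; [exact: loc_SQ|exact: proj1 Sab|exact: proj2 Sab].
by rewrite -ea -eb.
Qed.

Lemma hchart_zero p iota G : hchart p iota G -> hchart (zero_prime R) iota G.
Proof.
case=> pre inj der SG G0 ln; split=> //; first exact: prechart_zero pre.
exact: over2_loc_zero.
Qed.

(** Exchanging X and Y reverses the orientation, hence the sign of the Hamiltonian. *)
Lemma hchart_swap p iota G : hchart p iota G ->
  hchart p (swapXY \o iota : {rmorphism B -> P}) (- swapXY G).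
Proof.
case=> pre inj der SG G0 ln.
have vf_swap f : vf (dY (- swapXY G)) (- dX (- swapXY G)) (swapXY f) =
    swapXY (vf (dY G) (- dX G) f).
  rewrite /vf dXN dYN !dX_swap !dY_swap swapD !swapM swapN opprK.
  by rewrite addrC.
split.
- split.
  + by move=> a x; rewrite /= (chartZ pre) swapM swapC.
  + move=> x /= e; apply: (chart_ker pre).
    by apply: (can_inj (@swapXYK _)); rewrite e rmorph0.
  + by move=> x; apply: swap_over; apply: (chart_loc pre).
  + move=> f Sf; have [t tp [x ex]] := chart_onto pre (swap_over Sf).
    exists t => //; exists x.
    by rewrite /= ex swapM swapXYK swapC.
  + move=> D'; have [a [b e]] := chart_der pre D'.
    exists (swapXY b), (swapXY a) => x.
    by rewrite /= e /vf dX_swap dY_swap swapD !swapM addrC.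
  + move=> j k; have [r r0 [l lP]] := chart_coef pre k j.
    by exists r => //; exists l => x; rewrite lP /= coef_swapXY.
- by apply: inj_comp => //; apply: (can_inj (@swapXYK _)).
- by move=> x; rewrite /= der vf_swap.
- by rewrite rpredN; apply: swap_over.
- by rewrite !coefN coef_swapXY G0 oppr0.
move=> f; have [n en] := ln (swapXY f); exists n.
rewrite -[f]swapXYK.
have -> : iter n (vf (dY (- swapXY G)) (- dX (- swapXY G))) (swapXY (swapXY f)) =
    swapXY (iter n (vf (dY G) (- dX G)) (swapXY f)).
  by elim: (n) => //= k ->; rewrite vf_swap.
by rewrite en rmorph0.
Qed.

(* The hypothesis excludes, in one of the two orders of the coordinates, the
   vanishing of dG/dY modulo N. *)
Lemma hchart_exists_dY p (N : zmodClosed K) :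
  (forall iota G, hchart p iota G -> dX G \is a over2 N ->
     dY G \is a over2 N -> False) ->
  exists iota G, hchart p iota G /\ dY G \isn't a over2 N.
Proof.
move=> noN; have [i [G hc]] := hchart_exists p.
have [YN|YN] := boolP (dY G \is a over2 N); last by exists i, G.
have [XN|XN] := boolP (dX G \is a over2 N); first by case: (noN i G hc XN YN).
exists (swapXY \o i), (- swapXY G); split; first exact: hchart_swap.
rewrite dYN dY_swap rpredN; apply: contra XN => /swap_over.
by rewrite swapXYK.
Qed.

Lemma hchart_nz p : (exists x, D x <> 0) -> exists iota G,
  hchart p iota G /\ dY G != 0.
Proof.
move=> [x Dx]; have [|i [G [hc GN]]] := @hchart_exists_dY p zero_pred.
  move=> i G hc; rewrite !over2_zero => /eqP X0 /eqP Y0; apply: Dx.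
  by apply: (hc_inj hc); rewrite (hc_der hc) /vf X0 Y0 oppr0 !mul0r addr0 rmorph0.
by exists i, G; rewrite -over2_zero.
Qed.

Local Notation DB := (ideal_gen (range D)).

Section InChart.
Variables (p : prime_idealr R) (iota : {rmorphism B -> P}) (G : P).
Hypothesis hc : hchart p iota G.
Let ch := hc_pre hc.

Lemma iota_over x : iota x \is a over2 (S p).
Proof. exact: (chart_loc ch). Qed.

Lemma dYG_over : dY G \is a over2 (S p).
Proof. exact: dY_over (hc_over hc). Qed.

Lemma dXG_over : - dX G \is a over2 (S p).
Proof. by rewrite rpredN; apply: dX_over (hc_over hc). Qed.

Lemma DB_chart x : DB x -> exists u v, [/\ u \is a over2 (S p),
  v \is a over2 (S p) & iota x = u * dY G + v * - dX G].
Proof.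
move=> [s [sD ->]]; elim: s sD => [|q s IH] sD.
  by exists 0, 0; rewrite big_nil rmorph0 !rpred0 !mul0r addr0.
have [|u [v [Su Sv e]]] := IH; first by move=> r rs; apply: sD; rewrite inE rs orbT.
have [y _ ey] := sD q (mem_head _ _).
exists (iota q.1 * dX (iota y) + u), (iota q.1 * dY (iota y) + v).
rewrite !(rpredD, rpredM) ?iota_over ?dX_over ?dY_over ?iota_over //; split=> //.
have -> : \sum_(r <- q :: s) r.1 *: (r.2 : B^o) =
    q.1 * q.2 + \sum_(r <- s) r.1 *: (r.2 : B^o) by rewrite big_cons.
by rewrite rmorphD rmorphM /= e -ey (hc_der hc) /vf; ring.
Qed.

Lemma onto2 f g : f \is a over2 (S p) -> g \is a over2 (S p) ->
  exists2 t, t \notin p & exists x y, iota x = cst t * f /\ iota y = cst t * g.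
Proof.
move=> /(chart_onto ch)[t tp [x ex]] /(chart_onto ch)[u up [y ey]].
exists (t * u); first exact: prime_notinM.
exists (u *: x), (t *: y); rewrite !(chartZ ch) ex ey cstM.
by split; ring.
Qed.

(** Up to multipliers outside p, the coordinates come from B, and D maps X and Y to the two
    components. *)
Lemma DB_onto u v : u \is a over2 (S p) -> v \is a over2 (S p) ->
  exists2 t, t \notin p & exists2 z, DB z &
    iota z = cst t * (u * dY G + v * - dX G).
Proof.
move=> Su Sv; have [t tp [x [y [ex ey]]]] := onto2 Su Sv.
have [||t' t'p [x' [y' [ex' ey']]]] :=
    onto2 (_ : 'X%:P \is a over2 (S p)) (_ : 'X \is a over2 (S p)).
- by rewrite polyOverC polyOverX.
- exact: polyOverX.
exists (t * t'); first exact: prime_notinM.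
exists (x * D x' + y * D y').
  apply: (@span_setP _ (B^o) _ x (D x') (y * D y')).
    by apply: (@span_set_incl _ (B^o)); exists x'.
  rewrite -[_ * _]addr0; apply: (@span_setP _ (B^o) _ y (D y') 0).
    by apply: (@span_set_incl _ (B^o)); exists y'.
  exact: (@span_set0 _ (B^o)).
rewrite rmorphD !rmorphM /= !(hc_der hc) ex ey ex' ey' !vf_cst.
rewrite /vf dX_polyC derivX dYC dX_X dY_X; ring.
Qed.

End InChart.
End HamiltonianCharts.

(** * Local generators of the kernel *)

Section LocalGenerators.
Variables (R : idomainType) (B : comAlgType R) (D : derivation B).

(** It expresses that A_p is the polynomial ring R_p[F], without forming the localization. *)
Definition local_gen (p : prime_idealr R) (F : B) := [/\ D F = 0,
  forall a : {poly R}, horner_alg F a = 0 -> a = 0 &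
  forall x, D x = 0 -> exists2 t, t \notin p &
    exists a : {poly R}, t *: x = horner_alg F a].

(** Irreducibility of D_p with denominators cleared: a divisor of the image of D_p is a unit of
    B_p. *)
Definition irr_at (p : prime_idealr R) := forall b : B,
  (forall x, exists2 t, t \notin p & exists y, t *: D x = b * y) ->
  exists2 t, t \notin p & exists c, t%:A = b * c.

(** A regular sequence of a domain, without the condition that it generate a proper ideal. *)
Definition regular_pair (a b : B) := a != 0 /\
  forall z y, b * z = a * y -> exists w, z = a * w.

(* Depth at least two of D(B)B, in the form (B : DB) = B in the fraction field. *)
Definition depth2 := forall z a : B, a != 0 ->
  (forall x, exists y, D x * z = a * y) -> exists y, z = a * y.

End LocalGenerators.

Section LocalTheory.
Variables (R : idomainType) (Q : frac_field R) (M : lmodType R).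
Variables (B : comAlgType R) (sy : {linear M -> B}).
Hypothesis symB : is_symalg sy.
Variable D : derivation B.
Local Notation K := (ff_sort Q).
Local Notation "x %:F" := (ff_in Q x).
Local Notation P := {poly {poly K}}.
Local Notation S := (@loc_ring R Q).
Local Notation cst := (@cst R Q).

Hypothesis noeth : noetherian_ring R.
Hypothesis RQ : forall n, exists y : R, n.+1%:R * y = 1.
Hypothesis lnd : locally_nilpotent D.
Hypothesis basis : forall p : prime_idealr R,
  exists s m1 m2 (la mu : M -> R), [/\ s \notin p,
    forall m, s *: m = la m *: m1 + mu m *: m2 &
    forall a b, a *: m1 + b *: m2 = 0 -> a = 0 /\ b = 0].
Local Notation DB := (ideal_gen (range D)).

Section InChart.
Variables (p : prime_idealr R) (iota : {rmorphism B -> P}) (G : P).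
Hypothesis hc : hchart D p iota G.
Let ch := hc_pre hc.
Let inj := hc_inj hc.

Lemma iota_horner F (a : {poly R}) :
  iota (horner_alg F a) = ev (iota F) (map_poly (ff_in Q) a).
Proof.
elim/poly_ind: a => [|a c IH]; first by rewrite !rmorph0.
rewrite rmorphD rmorphM /= horner_algC horner_algX rmorphD rmorphM /= IH.
rewrite (chartZ ch) rmorph1 mulr1 rmorphD rmorphM /= map_polyX map_polyC.
by rewrite evD evM evC evX.
Qed.

Lemma reg_chart a b : regular_pair a b -> forall f g : P,
  f \is a over2 (S p) -> g \is a over2 (S p) -> iota b * f = iota a * g ->
  exists2 w, w \is a over2 (S p) & f = iota a * w.
Proof.
move=> [a0 reg] f g Sf Sg e; have [t tp [x [y [ex ey]]]] := onto2 hc Sf Sg.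
have [|w ew] := reg x y.
  by apply: inj; rewrite !rmorphM /= ex ey mulrCA e mulrCA.
have e' : f = iota a * (((t%:F)^-1)%:P%:P * iota w).
  apply: (@mulfI _ (cst t)); first by rewrite cst_eq0 (notin_prime_neq0 tp).
  rewrite -ex ew rmorphM /= mulrCA [cst t * _]mulrA -!polyCM mulfV.
    by rewrite mul1r.
  by rewrite ff_eq0 (notin_prime_neq0 tp).
exists (((t%:F)^-1)%:P%:P * iota w) => //.
by rewrite rpredM ?(iota_over hc) // !polyOverC inv_loc.
Qed.

(** Vanishing of the first Koszul homology of the two components of D over R_p[X, Y]. *)
Definition grad_prop := forall u v, u \is a over2 (S p) ->
  v \is a over2 (S p) -> u * dY G + v * - dX G = 0 ->
  exists2 q, q \is a over2 (S p) & u = q * dX G /\ v = q * dY G.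

Lemma grad_of_unit : DB 1 -> grad_prop.
Proof.
move=> /(DB_chart hc)[u0 [v0 [Su0 Sv0 e0]]] u v Su Sv e.
rewrite rmorph1 in e0; exists (u0 * v - v0 * u).
  by rewrite rpredB // rpredM.
by apply: comax_grad; rewrite -?e0.
Qed.

(** Write a and b as combinations of the components with coefficients (x1, y1) and (x2, y2). The
    multiplier sought is both (x1 v - y1 u)/a and (x2 v - y2 u)/b, and regularity of (a, b) makes
    such a common fraction integral. *)
Lemma grad_of_regular a b : DB a -> DB b -> regular_pair a b ->
  dY G != 0 -> grad_prop.
Proof.
move=> Da Db reg nz u v Su Sv e.
have [x1 [y1 [Sx1 Sy1 ea]]] := DB_chart hc Da.
have [x2 [y2 [Sx2 Sy2 eb]]] := DB_chart hc Db.
have [|||w Sw ew] := reg_chart reg (_ : x1 * v - y1 * u \is a over2 (S p))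
    (_ : x2 * v - y2 * u \is a over2 (S p)).
- by rewrite rpredB // rpredM.
- by rewrite rpredB // rpredM.
- apply: (mulfI nz); rewrite ea eb.
  transitivity ((u * dY G + v * - dX G) * (x2 * y1 - x1 * y2) * - dY G +
    dY G * ((x1 * dY G + y1 * - dX G) * (x2 * v - y2 * u))); first by ring.
  by rewrite e !mul0r add0r.
have a0 : iota a != 0.
  by rewrite -(rmorph0 iota) (inj_eq inj); case: reg.
exists w => //; split; apply: (mulfI a0); rewrite mulrA -ew ea.
  transitivity (x1 * (u * dY G + v * - dX G) + (x1 * v - y1 * u) * dX G).
    by ring.
  by rewrite e mulr0 add0r.
transitivity (- y1 * (u * dY G + v * - dX G) + (x1 * dY G + y1 * - dX G) * v
  + y1 * (u * dY G + v * - dX G)); first by ring.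
rewrite e !mulr0 add0r addr0.
transitivity (y1 * (u * dY G + v * - dX G) +
  (x1 * v - y1 * u) * dY G); first by ring.
by rewrite e mulr0 add0r.
Qed.

Lemma grad_local_gen : dY G != 0 -> grad_prop -> exists F, local_gen D p F.
Proof.
move=> nz grad; have [t tp [F eF]] := chart_onto ch (hc_over hc).
have t0 : t%:F != 0 by rewrite ff_eq0 (notin_prime_neq0 tp).
exists F; split.
- apply: inj; rewrite (hc_der hc) eF vf_cst rmorph0.
  by rewrite /vf [X in _ * X](_ : _ = 0) ?mulr0 //; ring.
- move=> a /(congr1 iota); rewrite iota_horner rmorph0 => /eqP.
  rewrite ev_eq0; last first.
    by rewrite eF dYM dYC mul0r add0r mulf_neq0 // cst_eq0 (notin_prime_neq0 tp).
  move=> /eqP e; apply/polyP => i; apply/eqP.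
  by rewrite coef0 -(ff_eq0 Q) -coef_map e coef0.
move=> x Dx; have SQp := loc_SQ Q RQ p.
have [|q Sq eq] := kernel_over (K_char0 Q RQ) SQp (hc_over hc) nz grad
    (iota_over hc x).
  by rewrite -(hc_der hc) Dx rmorph0.
(* The generator is F = t G, so a polynomial in G is rewritten in F by dividing the variable by
   t. *)
pose q' := q \Po ((t%:F)^-1%:P * 'X).
have Sq' : q' \is a polyOver (S p).
  by rewrite polyOver_comp // rpredM ?polyOverX // polyOverC inv_loc.
have eq' : iota x = ev (iota F) q'.
  rewrite ev_comp evM evC evX eF mulrA -!polyCM mulVf // !polyC1 mul1r.
  exact: eq.
have [|u [g [up _ eg]]] := @loc_clear _ Q p (full_ideal R) q'.
  by apply/polyOverP => i; rewrite -loc_ring_full; apply: (polyOverP Sq').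
exists u => //; exists g; apply: inj.
by rewrite (chartZ ch) iota_horner -eg evM evC eq'.
Qed.

Lemma irr_chart : irr_at D p -> forall c y1 y2, c \is a over2 (S p) ->
  y1 \is a over2 (S p) -> y2 \is a over2 (S p) ->
  dY G = c * y1 -> - dX G = c * y2 ->
  exists2 c', c' \is a over2 (S p) & c * c' = 1.
Proof.
move=> irr c y1 y2 Sc S1 S2 e1 e2.
have [t tp [c0 ec0]] := chart_onto ch Sc.
have [|u up [c1 ec1]] := irr c0.
  move=> x; pose y := dX (iota x) * y1 + dY (iota x) * y2.
  have Sy : y \is a over2 (S p).
    by rewrite rpredD // rpredM // ?dX_over ?dY_over ?(iota_over hc).
  have [t' t'p [y' ey']] := chart_onto ch Sy.
  exists (t' * t); first exact: prime_notinM.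
  exists y'; apply: inj; rewrite (chartZ ch) rmorphM /= ec0 ey' (hc_der hc).
  by rewrite /vf e1 e2 cstM /y; ring.
have u0 : u%:F != 0 by rewrite ff_eq0 (notin_prime_neq0 up).
have eu : cst u = cst t * c * iota c1.
  by rewrite -ec0 -rmorphM /= -ec1 (chartZ ch) rmorph1 mulr1.
exists ((u%:F)^-1%:P%:P * (cst t * iota c1)).
  rewrite rpredM ?rpredM ?(iota_over hc) ?cst_over //.
  by rewrite !polyOverC inv_loc.
transitivity ((u%:F)^-1%:P%:P * (cst t * c * iota c1)); first by ring.
by rewrite -eu -!polyCM mulVf.
Qed.

End InChart.

Lemma irr_no_common_factor p (iota : {rmorphism B -> P}) G : hchart D p iota G ->
  irr_at D (zero_prime R) -> no_common_factor (dY G) (- dX G).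
Proof.
move=> /(hchart_zero) hc irr c f g ef eg.
have [|||c' _ e] := irr_chart hc irr _ _ _ ef eg; try exact: over2_loc_zero.
by exists c'.
Qed.

(** The zero derivation is divisible by 0, which is not a unit. *)
Lemma irr_at_neq0 p : irr_at D p -> exists x, D x <> 0.
Proof.
move=> irr; apply: contrapT => /forallNP D0.
have [|t tp [c]] := irr 0.
  move=> x; exists 1; first exact: prime_notin1.
  by exists 0; rewrite scale1r mulr0; apply: contrapT; apply: D0.
rewrite mul0r => /(B_tf Q symB noeth basis)[t0|/eqP].
  by rewrite t0 rpred0 in tp.
by rewrite oner_eq0.
Qed.

Lemma depth_local p F : irr_at D (zero_prime R) -> irr_at D p ->
  local_gen D p F -> forall z a : B, a != 0 ->
  (forall x, exists y, D x * z = a * y) ->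
  exists2 t, t \notin p & exists y, t *: z = a * y.
Proof.
move=> irr0 irr [DF _ Fgen] z a a0 dvd.
have [iota [G [hc nz]]] :=
  hchart_nz Q symB noeth RQ lnd basis p (irr_at_neq0 irr0).
have ch := hc_pre hc; have inj := hc_inj hc.
have ia0 : iota a != 0 by rewrite -(rmorph0 iota) (inj_eq inj).
have ker f : f \is a over2 (S p) -> vf (dY G) (- dX G) f = 0 ->
    exists2 q, q \is a polyOver (S p) & f = ev (iota F) q.
  move=> Sf Df; have [t tp [x ex]] := chart_onto ch Sf.
  have [|u up [q eq]] := Fgen x.
    by apply: inj; rewrite (hc_der hc) ex vf_cst Df mulr0 rmorph0.
  have ut : u * t \notin p by exact: prime_notinM.
  exists (((u * t)%:F)^-1%:P * map_poly (ff_in Q) q).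
    rewrite rpredM ?polyOverC ?inv_loc //; apply/polyOverP => i.
    by rewrite coef_map tofrac_loc.
  rewrite evM evC -(iota_horner hc) -eq (chartZ ch) ex mulrA -cstM mulrA.
  by rewrite -!polyCM mulVf ?mul1r // ff_eq0 (notin_prime_neq0 ut).
have dvdS f : (exists2 t, t \notin p & exists x, iota (D x) = cst t * f) ->
    exists2 y, y \is a over2 (S p) & f * iota z = iota a * y.
  move=> [t tp [x ex]]; have [y ey] := dvd x.
  exists ((t%:F)^-1%:P%:P * iota y).
    by rewrite rpredM ?(iota_over hc) // !polyOverC inv_loc.
  apply: (@mulfI _ (cst t)); first by rewrite cst_eq0 (notin_prime_neq0 tp).
  rewrite mulrA -ex -rmorphM /= ey rmorphM /= [RHS]mulrCA [cst t * _]mulrA.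
  by rewrite -!polyCM mulfV ?mul1r // ff_eq0 (notin_prime_neq0 tp).
have [|y1 Sy1 e1] := dvdS (dY G).
  have [|t tp [x ex]] := chart_onto ch (_ : 'X%:P \is a over2 (S p)).
    by rewrite polyOverC polyOverX.
  exists t => //; exists x.
  by rewrite (hc_der hc) ex vf_cst /vf dX_polyC derivX dYC mulr1 mulr0 addr0.
have [|y2 Sy2 e2] := dvdS (- dX G).
  have [|t tp [x ex]] := chart_onto ch (_ : 'X \is a over2 (S p)).
    exact: polyOverX.
  exists t => //; exists x.
  by rewrite (hc_der hc) ex vf_cst /vf dX_X dY_X mulr1 mulr0 add0r.
have [w Sw ew] := hamiltonian_depth (K_char0 Q RQ) (loc_SQ Q RQ p)
  (iota_over hc F) (hc_over hc) (hc_0 hc) nz ker (irr_no_common_factor hc irr0)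
  (irr_chart hc irr) ia0 Sy1 Sy2 e1 e2.
have [t tp [y ey]] := chart_onto ch Sw; exists t => //; exists y.
by apply: inj; rewrite (chartZ ch) rmorphM /= ey ew; ring.
Qed.

Lemma depth_global : (forall p, exists F, local_gen D p F) ->
  (forall p, irr_at D p) -> depth2 D.
Proof.
move=> gen irr z a a0 dvd.
apply: (loc_global noeth (G := fun x => exists y, x = a * y)).
- by exists 0; rewrite mulr0.
- move=> c _ _ [y ->] [y' ->]; exists (c *: y + y').
  by rewrite mulrDr -scalerAr.
move=> p; have [F gF] := gen p; exact: (depth_local (irr _) (irr p) gF a0 dvd).
Qed.

Lemma local_gen_exists p :
  (exists a b, [/\ DB a, DB b & regular_pair a b]) \/ DB 1 ->
  exists F, local_gen D p F.
Proof.
move=> h; have [x Dx] : exists x, D x <> 0.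
  apply: contrapT => /forallNP D0.
  have DB0 y : DB y -> y = 0.
    move=> [s [sD ->]]; rewrite big_seq big1 // => q /sD[w _ <-].
    have -> : D w = 0 by apply: contrapT; apply: D0.
    by rewrite scaler0.
  case: h => [[a [b [Da _ [a0 _]]]]|D1].
    by rewrite (DB0 a Da) eqxx in a0.
  by have /eqP := DB0 1 D1; rewrite oner_eq0.
have [iota [G [hc nz]]] :=
  hchart_nz Q symB noeth RQ lnd basis p (ex_intro (fun x => D x <> 0) x Dx).
apply: (grad_local_gen hc nz); case: h => [[a [b [Da Db reg]]]|D1].
  exact: (grad_of_regular hc Da Db reg nz).
exact: (grad_of_unit hc D1).
Qed.

(** If t a1 = b c and u a2 = b d, then a2 (u c) = a1 (t d), so regularity gives u c = a1 w, and
    cancelling a1 leaves u t = b w with u t outside p. *)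
Lemma irr_of_depth p :
  (exists a b, [/\ DB a, DB b & regular_pair a b]) \/ DB 1 -> irr_at D p.
Proof.
move=> h b irr.
have dvd y : DB y -> exists2 t, t \notin p & exists c, t *: y = b * c.
  move=> [s [sD ->]]; elim: s sD => [|q s IH] sD.
    exists 1; first exact: prime_notin1.
    by exists 0; rewrite big_nil scaler0 mulr0.
  have [|t tp [c ec]] := IH; first by move=> r rs; apply: sD; rewrite inE rs orbT.
  have [w _ ew] := sD q (mem_head _ _); have [u up [d ed]] := irr w.
  exists (t * u); first exact: prime_notinM.
  exists (t *: (q.1 * d) + u *: c).
  rewrite big_cons scalerDr -ew.
  have -> : (t * u) *: (q.1 *: (D w : B^o)) = b * (t *: (q.1 * d)) :> B.
    rewrite -[q.1 *: _]/(q.1 * D w) -scalerA scalerAr ed -scalerAr.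
    by congr (_ *: _); ring.
  by rewrite [t * u]mulrC -scalerA ec mulrDr -!scalerAr.
case: h => [[a1 [a2 [/dvd[t tp [c ec]] /dvd[u up [d ed]] [a0 reg]]]]|/dvd //].
have t0 := notin_prime_neq0 tp; have u0 := notin_prime_neq0 up.
have b0 : b != 0.
  apply: contraNneq a0 => b0; apply/eqP/(B_tfI Q symB noeth basis t0).
  by rewrite ec b0 mul0r scaler0.
have e : a2 * (u *: c) = a1 * (t *: d).
  apply: (B_cancel Q symB noeth basis b0).
  rewrite -!scalerAr mulrCA -ec mulrCA -ed -!scalerAr !scalerA.
  by rewrite [u * t]mulrC [a2 * a1]mulrC.
have [w ew] := reg _ _ e.
exists (u * t); first exact: prime_notinM.
exists w; apply: (B_cancel Q symB noeth basis a0).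
rewrite -scalerAr mulr1 -scalerA ec scalerAr ew; ring.
Qed.

End LocalTheory.

(** * Hilbert's basis theorem and regular elements *)

Section IdealGen.
Variable S : comNzRingType.

Lemma ideal_gen_sub (X Y : set S) : (forall x, X x -> Y x) ->
  forall x, ideal_gen X x -> ideal_gen Y x.
Proof.
move=> XY; apply: (@ideal_gen_min _ (gen_ideal Y)) => x Xx.
by apply: (span_set_incl (V := S^o)); apply: XY.
Qed.

Lemma ideal_gen1 (a x : S) : ideal_gen [set` [:: a]] x <-> exists c, x = c * a.
Proof.
split=> [/ideal_gen_cons[c [y [/ideal_gen_nil -> ->]]]|[c ->]].
  by exists c; rewrite addr0.
by apply/ideal_gen_cons; exists c, 0; rewrite addr0; split=> //; apply/ideal_gen_nil.
Qed.

Lemma ideal_gen2 (a b x : S) :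
  ideal_gen [set` [:: a; b]] x <-> exists c d, x = c * a + d * b.
Proof.
split=> [/ideal_gen_cons[c [y [/ideal_gen1[d ->] ->]]]|[c [d ->]]].
  by exists c, d.
by apply/ideal_gen_cons; exists c, (d * b); split=> //; apply/ideal_gen1; exists d.
Qed.

End IdealGen.

Section Hilbert.
Variable S : comNzRingType.
Hypothesis fg : noeth_ideals S.

Lemma hilbert_basis : noeth_ideals {poly S}.
Proof.
move=> J.
pose lead n c := exists p : {poly S}, [/\ J p, (size p <= n.+1)%N & p`_n = c].
have lead0 n : lead n 0.
  by exists 0; split; rewrite ?coef0 ?size_poly0 //; apply: id_mem0.
have leadP n a x y : lead n x -> lead n y -> lead n (a * x + y).
  move=> [p [Jp sp <-]] [q [Jq sq <-]]; exists (a%:P * p + q); split.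
  - by apply: id_memP.
  - apply: (leq_trans (size_polyD _ _)); rewrite geq_max sq andbT.
    by rewrite mul_polyC (leq_trans (size_scale_leq _ _)).
  by rewrite coefD coefCM.
pose L n := Ideal (lead0 n) (leadP n).
have [|N LN] := @noeth_chain _ L fg.
  move=> n x [p [Jp sp <-]]; exists ('X * p); split; first exact: idM.
    by rewrite mulrC (leq_trans (size_polyMleq _ _)) // size_polyX addn2.
  by rewrite coefXM.
pose covers (s : seq {poly S}) n := forall c, lead n c -> exists q : {poly S},
  [/\ ideal_gen [set` s] q, (size q <= n.+1)%N & q`_n = c].
have covern n : exists2 s : seq {poly S},
    (forall p, p \in s -> J p) & covers s n.
  have [g gP] := fg (L n).
  suff [s sJ sP] : exists2 s : seq {poly S}, (forall p, p \in s -> J p) &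
      forall c, ideal_gen [set` g] c -> exists q : {poly S},
        [/\ ideal_gen [set` s] q, (size q <= n.+1)%N & q`_n = c].
    by exists s => // c /gP; apply: sP.
  have : forall x, x \in g -> lead n x.
    by move=> x xg; apply/(gP x); apply: (span_set_incl (V := S^o)).
  elim: g {gP} => [|x g IH] gL.
    exists [::] => // c /ideal_gen_nil ->; exists 0.
    by rewrite size_poly0 coef0; split=> //; apply: span_set0.
  have [|s sJ sP] := IH; first by move=> y yg; apply: gL; rewrite inE yg orbT.
  have [p [Jp sp ep]] := gL x (mem_head _ _).
  exists (p :: s) => [q|c /ideal_gen_cons[a [y [/sP[q [sq szq <-]] ->]]]].
    by rewrite inE => /predU1P[->|/sJ].
  exists (a%:P * p + q); split.
  - by apply/ideal_gen_cons; exists a%:P, q.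
  - apply: (leq_trans (size_polyD _ _)); rewrite geq_max szq andbT.
    by rewrite mul_polyC (leq_trans (size_scale_leq _ _)).
  by rewrite coefD coefCM ep.
have [s sJ sP] : exists2 s : seq {poly S}, (forall p, p \in s -> J p) &
    forall n, (n < N.+1)%N -> covers s n.
  elim: N.+1 => [|k [s sJ sP]]; first by exists [::].
  have [r rJ rP] := covern k; exists (r ++ s) => [p|n].
    by rewrite mem_cat => /orP[/rJ|/sJ].
  rewrite ltnS leq_eqVlt => /predU1P[->|/sP cov] c.
    move=> /rP[q [rq sq eq]].
    exists q; split=> //; apply: ideal_gen_sub rq => x.
    by rewrite /= mem_cat => ->.
  move=> /cov[q [rq sq eq]]; exists q; split=> //.
  by apply: ideal_gen_sub rq => x; rewrite /= mem_cat => ->; rewrite orbT.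
exists s => p; split; last exact: ideal_gen_min.
have [n] := ubnP (size p); elim: n p => // n IH p lt Jp.
have [->|p0] := eqVneq p 0; first exact: span_set0.
have szp : (size p).-1.+1 = size p by rewrite prednK // size_poly_gt0.
have [q [sq szq eq]] : exists q : {poly S}, [/\ ideal_gen [set` s] q,
    (size q <= size p)%N & q`_(size p).-1 = lead_coef p].
  have lp : lead (size p).-1 (lead_coef p) by exists p; rewrite szp.
  have [le|gt] := leqP (size p).-1 N.
    by have [q [? ? ?]] := sP _ le _ lp; exists q; rewrite -szp.
  have [q [sq szq eq]] := sP N (ltnSn _) _ (LN _ _ lp).
  (* Beyond degree N there are no new leading coefficients, so a polynomial of degree N is shifted
     up. *)
  exists ('X^((size p).-1 - N) * q); split.
  - exact: (@idM _ (gen_ideal [set` s])).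
  - apply: (leq_trans (size_polyMleq _ _)); rewrite size_polyXn addSn /=.
    by rewrite (leq_trans (leq_add (leqnn _) szq)) // addnS subnK ?szp // ltnW.
  by rewrite coefXnM ltnNge leq_subr /= subKn // ltnW.
have Jq : J q by apply: (ideal_gen_min _ sq).
rewrite -[p](subrK q); apply: (@idD _ (gen_ideal [set` s])) => //.
apply: IH; last exact: idB.
rewrite -ltnS (leq_trans _ lt) // ltnS -szp ltnS.
apply/leq_sizeP => j; rewrite leq_eqVlt coefB => /predU1P[<-|gt].
  by rewrite eq lead_coefE subrr.
by rewrite !nth_default ?subrr // ?(leq_trans szq) // -szp.
Qed.

Lemma surj_noeth (T : comNzRingType) (f : {rmorphism S -> T}) :
  (forall y, exists x, f x = y) -> noeth_ideals T.
Proof.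
move=> surj J.
have m0 : J (f 0) by rewrite rmorph0; apply: id_mem0.
have mP a x y : J (f x) -> J (f y) -> J (f (a * x + y)).
  by rewrite rmorphD rmorphM; apply: id_memP.
have [s sP] := fg (@Ideal S (fun x => J (f x)) m0 mP).
exists (map f s) => y; split.
  have [x <-] := surj y => /(sP x)/=.
  elim: {sP m0 mP}s x => [|g s IH] x.
    by move=> /ideal_gen_nil ->; rewrite rmorph0; apply: span_set0.
  move=> /ideal_gen_cons[a [z [/IH zs ->]]]; apply/ideal_gen_cons.
  by exists (f a), (f z); rewrite rmorphD rmorphM.
apply: ideal_gen_min => z /mapP[x xs ->]; apply/(sP x).
exact: (span_set_incl (V := S^o)).
Qed.
End Hilbert.

Section SymNoetherian.
Variables (R : comNzRingType) (M : lmodType R).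
Variables (B : comAlgType R) (sy : {linear M -> B}).
Hypothesis symB : is_symalg sy.

(** Adjoining one variable per generator of M gives a polynomial ring over R that maps onto B. *)
Lemma symalg_noeth : noeth_ideals R -> fin_gen M -> noeth_ideals B.
Proof.
move=> fgR [gs gsP].
have [S [f [fgS fR fgs]]] : exists (S : comNzRingType) (f : {rmorphism S -> B}),
    [/\ noeth_ideals S, forall a : R, exists x, f x = a%:A &
        forall m, m \in gs -> exists x, f x = sy m].
  elim: gs {gsP} => [|m gs [S [f [fgS fR fgs]]]].
    by exists R, (in_alg B); split=> // a; exists a.
  have cfu : commr_rmorph f (sy m) by move=> x; apply: mulrC.
  exists {poly S}, (horner_morph cfu); split.
  - exact: hilbert_basis.
  - by move=> a; have [x <-] := fR a; exists x%:P; apply: horner_morphC.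
  move=> n; rewrite inE => /predU1P[->|/fgs[x <-]].
    by exists 'X; apply: horner_morphX.
  by exists x%:P; apply: horner_morphC.
apply: (surj_noeth fgS (f := f)) => y.
elim/(symalg_ind symB): y => [//|m|x y [u <-] [v <-]|x y [u <-] [v <-]].
- have : span_set [set` gs] m by rewrite gsP.
  move=> [s [sP ->]]; elim: s sP => [|q s IH] sP.
    by exists 0; rewrite big_nil linear0 rmorph0.
  have [|x ex] := IH; first by move=> r rs; apply: sP; rewrite inE rs orbT.
  have [y ey] := fgs q.2 (sP q (mem_head _ _)); have [a ea] := fR q.1.
  exists (a * y + x).
  by rewrite rmorphD rmorphM /= ea ey ex big_cons linearD linearZ /= algM.
- by exists (u + v); rewrite rmorphD.
by exists (u * v); rewrite rmorphM.
Qed.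
End SymNoetherian.

Section NonZeroDivisor.
Variables (B : comNzRingType).
Hypothesis fg : noeth_ideals B.
Hypothesis BQ : forall n, exists y : B, n.+1%:R * y = 1.
Variable I0 : ideal B.

Lemma cancel_nat n x : I0 (n.+1%:R * x) -> I0 x.
Proof.
have [y ey] := BQ n => /(@idM _ I0 y).
by rewrite mulrA [y * _]mulrC ey mul1r.
Qed.

(* If every g1 + t g2 had a torsion element z_t modulo I0, then by noetherianity
   z_k would be a combination of the z_t with t < k, hence killed by the product
   of the g1 + t g2, which acts on z_k as a unit times a power of g2. *)
Lemma pencil_regular (V : ideal B) (g1 g2 : B) :
  (forall z, V z -> I0 (g1 * z) -> I0 (g2 * z) -> I0 z) ->
  exists t : nat, forall z, V z -> I0 ((g1 + t%:R * g2) * z) -> I0 z.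
Proof.
move=> reg; apply: contrapT => /forallNP bad.
pose h t := g1 + t%:R * g2.
have ex t : exists y, [/\ V y, I0 (h t * y) & ~ I0 y].
  apply: contrapT => none; apply: (bad t) => y Vy hy.
  by apply: contrapT => ny; apply: none; exists y.
have [z zP] := choice ex.
pose span n x := exists c : nat -> B, I0 (x - \sum_(i < n) c i * z i).
have span0 n : span n 0.
  exists (fun _ => 0); rewrite big1 ?subr0; first exact: id_mem0.
  by move=> i _; rewrite mul0r.
have spanP n a x y : span n x -> span n y -> span n (a * x + y).
  move=> [c Ic] [d Id]; exists (fun i => a * c i + d i).
  have -> : a * x + y - \sum_(i < n) (a * c i + d i) * z i =
      a * (x - \sum_(i < n) c i * z i) + (y - \sum_(i < n) d i * z i).
    rewrite mulrBr mulr_sumr addrACA -opprD -big_split /=; congr (_ - _).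
    by apply: eq_bigr => i _; ring.
  exact: id_memP.
have [|N LN] := @noeth_chain _ (fun n => Ideal (span0 n) (spanP n)) fg.
  move=> n x [c Ic]; exists (fun i => if (i < n)%N then c i else 0).
  rewrite big_ord_recr /= ltnn mul0r addr0.
  by rewrite (eq_bigr (fun i : 'I_n => c i * z i)) // => i _; rewrite ltn_ord.
have [Vz hz nz] := zP N; have [c Ic] : span N (z N).
  apply: (LN N.+1); exists (fun i => (i == N)%:R).
  rewrite big_ord_recr /= eqxx mul1r big1 ?add0r ?subrr; first exact: id_mem0.
  by move=> i _; rewrite ltn_eqF ?ltn_ord ?mul0r.
have kill : I0 ((\prod_(i < N) h i) * z N).
  rewrite -(subrK (\sum_(i < N) c i * z i) (z N)) mulrDr.
  apply: idD; first exact: idM.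
  rewrite mulr_sumr; apply: (big_ind I0) => [||i _].
  - exact: id_mem0.
  - by move=> x y; apply: idD.
  rewrite (bigD1 i) //=; set w := \prod_(j < N | _) _; have [_ hi _] := zP i.
  have -> : h i * w * (c i * z i) = (c i * w) * (h i * z i) by ring.
  exact: idM.
have hdiff i x : (i < N)%N -> I0 (h N * x) ->
    I0 (h i * x + (N - i)%:R * (g2 * x)).
  move=> lt; have -> : h i * x + (N - i)%:R * (g2 * x) = h N * x.
    by rewrite /h natrB 1?ltnW //; ring.
  by [].
have pow j x : (j <= N)%N -> I0 (h N * x) ->
    I0 ((\prod_(i < j) h i) * x) -> I0 (g2 ^+ j * x).
  elim: j x => [|j IH] x le hx; first by rewrite big_ord0 expr0 !mul1r.
  rewrite big_ord_recr /= -mulrA => /IH.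
  have hhx : I0 (h N * (h j * x)) by rewrite mulrCA; apply: idM.
  move=> /(_ (ltnW le) hhx) Ij.
  have := idB (@idM _ I0 (g2 ^+ j) _ (hdiff j x le hx)) Ij.
  have -> : g2 ^+ j * (h j * x + (N - j)%:R * (g2 * x)) - g2 ^+ j * (h j * x) =
      (N - j)%:R * (g2 ^+ j.+1 * x) by rewrite exprSr; ring.
  rewrite -(prednK (_ : 0 < N - j)%N) ?subn_gt0 //; exact: cancel_nat.
have {}pow := pow N (z N) (leqnn _) hz kill.
(* The last multiple g2^m z_N outside I0 is killed by g2 and, through h_N, also by g1 modulo I0. *)
have [m [gm ngm]] : exists m, I0 (g2 ^+ m.+1 * z N) /\ ~ I0 (g2 ^+ m * z N).
  move: (z N) pow nz => x; elim: (N) => [|k IH] gk nx; first by case: nx; rewrite expr0 mul1r in gk.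
  have [gk'|ngk] := pselect (I0 (g2 ^+ k * x)); first exact: IH.
  by exists k.
apply: ngm; apply: reg.
- exact: idM.
- have -> : g1 * (g2 ^+ m * z N) =
      g2 ^+ m * (h N * z N) - N%:R * (g2 ^+ m.+1 * z N).
    by rewrite exprS /h; ring.
  by apply: idB; apply: idM.
by rewrite mulrA -exprS.
Qed.

(** This takes the place of prime avoidance for the associated primes of B/I0. Passing to the tail
    restricts V to the elements killed by g, so b is regular where g is not, and a combination b + t
    g is regular on all of V. *)
Lemma ideal_regular (l : seq B) (V : ideal B) :
  (forall z, V z -> (forall g, g \in l -> I0 (g * z)) -> I0 z) ->
  exists2 b, ideal_gen [set` l] b & forall z, V z -> I0 (b * z) -> I0 z.
Proof.
elim: l V => [|g l IH] V reg.
  exists 0; first exact: span_set0.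
  by move=> z Vz _; apply: reg.
have m0 : V 0 /\ I0 (g * 0) by rewrite mulr0; split; apply: id_mem0.
have mP a x y : V x /\ I0 (g * x) -> V y /\ I0 (g * y) ->
    V (a * x + y) /\ I0 (g * (a * x + y)).
  move=> [Vx gx] [Vy gy]; split; first exact: id_memP.
  by rewrite mulrDr mulrCA; apply: id_memP.
have [|b lb bP] := IH (@Ideal B (fun z => V z /\ I0 (g * z)) m0 mP).
  move=> z /= [Vz gz] lz; apply: reg => // g'.
  by rewrite inE => /predU1P[->|/lz].
have [z Vz bz gz|t tP] := @pencil_regular V b g; first exact: (bP z).
exists (b + t%:R * g) => //; apply/ideal_gen_cons; exists t%:R, b.
by rewrite addrC.
Qed.

End NonZeroDivisor.

(** * Grade two *)

Section GradeTwo.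
Variables (R : idomainType) (Q : frac_field R) (M : lmodType R).
Variables (B : comAlgType R) (sy : {linear M -> B}).
Hypothesis symB : is_symalg sy.
Variable D : derivation B.
Local Notation K := (ff_sort Q).
Local Notation "x %:F" := (ff_in Q x).
Local Notation P := {poly {poly K}}.
Local Notation S := (@loc_ring R Q).
Local Notation cst := (@cst R Q).

Hypothesis noeth : noetherian_ring R.
Hypothesis RQ : forall n, exists y : R, n.+1%:R * y = 1.
Hypothesis fgM : fin_gen M.
Hypothesis lnd : locally_nilpotent D.
Hypothesis basis : forall p : prime_idealr R,
  exists s m1 m2 (la mu : M -> R), [/\ s \notin p,
    forall m, s *: m = la m *: m1 + mu m *: m2 &
    forall a b, a *: m1 + b *: m2 = 0 -> a = 0 /\ b = 0].
Local Notation DB := (ideal_gen (range D)).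

(** Depth two says that an element killed modulo a = D x by all of D(B)B is divisible by a. Since
    D(B)B is generated by the images of generators of M, some b in it is a nonzerodivisor modulo
    a. *)
Lemma exists_regular_pair : depth2 D -> (exists x, D x <> 0) ->
  exists a b, [/\ DB a, DB b & regular_pair a b].
Proof.
move=> depth [x Dx]; have a0 : D x != 0 by apply/eqP.
pose I0 z := exists y, z = D x * y.
have I00 : I0 0 by exists 0; rewrite mulr0.
have I0P c y z : I0 y -> I0 z -> I0 (c * y + z).
  by move=> [u ->] [v ->]; exists (c * u + v); ring.
pose I := Ideal I00 I0P.
have BQ n : exists y : B, n.+1%:R * y = 1.
  have [y ey] := RQ n; exists y%:A.
  by rewrite mulr_natl -scaler_nat scalerA ey scale1r.
have [gs gsP] := fgM.
have [z _ lz|b lb bP] := @ideal_regular B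
  (symalg_noeth symB (noeth_fg noeth) fgM) BQ I [seq D (sy g) | g <- gs]
  (full_ideal B).
- apply: depth a0 _ => y.
  elim/(symalg_ind symB): y => [c|m|y y' [u eu] [v ev]|y y' [u eu] [v ev]].
  + by exists 0; rewrite linearZ /= der1 scaler0 mul0r mulr0.
  + have : span_set [set` gs] m by rewrite gsP.
    move=> [s [sP ->]]; elim: s sP => [|q s IH] sP.
      by exists 0; rewrite big_nil !linear0 mul0r mulr0.
    have [|u eu] := IH; first by move=> r rs; apply: sP; rewrite inE rs orbT.
    have [|v ev] := lz (D (sy q.2)).
      by apply: map_f; apply: (sP q (mem_head _ _)).
    exists (q.1 *: v + u).
    by rewrite big_cons !linearD !linearZ /= mulrDl -scalerAl ev eu mulrDr scalerAr.
  + by exists (u + v); rewrite linearD /= mulrDl eu ev mulrDr.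
  exists (y' * u + y * v); rewrite der_leibniz mulrDl mulrAC eu -[y * _ * z]mulrA ev; ring.
exists (D x), b; split.
- by apply: (span_set_incl (V := B^o)); exists x.
- by apply: ideal_gen_sub lb => y /mapP[g _ ->]; exists (sy g).
split=> // z y e; have [||w ew] := bP z => //; first by exists y.
by exists w.
Qed.

Lemma pair_of_grade2 : grade_is DB (Some 2%N) ->
  exists a b, [/\ DB a, DB b & regular_pair a b].
Proof.
move=> [_ [s [[sD [_ reg] _] ss]]].
case: s ss sD reg => [//|a [//|b [|//]]] _ sD reg.
exists a, b; split.
- by apply: sD; rewrite /= inE eqxx.
- by apply: sD; rewrite /= !inE eqxx orbT.
split=> [|z y e].
  apply/eqP => a0; have := reg 0%N isT 1 => /=.
  rewrite a0 mul0r => /(_ (span_set0 (V := B^o) _)) /ideal_gen_nil /eqP.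
  by rewrite oner_eq0.
have [|c ->] := iffLR (ideal_gen1 _ _) (reg 1%N isT z _).
  by apply/ideal_gen1; exists y; rewrite /= e mulrC.
by exists c; rewrite mulrC.
Qed.

(** Locally D(B)B is generated by f and g. By Cramer's rule the determinant [del] of (a, b) in terms
    of (f, g) satisfies x del in (a, b), so del is in (a, b) by regularity of x. Feeding this back
    into (a, b) gives 1 = w' f + w g. *)
Lemma regular_three a b x : DB a -> DB b -> DB x -> regular_pair a b ->
  (forall y, ideal_gen [set` [:: a; b]] (x * y) ->
     ideal_gen [set` [:: a; b]] y) -> DB 1.
Proof.
move=> Da Db Dx reg regx; apply: contrapT => D1.
have J0 : DB (0%:A) by rewrite scale0r; apply: (span_set0 (V := B^o)).
have JP c r r' : DB (r%:A) -> DB (r'%:A) -> DB ((c * r + r')%:A).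
  move=> Dr Dr'; rewrite scalerDl -scalerA -algM.
  exact: (span_setP (V := B^o)).
(* J is the trace of D(B)B on R. At a prime p above it, the identity 1 = w' f + w g would put a
   scalar outside p into J. *)
pose J := @Ideal R (fun r => DB (r%:A)) J0 JP.
have [|p Jp] := @prime_ideal_above R noeth J; first by rewrite /= scale1r.
have [i [G hc]] := hchart_exists Q symB noeth RQ lnd basis p.
have ch := hc_pre hc; have inj := hc_inj hc.
have SI y := iota_over hc y.
set f := dY G; set g := - dX G.
have Sf : f \is a over2 (S p) := dYG_over hc.
have Sg : g \is a over2 (S p) := dXG_over hc.
have [a1 [a2 [Sa1 Sa2 ea]]] := DB_chart hc Da.
have [b1 [b2 [Sb1 Sb2 eb]]] := DB_chart hc Db.
have [x1 [x2 [Sx1 Sx2 ex]]] := DB_chart hc Dx.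
rewrite -/f -/g in ea eb ex.
pose del := a1 * b2 - a2 * b1.
have Sdel : del \is a over2 (S p) by rewrite rpredB // rpredM.
have [t tp [del' edel']] := chart_onto ch Sdel.
have [||t' t'p [c' [d' [ec' ed']]]] :=
    onto2 hc (_ : x1 * b2 - x2 * b1 \is a over2 (S p))
             (_ : x2 * a1 - x1 * a2 \is a over2 (S p)).
- by rewrite rpredB // rpredM.
- by rewrite rpredB // rpredM.
have xdel : x * (t' *: del') = t *: c' * a + t *: d' * b.
  apply: inj; rewrite rmorphD !rmorphM /= !(chartZ ch) edel' ec' ed' ex ea eb.
  by rewrite /del; ring.
have [|u [v euv]] := iffLR (ideal_gen2 _ _ _) (regx (t' *: del') _).
  by apply/ideal_gen2; exists (t *: c'), (t *: d').
have tt : t' * t \notin p by exact: prime_notinM.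
pose k : P := ((t' * t)%:F)^-1%:P%:P.
have Sk : k \is a over2 (S p) by rewrite !polyOverC inv_loc.
have kE : k * cst (t' * t) = 1.
  by rewrite -!polyCM mulVf // ff_eq0 (notin_prime_neq0 tt).
have edel : del = k * i u * i a + k * i v * i b.
  have e : cst (t' * t) * del = i (t' *: del').
    by rewrite (chartZ ch) edel' cstM mulrA.
  transitivity (k * (cst (t' * t) * del)); first by rewrite mulrA kE mul1r.
  by rewrite e euv rmorphD !rmorphM /=; ring.
set u' := k * i u in edel; set v' := k * i v in edel.
have Su' : u' \is a over2 (S p) by rewrite rpredM ?SI.
have Sv' : v' \is a over2 (S p) by rewrite rpredM ?SI.
(* From a b2 - b a2 = f del and del = u' a + v' b one gets b (a2 + v' f) = a (b2 - u' f), so a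
   divides a2 + v' f; likewise it divides a1 - v' g. *)
have [|||w Sw ew] := reg_chart hc reg (_ : a2 + v' * f \is a over2 (S p))
    (_ : b2 - u' * f \is a over2 (S p)).
- by rewrite rpredD // rpredM.
- by rewrite rpredB // rpredM.
- transitivity (i b * a2 + f * (del - u' * i a)); first by rewrite edel; ring.
  by rewrite /del ea eb; ring.
have [|||w' Sw' ew'] := reg_chart hc reg (_ : a1 - v' * g \is a over2 (S p))
    (_ : b1 + u' * g \is a over2 (S p)).
- by rewrite rpredB // rpredM.
- by rewrite rpredD // rpredM.
- transitivity (i b * a1 - g * (del - u' * i a)); first by rewrite edel; ring.
  by rewrite /del ea eb; ring.
have a0 : i a != 0 by rewrite -(rmorph0 i) (inj_eq inj); case: reg.
have one : w' * f + w * g = 1.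
  apply: (mulfI a0); rewrite mulr1 [RHS]ea.
  transitivity ((i a * w') * f + (i a * w) * g); first by ring.
  by rewrite -ew -ew'; ring.
have [r rp [z Dz ez]] := DB_onto hc Sw' Sw.
have : DB (r%:A).
  suff <- : z = r%:A by [].
  by apply: inj; rewrite ez (chartZ ch) rmorph1 one.
by move/(Jp r); rewrite (negPf rp).
Qed.

Lemma DB_setT : DB = setT <-> DB 1.
Proof.
split=> [->//|D1]; rewrite predeqE => x; split=> // _.
rewrite -[x]mulr1 -[_ * _]addr0.
by apply: (span_setP (V := B^o)) => //; apply: (span_set0 (V := B^o)).
Qed.

Lemma grade2_of_pair a b : ~ DB 1 -> DB a -> DB b -> regular_pair a b ->
  grade_is DB (Some 2%N).
Proof.
move=> D1 Da Db reg; split; first by move/DB_setT.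
have sub x : x \in [:: a; b] -> DB x.
  by rewrite !inE => /orP[|] /eqP ->.
exists [:: a; b]; split=> //; split.
- exact: sub.
- split.
    move=> e; apply: D1; have : ideal_gen [set` [:: a; b]] (1 : B) by rewrite e.
    exact: (@ideal_gen_min _ (gen_ideal (range D))).
  have [a0 rg] := reg; case=> [|[|//]] _ y /=.
    move=> /ideal_gen_nil ay; apply/ideal_gen_nil.
    by apply: (B_cancel Q symB noeth basis a0); rewrite ay mulr0.
  move=> /ideal_gen1[c e]; apply/ideal_gen1.
  by have [|w ->] := rg y c; [rewrite e mulrC|exists w; rewrite mulrC].
move=> x Dx [_ reg3]; apply: D1; apply: (regular_three Da Db Dx reg) => y.
exact: (reg3 2%N isT).
Qed.

End GradeTwo.

(** * Kernels isomorphic to symmetric algebras of invertible ideals *)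

Section HornerAlg.
Variables (R : idomainType) (A B : comAlgType R) (g : {rmorphism A -> B}).
Hypothesis gZ : forall a x, g (a *: x) = a *: g x.

Lemma morph_horner (x : A) (a : {poly R}) : g (horner_alg x a) = horner_alg (g x) a.
Proof.
elim/poly_ind: a => [|a c IH]; first by rewrite !rmorph0.
rewrite !rmorphD !rmorphM /= !horner_algC !horner_algX IH.
by rewrite gZ rmorph1.
Qed.

Lemma horner_algZ (x : A) c (a : {poly R}) :
  horner_alg x (c%:P * a) = c *: horner_alg x a.
Proof. by rewrite rmorphM /= horner_algC algM. Qed.

Lemma horner_alg_Po (x : A) (a b : {poly R}) :
  horner_alg x (a \Po b) = horner_alg (horner_alg x b) a.
Proof.
elim/poly_ind: a => [|a c IH]; first by rewrite comp_poly0 !rmorph0.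
by rewrite comp_poly_MXaddC !rmorphD !rmorphM /= !horner_algC !horner_algX IH.
Qed.

Lemma horner_homog (r : R) (x y : A) (b : {poly R}) : r *: x = y ->
  exists N, exists bh : {poly R}, r ^+ N *: horner_alg x b = horner_alg y bh.
Proof.
move=> e; elim/poly_ind: b => [|b c [N [bh ebh]]].
  by exists 0%N, 0; rewrite !rmorph0 scaler0.
exists N.+1, (bh * 'X + (r ^+ N.+1 * c)%:P).
rewrite !rmorphD !rmorphM /= !horner_algC !horner_algX -ebh -e scalerDr.
by rewrite -scalerAl -scalerAr !scalerA -exprSr algM scalerA.
Qed.

End HornerAlg.

Lemma horner_alg_poly (R : idomainType) (q a : {poly R}) :
  horner_alg q a = a \Po q.
Proof.
elim/poly_ind: a => [|a c IH]; first by rewrite comp_poly0 rmorph0.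
rewrite comp_poly_MXaddC rmorphD rmorphM /= horner_algC horner_algX IH.
by rewrite alg_polyC.
Qed.

Lemma bij_lrmorphism (R : idomainType) (A B : comAlgType R)
    (g : {rmorphism A -> B}) : (forall a x, g (a *: x) = a *: g x) ->
  injective g -> (forall y, exists x, g x = y) ->
  exists f : {lrmorphism B -> A}, bijective f.
Proof.
move=> gZ gI gS; have [f fK] := choice gS.
have fD : zmod_morphism f.
  by move=> x y; apply: gI; rewrite rmorphB /= !fK.
have fM : monoid_morphism f.
  by split=> [|x y]; apply: gI; rewrite ?rmorphM ?rmorph1 /= !fK.
have fZ : scalable f by move=> a x; apply: gI; rewrite gZ !fK.
pose h : {lrmorphism B -> A} := HB.pack f
  (GRing.isZmodMorphism.Build B A f fD) (GRing.isMonoidMorphism.Build B A f fM)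
  (GRing.isScalable.Build R B A *:%R f fZ).
by exists h; exists g => x; [exact: fK|apply: gI; exact: fK].
Qed.

Section KernelAlgebra.
Variables (R : idomainType) (B : comAlgType R) (D : derivation B).
Local Notation A := (ker_alg D).

Definition kval (x : A) : B := \val x.
Lemma kvalD x y : kval (x + y) = kval x + kval y. Proof. exact: rmorphD. Qed.
Lemma kvalM x y : kval (x * y) = kval x * kval y. Proof. exact: rmorphM. Qed.
Lemma kval1 : kval 1 = 1. Proof. exact: rmorph1. Qed.
Lemma kvalZ a x : kval (a *: x) = a *: kval x. Proof. exact: linearZ. Qed.
Lemma kvalB : zmod_morphism kval. Proof. exact: rmorphB. Qed.
Lemma kval_mult : monoid_morphism kval. Proof. by split; [exact: kval1|exact: kvalM]. Qed.
HB.instance Definition _ := GRing.isZmodMorphism.Build A B kval kvalB.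
HB.instance Definition _ := GRing.isMonoidMorphism.Build A B kval kval_mult.
Lemma kval_inj : injective kval. Proof. exact: val_inj. Qed.
Lemma kvalP x : D (kval x) = 0. Proof. by apply/eqP; exact: (valP x). Qed.
Lemma kval_onto y : D y = 0 -> exists x, kval x = y.
Proof. by move=> /eqP Dy; exists (KerAlg (Dy : y \in der_ker D)). Qed.

End KernelAlgebra.

Section FromSym.
Variables (R : idomainType) (B : comAlgType R) (D : derivation B).
Variables (I : submodClosed R^o) (C : comAlgType R).
Variable (sc : {linear submod I -> C}).
Hypothesis symC : is_symalg sc.

Lemma symalg_local t (i0 : submod I) :
  (forall i : submod I, exists c : R, t *: i = c *: i0) ->
  forall z : C, exists N, exists a : {poly R}, t ^+ N *: z = horner_alg (sc i0) a.
Proof.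
move=> ti z; elim/(symalg_ind symC): z
    => [a|i|x y [n [a ea]] [m [b eb]]|x y [n [a ea]] [m [b eb]]].
- by exists 0%N, a%:P; rewrite horner_algC scale1r.
- have [c e] := ti i; exists 1%N, (c%:P * 'X).
  by rewrite horner_algZ horner_algX expr1 -!linearZ /= e.
- exists (n + m)%N, ((t ^+ m)%:P * a + (t ^+ n)%:P * b).
  rewrite rmorphD /= !horner_algZ -ea -eb !scalerA -!exprD scalerDr.
  by rewrite [(m + n)%N]addnC.
exists (n + m)%N, (a * b).
by rewrite rmorphM /= -ea -eb -scalerAl -scalerAr scalerA -exprD.
Qed.

(** In 1 = sum i z with i in I and z in its inverse, some product w = i0 z is outside p. For i in I,
    w i = (i z) i0 with i z in R. *)
Lemma invertible_local (p : prime_idealr R) : invertible_ideal I ->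
  exists2 t, t \notin p & exists2 i0 : submod I, val i0 != 0 :> R &
    forall i : submod I, exists c : R, t *: i = c *: i0.
Proof.
move=> [J [_ eIJ]].
have IJ_R x z : x \in I -> J z -> exists w, tofrac (x : R) * z = tofrac w.
  move=> Ix Jz; have : @frac_mul_set R [set` I] J (tofrac (x : R) * z).
    exists [:: (x : R, z)]; rewrite big_seq1; split=> // q.
    by rewrite inE => /eqP->.
  by rewrite eIJ => -[w _ <-]; exists w.
have : @frac_mul_set R [set` I] J (tofrac 1) by rewrite eIJ; exists 1.
move=> [s [sIJ e1]].
have [q qs [w wp ew]] : exists2 q, q \in s & exists2 w, w \notin p &
    tofrac q.1 * q.2 = tofrac w.
  apply: contrapT => none.
  suff [w wp ew] : exists2 w, w \in p &
      \sum_(q <- s) tofrac q.1 * q.2 = tofrac w.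
    have e : w = 1 by apply/eqP; rewrite -tofrac_eq -ew -e1.
    by have := idealr1 p; rewrite -e wp.
  elim: s sIJ {e1} none => [|q s IH] sIJ none.
    by exists 0; rewrite ?rpred0 // big_nil tofrac0.
  have [||w wp ew] := IH; first by move=> r rs; apply: sIJ; rewrite inE rs orbT.
    move=> [r rs h]; apply: none; exists r => //; by rewrite inE rs orbT.
  have [Iq Jq] := sIJ q (mem_head _ _); have [v ev] := IJ_R _ _ Iq Jq.
  have vp : v \in p.
    apply/negPn/negP => vp; apply: none; exists q; rewrite ?mem_head //.
    by exists v.
  by exists (v + w); rewrite ?rpredD // big_cons ew ev tofracD.
have [Iq Jq] := sIJ q qs.
exists w => //; exists (Submod Iq).
  apply: contraNneq wp => /= q0; have : @tofrac R w = 0.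
    by apply: (etrans (esym ew)); rewrite q0 tofrac0 mul0r.
  by move/eqP; rewrite tofrac_eq0 => /eqP->; rewrite rpred0.
move=> i; have [c ec] := IJ_R _ _ (valP i) Jq; exists c.
have e (v : R) : tofrac v * q.2 = tofrac c -> w * v = c * q.1.
  move=> ev; apply/eqP; rewrite -tofrac_eq !tofracM -ew -ev.
  by rewrite -mulrA mulrC [q.2 * _]mulrC.
by apply: val_inj; exact: (e _ ec).
Qed.

Lemma local_gen_of_iso (f : {lrmorphism ker_alg D -> C}) : bijective f ->
  invertible_ideal I -> forall p, exists F, local_gen D p F.
Proof.
move=> [g fK gK] inv p.
have [t tp [i0 nz ti]] := invertible_local p inv.
have fI : injective f := can_inj fK.
pose fr : {rmorphism ker_alg D -> C} := f.
have fZ a x : fr (a *: x) = a *: fr x by exact: linearZ.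
have frK x : fr (g x) = x by exact: gK.
exists (kval (g (sc i0))); split.
- exact: kvalP.
- move=> a; rewrite -(morph_horner (@kvalZ _ _ D)) => /eqP.
  rewrite -(rmorph0 (@kval _ _ D)) (inj_eq (@kval_inj _ _ D)) => /eqP /(congr1 fr).
  rewrite (morph_horner fZ) frK rmorph0 => ea.
  (* The algebra map sending i to i T detects algebraic relations: i0 goes to a nonzero multiple of
     T. *)
  have [|psi [psiI psiZ]] := symalg_eval symC (phi := @polyC R)
      (f := fun i : submod I => (val i : R) *: 'X).
    by move=> b m n; rewrite mul_polyC scalerA -scalerDl.
  have := congr1 psi ea; rewrite (morph_horner (B := {poly R})); last first.
    by move=> b x; rewrite psiZ mul_polyC.
  rewrite psiI rmorph0 => /eqP.
  rewrite horner_alg_poly comp_poly_eq0; first by move/eqP.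
  by rewrite size_scale // size_polyX.
move=> x /kval_onto[y <-].
have [N [a ea]] := symalg_local ti (fr y).
exists (t ^+ N).
  by elim: (N) => [|k IH]; rewrite ?prime_notin1 // exprS prime_notinM.
exists a; rewrite -(morph_horner (@kvalZ _ _ D)) -kvalZ; congr (kval _).
apply: (fI : injective fr).
by rewrite fZ ea (morph_horner fZ) frK.
Qed.

End FromSym.

Section ToSym.
Variables (R : idomainType) (B : comAlgType R) (D : derivation B).
Variable eps : {rmorphism B -> R}.
Hypothesis epsZ : forall a x, eps (a *: x) = a * eps x.
Hypothesis noeth : noetherian_ring R.
Hypothesis tf : forall (a : R) (x : B), a *: x = 0 -> a = 0 \/ x = 0.
Hypothesis functional : forall x : B, x <> 0 ->
  exists l : {linear B -> R^o}, l x <> 0.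
Hypothesis gen : forall p, exists F, local_gen D p F.
Hypothesis glob : forall (G : B -> Prop), G 0 ->
  (forall a x y, G x -> G y -> G (a *: x + y)) ->
  forall x, (forall p : prime_idealr R, exists2 t, t \notin p & G (t *: x)) -> G x.

Lemma tfI a (x y : B) : a != 0 -> a *: x = a *: y -> x = y.
Proof.
move=> a0 e; apply: subr0_eq; have [] := @tf a (x - y); last by [].
  by rewrite scalerBr e subrr.
by move/eqP; rewrite (negPf a0).
Qed.

(** Removing the constant term leaves a generator determined up to a scalar, so that the local
    generators span comparable lines. *)
Lemma local_gen_norm p : exists2 F, local_gen D p F & eps F = 0.
Proof.
have [F [DF Ft Fg]] := gen p; set c := eps F.
exists (F - c%:A); last by rewrite rmorphB epsZ rmorph1 mulr1 subrr.
have e1 : horner_alg F ('X - c%:P) = F - c%:A.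
  by rewrite rmorphB /= horner_algX horner_algC.
have e2 : horner_alg (F - c%:A) ('X + c%:P) = F.
  by rewrite rmorphD /= horner_algX horner_algC subrK.
split.
- by rewrite linearB linearZ /= der1 scaler0 DF subrr.
- move=> a; rewrite -e1 -horner_alg_Po => /Ft/eqP.
  by rewrite comp_poly2_eq0 ?size_XsubC // => /eqP.
move=> x /Fg[t tp [a ea]]; exists t => //; exists (a \Po ('X + c%:P)).
by rewrite horner_alg_Po e2.
Qed.

Let zp := zero_prime R.

Lemma gen0_exists : exists F0 : B, [/\ local_gen D zp F0, eps F0 = 0 & F0 <> 0].
Proof.
have [F gF e] := local_gen_norm zp; exists F; split=> // F0.
have [_ Ft _] := gF; have := Ft 'X; rewrite horner_algX => /(_ F0)/eqP.
by rewrite polyX_eq0.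
Qed.

Section Line.
Variable F0 : B.
Hypotheses (gF0 : local_gen D zp F0) (eps0 : eps F0 = 0) (F00 : F0 <> 0).

(** The intersection of A with K F0, that is, the degree-one part of the kernel. *)
Definition line (x : B) := D x = 0 /\ exists r c, r != 0 /\ r *: x = c *: F0.

Lemma line0 : line 0.
Proof.
split; first by rewrite linear0.
by exists 1, 0; rewrite oner_neq0 scaler0 scale0r.
Qed.

Lemma lineP a x y : line x -> line y -> line (a *: x + y).
Proof.
move=> [Dx [r [c [r0 ex]]]] [Dy [s [d [s0 ey]]]]; split.
  by rewrite linearP /= Dx Dy scaler0 addr0.
exists (r * s), (s * a * c + r * d); split; first by rewrite mulf_neq0.
rewrite scalerDr scalerDl -!scalerA -ey -ex !scalerA.
by congr (_ *: _ + _ *: _); ring.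
Qed.

(** Over K both F and F0 generate the kernel, so each is a polynomial in the other. Degrees multiply
    under composition, hence both polynomials are affine, and [eps] removes the constant terms. *)
Lemma line_gen p F : local_gen D p F -> eps F = 0 ->
  line F /\ forall x, line x -> exists2 t, t \notin p & exists c, t *: x = c *: F.
Proof.
move=> [DF Ft Fg] eF; have [_ F0t F0g] := gF0.
have [r rp [a ea]] := F0g F DF; have r0 : r != 0 by rewrite -zero_primeE.
have [t tp [b eb]] : exists2 t, t \notin p & exists a : {poly R},
    t *: F0 = horner_alg F a.
  by apply: Fg; case: gF0.
have [N [bh ebh]] := horner_homog b ea.
have t0 := notin_prime_neq0 tp.
have comp : (r ^+ N * t)%:P * 'X = bh \Po a.
  apply/eqP; rewrite -subr_eq0; apply/eqP/F0t.
  rewrite rmorphB /= horner_algZ horner_algX horner_alg_Po -ebh -eb scalerA.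
  by rewrite subrr.
have sza : (size a).-1 = 1%N.
  have := size_comp_poly bh a; rewrite -comp mul_polyC size_scale; last first.
    by rewrite mulf_neq0 // expf_neq0.
  by rewrite size_polyX /= => /esym/eqP; rewrite muln_eq1 => /andP[_ /eqP].
have sa : size a = 2%N by move: sza; case: (size a) => //= n ->.
have ea2 : a = a`_1 *: 'X + (a`_0)%:P.
  apply/polyP => i; rewrite coefD coefZ coefX coefC.
  case: i => [|[|i]] /=; rewrite ?mulr0 ?mulr1 ?add0r ?addr0 //.
  by rewrite nth_default ?sa.
have a1 : a`_1 != 0.
  rewrite -[1%N]sza; rewrite -lead_coefE lead_coef_eq0.
  by apply: contra_eq_neq sza => ->; rewrite size_poly0.
have erF : r *: F = a`_1 *: F0.
  have e : r *: F = a`_1 *: F0 + (a`_0)%:A.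
    by rewrite ea {1}ea2 rmorphD /= -mul_polyC horner_algZ horner_algX horner_algC.
  have := congr1 eps e; rewrite rmorphD /= !epsZ eF eps0 !mulr0 add0r rmorph1 mulr1.
  by move=> z; rewrite e -z scale0r addr0.
split; first by split=> //; exists r, a`_1.
move=> x [Dx [s [c [s0 ex]]]]; have [u up [q eq]] := Fg x Dx.
exists u => //; exists q`_1.
have k0 : a`_1 * s != 0 by rewrite mulf_neq0.
have eqq : (a`_1 * s)%:P * q = (u * c * r)%:P * 'X.
  apply/eqP; rewrite -subr_eq0; apply/eqP/Ft.
  rewrite rmorphB /= !horner_algZ horner_algX -eq -[(u * c * r) *: F]scalerA erF.
  rewrite !scalerA; apply/eqP; rewrite subr_eq0; apply/eqP.
  transitivity ((a`_1 * u) *: (s *: x)); first by rewrite scalerA; congr (_ *: _); ring.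
  by rewrite ex scalerA; congr (_ *: _); ring.
have eq2 : q = q`_1 *: 'X.
  apply/polyP => i; rewrite coefZ coefX.
  have := congr1 (fun f : {poly R} => f`_i) eqq; rewrite !coefCM coefX.
  case: eqP => [-> _|_]; first by rewrite mulr1.
  by rewrite !mulr0 => /eqP; rewrite mulf_eq0 (negPf k0) => /eqP.
by rewrite eq {1}eq2 -mul_polyC horner_algZ horner_algX.
Qed.

Variable l : {linear B -> R^o}.
Hypothesis l0 : l F0 <> 0.

Lemma line_inj x : line x -> l x = 0 -> x = 0.
Proof.
move=> [_ [r [c [r0 ex]]]] lx; have := congr1 l ex.
rewrite !linearZ /= lx scaler0 => /esym/eqP.
rewrite -[_ *: _]/(c * (l F0 : R)) mulf_eq0 => /orP[/eqP c0|/eqP //].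
apply: (tfI r0); by rewrite ex c0 scale0r scaler0.
Qed.

(** The functional l does not vanish on F0, so it embeds the line into R and makes it an ideal. *)
Definition line_pred : {pred R^o} := fun i => `[< exists2 x, line x & l x = i >].
Lemma line_pred_closed : submod_closed line_pred.
Proof.
split=> [|a i j /asboolP[x Lx <-] /asboolP[y Ly <-]]; apply/asboolP.
  by exists 0; [exact: line0|rewrite linear0].
by exists (a *: x + y); [exact: lineP|rewrite linearP].
Qed.
HB.instance Definition _ := GRing.isSubmodClosed.Build R R^o line_pred line_pred_closed.
Definition line_ideal : submodClosed R^o := line_pred.

Lemma line_lift : exists u : submod line_ideal -> ker_alg D,
  (forall i, line (kval (u i)) /\ l (kval (u i)) = val i) /\
  forall a i j, u (a *: i + j) = a *: u i + u j.
Proof.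
have ex (i : submod line_ideal) :
    exists x : ker_alg D, line (kval x) /\ l (kval x) = val i.
  have /asboolP[x Lx lx] := valP i; have [y ey] := kval_onto (proj1 Lx).
  by exists y; rewrite ey.
have [u uP] := choice ex; exists u; split=> // a i j; apply: kval_inj.
have [Li li] := uP i; have [Lj lj] := uP j; have [La la] := uP (a *: i + j).
rewrite kvalD kvalZ; apply: subr0_eq; apply: line_inj.
  rewrite -scaleN1r addrC; apply: lineP => //; exact: lineP.
by rewrite linearB linearP /= la li lj -[val (_ + _)]/(a *: val i + val j) subrr.
Qed.

(* The denominators t are made uniform by the finite generation of the ideal. *)
Lemma line_local (p : prime_idealr R) : exists2 t, t \notin p & exists F,
  [/\ local_gen D p F, line F & forall x, line x -> exists c, t *: x = c *: F].
Proof.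
have [F gF eF] := local_gen_norm p; have [LF Lg] := line_gen gF eF.
have i0 : line_pred 0 by apply/asboolP; exists 0; [exact: line0|rewrite linear0].
have iP (a x y : R) : line_pred x -> line_pred y -> line_pred (a * x + y).
  move=> /asboolP[u Lu <-] /asboolP[v Lv <-]; apply/asboolP.
  by exists (a *: u + v); [exact: lineP|rewrite linearP].
have [s sP] := noeth_fg noeth (@Ideal R (fun i : R => line_pred i) i0 iP).
pose m (t i : R) := exists c, t * i = c * l F.
have mi (i : R) : line_pred i -> exists2 t, t \notin p & m t i.
  move=> /asboolP[x Lx <-]; have [t tp [c e]] := Lg x Lx; exists t => //.
  by exists c; have := congr1 l e; rewrite !linearZ.
have [t tp ts] : exists2 t, t \notin p & forall i, i \in s -> m t i.
  have : forall i, i \in s -> line_pred i.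
    by move=> i si; apply/(sP i); apply: (span_set_incl (V := R^o)).
  elim: s {sP} => [|i s IH] sL; first by exists 1; rewrite ?prime_notin1.
  have [|t tp ts] := IH; first by move=> j js; apply: sL; rewrite inE js orbT.
  have [u up [c e]] := mi i (sL i (mem_head _ _)).
  exists (t * u); first exact: prime_notinM.
  move=> j; rewrite inE => /predU1P[->|/ts[d ed]].
    by exists (t * c); rewrite -mulrA e mulrA.
  by exists (u * d); rewrite [t * u]mulrC -mulrA ed mulrA.
exists t => //; exists F; split=> // x Lx.
have : ideal_gen [set` s] (l x : R) by apply/sP; apply/asboolP; exists x.
move=> [q [qs eq]]; have [c ec] : m t (l x).
  rewrite eq; elim: q qs {eq} => [|y q IH] qs.
    by exists 0; rewrite big_nil mulr0 mul0r.
  have [|c ec] := IH; first by move=> r rq; apply: qs; rewrite inE rq orbT.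
  have [d ed] := ts y.2 (qs y (mem_head _ _)).
  exists (y.1 * d + c); rewrite big_cons mulrDr ec.
  by rewrite -[y.1 *: _]/(y.1 * (y.2 : R)) mulrCA ed mulrDl mulrA.
exists c; apply: subr0_eq; apply: line_inj.
  have -> : t *: x - c *: F = t *: x + (- c *: F + 0).
    by rewrite addr0 scaleNr.
  by apply: lineP => //; apply: lineP => //; apply: line0.
have lB : l (t *: x - c *: F) = t * (l x : R) - c * (l F : R) :> R.
  by rewrite linearB !linearZ.
by apply: (etrans lB); rewrite ec subrr.
Qed.

(** The inverse is the set of fractions multiplying the ideal into R. The scalars of R in the
    product of the two form an ideal, which is shown to contain 1 locally. *)
Lemma line_invertible : invertible_ideal line_ideal.
Proof.
pose J := [set z : {fraction R} | forall i : R, line_pred i ->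
  exists w, tofrac i * z = tofrac w]%classic.
have JP : frac_submodule J.
  split=> [i _|a x y Jx Jy i Li]; first by exists 0; rewrite mulr0 tofrac0.
  have [v ev] := Jx i Li; have [w ew] := Jy i Li; exists (a * v + w).
  by rewrite mulrDr mulrCA ev ew tofracD tofracM.
exists J; split=> //; rewrite predeqE => z; split.
  move=> [s [sP ->]]; elim: s sP => [|q s IH] sP.
    by exists 0; rewrite // big_nil tofrac0.
  have [|w _ ew] := IH; first by move=> r rs; apply: sP; rewrite inE rs orbT.
  have [Iq Jq] := sP q (mem_head _ _); have [v ev] := Jq q.1 Iq.
  by exists (v + w) => //; rewrite big_cons ev -ew tofracD.
pose IJ (w : R) := @frac_mul_set R [set` line_ideal] J (tofrac w).
have IJ0 : IJ 0 by exists [::]; rewrite big_nil tofrac0.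
have IJP (a x y : R) : IJ x -> IJ y -> IJ (a * x + y).
  move=> [s [sP es]] [r [rP er]].
  exists ([seq (q.1, tofrac a * q.2) | q <- s] ++ r); split.
    move=> q; rewrite mem_cat => /orP[/mapP[q' /sP[Iq Jq] ->]|/rP //].
    split=> //= i Li; have [w ew] := Jq i Li; exists (a * w).
    by rewrite mulrCA ew tofracM.
  rewrite tofracD tofracM es er big_cat big_map mulr_sumr; congr (_ + _).
  by apply: eq_bigr => q _; rewrite mulrCA.
have IJ1 : IJ 1.
  apply: (@local_global R noeth (@Ideal R IJ IJ0 IJP)) => p.
  have [t tp [F [gF LF tF]]] := line_local p; exists t => //=.
  have lF : (l F : R) != 0.
    apply/eqP => lF; have F_0 := line_inj LF lF; have [_ Ft _] := gF.
    have := Ft 'X; rewrite horner_algX => /(_ F_0)/eqP.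
    by rewrite polyX_eq0.
  have lF' : tofrac (l F : R) != 0 by rewrite tofrac_eq0.
  (* By the choice of t, the fraction t / l(F) multiplies the ideal into R, and its product with
     l(F) is t. *)
  exists [:: (l F : R, tofrac t / tofrac (l F : R))]; split; last first.
    by rewrite big_seq1 /= mulrC divfK.
  move=> q; rewrite inE => /eqP->; split; first by apply/asboolP; exists F.
  move=> i /asboolP[x Lx <-]; have [c ec] := tF x Lx; exists c.
  have e : t * (l x : R) = c * (l F : R) by have := congr1 l ec; rewrite !linearZ.
  have key (v w : R) : tofrac w != 0 -> t * v = c * w ->
      tofrac v * (tofrac t / tofrac w) = tofrac c.
    by move=> w0 ev; rewrite mulrA [_ * tofrac t]mulrC -tofracM ev tofracM mulfK.
  exact: (key _ _ lF' e).
move=> [w _ <-].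
have := IJP w 1 0 IJ1 IJ0; by rewrite /IJ mulr1 addr0.
Qed.

(** The inverse of l induces a map from the symmetric algebra to A. Both are locally generated by F
    alone, so injectivity and surjectivity follow at each prime from those of R[T] -> A. *)
Lemma line_iso (C : comAlgType R) (sc : {linear submod line_ideal -> C}) :
  is_symalg sc -> exists f : {lrmorphism ker_alg D -> C}, bijective f.
Proof.
move=> symC; have [u [uP uL]] := line_lift.
have [|g [gsc gZ0]] := symalg_eval symC (phi := in_alg (ker_alg D)) (f := u).
  by move=> a m n; rewrite uL /= algM.
have gZ a x : g (a *: x) = a *: g x by rewrite gZ0 /= algM.
apply: (bij_lrmorphism gZ).
  suff ker z : g z = 0 -> z = 0.
    by move=> x y e; apply/subr0_eq/ker; rewrite rmorphB /= e subrr.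
  move=> gz; have m0 : (0 : R) *: z = 0 by rewrite scale0r.
  have mP (a x y : R) : x *: z = 0 -> y *: z = 0 -> (a * x + y) *: z = 0.
    by move=> ex ey; rewrite scalerDl -scalerA ex ey scaler0 addr0.
  have := @local_global R noeth (@Ideal R (fun t => t *: z = 0) m0 mP).
  rewrite /= scale1r; apply=> p.
  have [t tp [F [gF LF tF]]] := line_local p.
  have Fi : l F \in line_ideal by apply/asboolP; exists F.
  have uF : kval (u (Submod Fi)) = F.
    have [Lu lu] := uP (Submod Fi); apply: subr0_eq; apply: line_inj.
      by rewrite -scaleN1r addrC; apply: lineP.
    by rewrite linearB lu subrr.
  have tl (i : submod line_ideal) : exists c : R, t *: i = c *: Submod Fi.
    have [Li li] := uP i; have [c ec] := tF _ Li; exists c; apply: val_inj.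
    by have := congr1 l ec; rewrite !linearZ /= li.
  have [N [a ea]] := symalg_local symC tl z.
  exists (t ^+ N).
    by elim: (N) => [|k IH]; rewrite ?prime_notin1 // exprS prime_notinM.
  have [_ Ft _] := gF; rewrite ea (Ft a) ?rmorph0 //.
  rewrite -uF -gsc -(morph_horner (@kvalZ _ _ D)) -(morph_horner gZ) -ea.
  by rewrite gZ gz scaler0 rmorph0.
move=> y; suff [x ex] : exists x, kval (g x) = kval y.
  by exists x; apply: kval_inj.
apply: (glob (G := fun b => exists x, kval (g x) = b)).
- by exists 0; rewrite !rmorph0.
- move=> a _ _ [x <-] [x' <-]; exists (a *: x + x').
  by rewrite rmorphD kvalD /= gZ kvalZ.
move=> p; have [t tp [F [gF LF _]]] := line_local p.
have [_ _ Fg] := gF; have [v vp [a ea]] := Fg _ (kvalP y).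
exists v => //.
have Fi : l F \in line_ideal by apply/asboolP; exists F.
have uF : kval (u (Submod Fi)) = F.
  have [Lu lu] := uP (Submod Fi); apply: subr0_eq; apply: line_inj.
    by rewrite -scaleN1r addrC; apply: lineP.
  by rewrite linearB lu subrr.
exists (horner_alg (sc (Submod Fi)) a).
rewrite ea; move: (Submod Fi) uF => i0 <-.
by rewrite -gsc -(morph_horner (@kvalZ _ _ D)) -(morph_horner gZ).
Qed.

End Line.

Lemma kernel_iso_sym :
  exists I : submodClosed R^o, invertible_ideal I /\ forall (C : comAlgType R) (sc : {linear submod I -> C}),
    is_symalg sc -> exists f : {lrmorphism ker_alg D -> C}, bijective f.
Proof.
have [F0 [gF0 e0 F00]] := gen0_exists.
have [l l0] := functional F00.
exists (line_ideal F0 l); split; first exact: line_invertible.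
by move=> C sc; apply: line_iso.
Qed.

End ToSym.

(** * Slices *)

Section ExtendedIdeal.
Variables (R : comNzRingType) (B : comAlgType R).

Definition mem_ext (J : ideal R) (x : B) := exists s : seq (R * B),
  (forall q, q \in s -> J q.1) /\ x = \sum_(q <- s) q.1 *: q.2.

Lemma ext0 (J : ideal R) : mem_ext J 0.
Proof. by exists [::]; rewrite big_nil. Qed.

Lemma extD (J : ideal R) x y : mem_ext J x -> mem_ext J y -> mem_ext J (x + y).
Proof.
move=> [s [sJ ->]] [r [rJ ->]]; exists (s ++ r); rewrite big_cat; split=> // q.
by rewrite mem_cat => /orP[/sJ|/rJ].
Qed.

Lemma ext_in (J : ideal R) r x : J r -> mem_ext J (r *: x).
Proof.
move=> Jr; exists [:: (r, x)]; rewrite big_seq1; split=> // q.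
by rewrite inE => /eqP->.
Qed.

Lemma ext_ind (J : ideal R) (G : B -> Prop) : G 0 ->
  (forall x y, G x -> G y -> G (x + y)) ->
  (forall r x, J r -> G (r *: x)) -> forall x, mem_ext J x -> G x.
Proof.
move=> G0 GD GJ _ [s [sJ ->]]; rewrite big_seq.
by apply: (big_ind G) => // q qs; apply/GJ/sJ.
Qed.

Lemma extM (J : ideal R) b x : mem_ext J x -> mem_ext J (b * x).
Proof.
move: x; apply: ext_ind => [|x y|r x Jr]; first by rewrite mulr0; apply: ext0.
  by rewrite mulrDr; apply: extD.
by rewrite -scalerAr; apply: ext_in.
Qed.

Lemma extZ (J : ideal R) a x : mem_ext J x -> mem_ext J (a *: x).
Proof. by rewrite -algM; apply: extM. Qed.

Lemma ext_der (D : derivation B) (J : ideal R) x : mem_ext J x -> mem_ext J (D x).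
Proof.
move: x; apply: ext_ind => [|x y|r x Jr]; first by rewrite linear0; apply: ext0.
  by rewrite linearD; apply: extD.
by rewrite linearZ; apply: ext_in.
Qed.

Lemma ext_full (J : ideal R) x : J 1 -> mem_ext J x.
Proof. by move=> J1; rewrite -[x]scale1r; apply: ext_in. Qed.

End ExtendedIdeal.

Section Slice.
Variables (R : idomainType) (Q : frac_field R) (M : lmodType R).
Variables (B : comAlgType R) (sy : {linear M -> B}).
Hypothesis symB : is_symalg sy.
Variable D : derivation B.
Local Notation K := (ff_sort Q).
Local Notation "x %:F" := (ff_in Q x).
Local Notation P := {poly {poly K}}.
Local Notation S := (@loc_ring R Q).
Local Notation cst := (@cst R Q).

Hypothesis noeth : noetherian_ring R.
Hypothesis RQ : forall n, exists y : R, n.+1%:R * y = 1.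
Hypothesis lnd : locally_nilpotent D.
Hypothesis basis : forall p : prime_idealr R,
  exists s m1 m2 (la mu : M -> R), [/\ s \notin p,
    forall m, s *: m = la m *: m1 + mu m *: m2 &
    forall a b, a *: m1 + b *: m2 = 0 -> a = 0 /\ b = 0].
Local Notation DB := (ideal_gen (range D)).
Hypothesis DB1 : DB 1.

Section InChart.
Variables (p : prime_idealr R) (iota : {rmorphism B -> P}).
Hypothesis ch : is_prechart p iota.

Lemma ext_loc (J : ideal R) x : mem_ext J x ->
  iota x \is a over2 (@loc_ideal R Q p J).
Proof.
move: x; apply: ext_ind => [|x y Jx Jy|r x Jr]; first by rewrite rmorph0 rpred0.
  by rewrite rmorphD rpredD.
rewrite (chartZ ch); apply/over2P => i j; rewrite !coefCM mulrC.
apply: loc_idealM; first by move/over2P: (chart_loc ch x).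
by apply/loc_idealP; exists r, 1; rewrite rmorph1 divr1 prime_notin1.
Qed.

Lemma loc_ext (J : ideal R) x : iota x \is a over2 (@loc_ideal R Q p J) ->
  exists2 t, t \notin p & mem_ext J (t *: x).
Proof.
pose G f := exists2 t, t \notin p & exists2 z, mem_ext J z & iota z = cst t * f.
have GD f g : G f -> G g -> G (f + g).
  move=> [t tp [z Jz ez]] [u up [w Jw ew]]; exists (t * u).
    exact: prime_notinM.
  exists (u *: z + t *: w); first by apply: extD; apply: extZ.
  by rewrite rmorphD /= !(chartZ ch) ez ew cstM; ring.
have GM f g : f \is a over2 (S p) -> G g -> G (f * g).
  move=> /(chart_onto ch)[t tp [y ey]] [u up [w Jw ew]].
  exists (t * u); first exact: prime_notinM.
  exists (y * w); first exact: extM.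
  by rewrite rmorphM /= ey ew cstM; ring.
have G0 : G 0.
  exists 1; first exact: prime_notin1.
  by exists 0; [exact: ext0|rewrite rmorph0 mulr0].
have Gc a : a \in @loc_ideal R Q p J -> G a%:P%:P.
  move=> /loc_idealP[j [b [Jj bp ->]]]; exists b => //.
  exists (j *: 1); first exact: ext_in.
  rewrite (chartZ ch) rmorph1 mulr1 -!polyCM mulrC divfK //.
  by rewrite ff_eq0 (notin_prime_neq0 bp).
have Gp (c : {poly K}) : c \is a polyOver (@loc_ideal R Q p J) -> G c%:P.
  elim/poly_ind: c => [_|c a IH /polyOverP Jc]; first exact: G0.
  rewrite polyCD polyCM mulrC; apply: GD.
    apply: GM; first by rewrite polyOverC polyOverX.
    apply: IH; apply/polyOverP => i; have := Jc i.+1.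
    by rewrite coefD coefMX coefC addr0.
  by apply: Gc; have := Jc 0%N; rewrite coefD coefMX coefC add0r.
have GJ f : f \is a over2 (@loc_ideal R Q p J) -> G f.
  elim/poly_ind: f => [_|f c IH /polyOverP Jf]; first exact: G0.
  rewrite mulrC; apply: GD.
    apply: GM; first exact: polyOverX.
    apply: IH; apply/polyOverP => i; have := Jf i.+1.
    by rewrite coefD coefMX coefC addr0.
  by apply: Gp; have := Jf 0%N; rewrite coefD coefMX coefC add0r.
move=> /GJ[t tp [z Jz ez]]; exists t => //.
suff -> : t *: x = z by [].
by apply: (prechart_inj symB noeth basis ch); rewrite (chartZ ch) ez.
Qed.

End InChart.

Lemma ext_global (J : ideal R) (x : B) :
  (forall p : prime_idealr R, exists2 t, t \notin p & mem_ext J (t *: x)) ->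
  mem_ext J x.
Proof.
apply: (loc_global noeth); first exact: ext0.
by move=> a y z Jy Jz; apply: extD => //; apply: extZ.
Qed.

(** Flatness of B over R, in the form (JB : c) = (J : c)B, read off the coefficients in each
    chart. *)
Lemma ext_colon (J J' : ideal R) c (x : B) : (forall r, J' r <-> J (r * c)) ->
  mem_ext J (c *: x) -> mem_ext J' x.
Proof.
move=> J'P Jcx; apply: ext_global => p.
have [i ch] := prechart_exists Q symB basis p.
apply: (loc_ext ch); apply/over2P => k l.
have /loc_ringP[u [v [vp e]]] : (i x)`_k`_l \in S p.
  by move/over2P: (chart_loc ch x).
have := ext_loc ch Jcx; rewrite (chartZ ch) => /over2P/(_ k l).
rewrite !coefCM e => /loc_idealP[j [b [Jj bp ej]]]; apply/loc_idealP.
have v0 : v%:F != 0 by rewrite ff_eq0 (notin_prime_neq0 vp).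
have b0 : b%:F != 0 by rewrite ff_eq0 (notin_prime_neq0 bp).
have eqn : u * b * c = v * j.
  apply: (@ff_inj _ Q); rewrite !rmorphM /=.
  transitivity (c%:F * (u%:F / v%:F) * (v%:F * b%:F)).
    by rewrite -[u%:F in LHS](divfK v0); ring.
  by rewrite ej mulrCA divfK // mulrC.
exists (u * b), (v * b); split.
- by apply/J'P; rewrite eqn; apply: idM.
- exact: prime_notinM.
by rewrite !rmorphM /= -mulf_div divff // mulr1.
Qed.

(** At a prime not containing J the claim is trivial. Otherwise J R_p is prime in R_p, and 1 in
    D(B)B supplies what [kernel_mod] requires: a gradient nonzero modulo J and a Koszul multiplier u
    dY f - v dX f. *)
Lemma kernel_mod_prime (J : ideal R) : ~ J 1 ->
  (forall x y, J (x * y) -> J x \/ J y) -> forall x : B, mem_ext J (D x) ->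
  exists2 y, D y = 0 & mem_ext J (x - y).
Proof.
move=> J1 Jp x JDx.
apply: (loc_global noeth (G := fun z => exists2 y, D y = 0 & mem_ext J (z - y))).
- by exists 0; [exact: linear0|rewrite subr0; apply: ext0].
- move=> a z w [y Dy Jy] [y' Dy' Jy']; exists (a *: y + y').
    by rewrite linearP /= Dy Dy' scaler0 addr0.
  rewrite opprD addrACA -scalerBr; apply: extD => //; exact: extZ.
move=> p.
have [[t [Jt tp]]|Jsub] := pselect (exists t, J t /\ t \notin p).
  by exists t => //; exists 0; [exact: linear0|rewrite subr0; apply: ext_in].
have {}Jsub t : J t -> t \in p.
  by move=> Jt; apply/negPn/negP => tp; apply: Jsub; exists t.
pose Z := @loc_ideal R Q p J.
have ZS a z : a \in S p -> z \in Z -> a * z \in Z by apply: loc_idealM.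
have Z1 : 1 \notin Z.
  apply/negP => /loc_idealP[a [b [Ja bp e]]].
  have b0 : b%:F != 0 by rewrite ff_eq0 (notin_prime_neq0 bp).
  have ab : a = b by apply: (@ff_inj _ Q); rewrite -[LHS](divfK b0) -e mul1r.
  by move: bp; rewrite -ab (Jsub a Ja).
have Zp : prime_in (S p) Z.
  move=> _ _ /loc_ringP[a [b [bp ->]]] /loc_ringP[c [d [dp ->]]].
  rewrite fracM => /loc_idealP[e [f [Je fp ee]]].
  have nz t : t \notin p -> t%:F != 0.
    by move=> tp; rewrite ff_eq0 (notin_prime_neq0 tp).
  have bd0 := nz _ (prime_notinM bp dp).
  have eqn : (a * c) * f = e * (b * d).
    apply: (@ff_inj _ Q); rewrite rmorphM [RHS]rmorphM /=.
    rewrite -[(a * c)%:F](divfK bd0) ee mulrAC divfK //.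
    exact: nz.
  have [ac|Jf] : J (a * c) \/ J f.
    by apply: Jp; rewrite eqn mulrC; apply: idM.
  - have [Ja|Jc] := Jp _ _ ac; apply/orP; [left|right]; apply/loc_idealP.
      by exists a, b.
    by exists c, d.
  by rewrite (Jsub f Jf) in fp.
have [|i [G [hc GZ]]] := hchart_exists_dY symB noeth RQ lnd basis (p := p)
    (N := Z : zmodClosed K).
  move=> i G hc XZ YZ; have [u [v [Su Sv e]]] := DB_chart hc DB1.
  have : 1 \is a over2 Z.
    rewrite -(rmorph1 i) e rpredD //; apply: over2_ideal ZS _ _ _ _ => //.
    by rewrite rpredN.
  by rewrite polyOverC polyOverC (negPf Z1).
have ch := hc_pre hc; have [u [v [Su Sv e1]]] := DB_chart hc DB1.
rewrite rmorph1 in e1.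
have [||a Sa aZ] := kernel_mod (K_char0 Q RQ) (loc_SQ Q RQ p) ZS Zp
    (hc_over hc) GZ _ (iota_over hc x).
- move=> f Sf Zf; exists (u * dY f - v * dX f).
  have SXf := dX_over Sf; have SYf := dY_over Sf.
  split.
  + by rewrite rpredB // rpredM.
  + have -> : dX f - (u * dY f - v * dX f) * dX G =
        u * vf (dY G) (- dX G) f + dX f * (1 - (u * dY G + v * - dX G)).
      by rewrite /vf; ring.
    by rewrite -e1 subrr mulr0 addr0; apply: over2_ideal ZS _ _ _ _.
  have -> : dY f - (u * dY f - v * dX f) * dY G =
      v * vf (dY G) (- dX G) f + dY f * (1 - (u * dY G + v * - dX G)).
    by rewrite /vf; ring.
  by rewrite -e1 subrr mulr0 addr0; apply: over2_ideal ZS _ _ _ _.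
- by rewrite -(hc_der hc); apply: ext_loc.
have [t tp [y ey]] := chart_onto ch (ev_over (hc_over hc) Sa).
have [|t' t'p Jt'] := loc_ext ch (_ : i (t *: x - y) \is a over2 Z).
  rewrite rmorphB /= (chartZ ch) ey -mulrBr; apply: over2_ideal ZS _ _ _ _ => //.
  exact: cst_over.
exists (t' * t); first exact: prime_notinM.
exists (t' *: y).
  rewrite linearZ /=; suff -> : D y = 0 by rewrite scaler0.
  by apply: (hc_inj hc); rewrite (hc_der hc) ey vf_cst ham_ev mulr0 rmorph0.
by rewrite -scalerA -scalerBr.
Qed.

(** If c d is in J but c and d are not, both J + (c) and (J : c) are larger than J. The first gives
    x = y + j + c w with y in the kernel and j in JB; then c D w is in JB, so D w is in (J : c)B and
    w can be corrected by the second. *)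
Lemma kernel_mod_ideal (J : ideal R) : forall x : B, mem_ext J (D x) ->
  exists2 y, D y = 0 & mem_ext J (x - y).
Proof.
elim/(noeth_ind noeth): J => J IH x JDx.
have [J1|J1] := pselect (J 1).
  by exists 0; [exact: linear0|rewrite subr0; apply: ext_full].
have [pr|npr] := pselect (forall x y, J (x * y) -> J x \/ J y).
  exact: kernel_mod_prime.
have [c [d [Jcd [Jc Jd]]]] : exists c d, J (c * d) /\ ~ J c /\ ~ J d.
  apply: contrapT => none; apply: npr => c d Jcd; apply: contrapT => /not_orP[? ?].
  by apply: none; exists c, d.
have [J' J'P] := add_principalP J c; have [J2 J2P] := colonP J c.
have sub' : subideal J J'.
  by move=> z Jz; apply/J'P; exists 0, z; rewrite mul0r add0r.
have lt' : ltideal J J'.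
  split=> //; exists c; split=> //; apply/J'P; exists 1, 0.
  by rewrite mul1r addr0; split=> //; apply: id_mem0.
have lt2 : ltideal J J2.
  split=> [z Jz|]; first by apply/J2P; rewrite mulrC; apply: idM.
  by exists d; split=> //; apply/J2P; rewrite mulrC.
have ext' : forall z : B, mem_ext J z -> mem_ext J' z.
  by apply: ext_ind => [|z w|r z Jr];
    [exact: ext0|exact: extD|apply: ext_in; exact: sub'].
have [y Dy] := IH J' lt' x (ext' _ JDx).
have split' : forall z : B, mem_ext J' z ->
    exists j w, mem_ext J j /\ z = j + c *: w.
  apply: ext_ind => [|z w [j [u [Jj ->]]] [k [v [Jk ->]]]|r z /J'P[a [b [Jb ->]]]].
  - by exists 0, 0; rewrite scaler0 addr0; split=> //; apply: ext0.
  - exists (j + k), (u + v); split; first exact: extD.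
    by rewrite scalerDr addrACA.
  exists (b *: z), (a *: z); split; first exact: ext_in.
  by rewrite scalerDl addrC scalerA [a * c]mulrC.
move=> /split'[j [w [Jj e]]].
have JDw : mem_ext J2 (D w).
  apply: (ext_colon J2P).
  have -> : c *: D w = D x + -1 *: D j.
    have := congr1 D e; rewrite linearB linearD linearZ /= Dy subr0 => ->.
    by rewrite scaleN1r addrAC subrr add0r.
  by apply: extD => //; apply/extZ/ext_der.
have [y' Dy' Jw] := IH J2 lt2 w JDw.
exists (y + c *: y'); first by rewrite linearD linearZ /= Dy Dy' scaler0 addr0.
have -> : x - (y + c *: y') = j + c *: (w - y').
  by rewrite opprD addrA e scalerBr addrA.
apply: extD => //; move: (w - y') Jw.
apply: ext_ind => [|z v|r z /J2P Jr]; first by rewrite scaler0; apply: ext0.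
  by rewrite scalerDr; apply: extD.
by rewrite scalerA mulrC; apply: ext_in.
Qed.

Lemma slice_exists : exists s, D s = 1.
Proof.
have [x Dx] : exists x, D x <> 0.
  apply: contrapT => /forallNP D0; have [s [sD e]] := DB1.
  have /eqP := oner_neq0 B; apply; rewrite e big_seq big1 // => q /sD[w _ <-].
  have -> : D w = 0 by apply: contrapT; apply: D0.
  by rewrite scaler0.
have [i [G [hc nz]]] := hchart_nz Q symB noeth RQ lnd basis (zero_prime R)
  (ex_intro (fun x => D x <> 0) x Dx).
have ch := hc_pre hc; have inj := hc_inj hc.
have [u [v [_ _ e1]]] := DB_chart hc DB1; rewrite rmorph1 in e1.
have [f ef] := ham_slice (K_char0 Q RQ) (hc_lnd hc) (esym e1) nz.
(* The slice over K, cleared of its denominator, has D s = t. The correction modulo tB makes s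
   divisible by t. *)
have [t t0 [s es]] := chart_onto0 ch f.
have Ds : D s = t *: 1.
  by apply: inj; rewrite (hc_der hc) es vf_cst ef (chartZ ch) rmorph1.
have m0 : exists c : R, 0 = c * t by exists 0; rewrite mul0r.
have mP (a y z : R) : (exists c, y = c * t) -> (exists c, z = c * t) ->
    exists c, a * y + z = c * t.
  by move=> [c ->] [d ->]; exists (a * c + d); ring.
pose J := @Ideal R (fun r => exists c, r = c * t) m0 mP.
have [|y Dy Jy] := @kernel_mod_ideal J s.
  by rewrite Ds; apply: ext_in; exists 1; rewrite mul1r.
have [w ew] : exists w, s - y = t *: w.
  move: (s - y) Jy; apply: ext_ind => [|z z' [w ->] [w' ->]|r z [c ->]].
  - by exists 0; rewrite scaler0.
  - by exists (w + w'); rewrite scalerDr.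
  by exists (c *: z); rewrite scalerA mulrC.
exists w; apply: (B_tfI Q symB noeth basis t0).
by have := congr1 D ew; rewrite linearB linearZ /= Dy subr0 Ds.
Qed.

End Slice.

Section SliceTheorem.
Variables (R : idomainType) (B : comAlgType R) (D : derivation B).
Hypothesis RQ : forall n, exists y : R, n.+1%:R * y = 1.
Hypothesis lnd : locally_nilpotent D.

(** Evaluation at s turns d/dT into D. Its kernel is stable under d/dT and meets the constants in 0,
    hence is 0; surjectivity follows by integrating along the nilpotency index. *)
Lemma slice_theorem s : D s = 1 ->
  exists f : {rmorphism {poly ker_alg D} -> B},
    bijective f /\ forall a : ker_alg D, f a%:P = \val a.
Proof.
move=> Ds; have cfu : commr_rmorph (@kval _ _ D) s by move=> x; apply: mulrC.
pose f : {rmorphism {poly ker_alg D} -> B} := horner_morph cfu.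
have fC a : f a%:P = kval a by exact: horner_morphC.
have fX : f 'X = s by exact: horner_morphX.
have Df q : D (f q) = f q^`().
  elim/poly_ind: q => [|q c IH].
    by rewrite deriv0 !rmorph0 linear0.
  rewrite rmorphD rmorphM /= fC fX linearD /= der_leibniz IH kvalP Ds addr0 mulr1.
  by rewrite derivD derivC addr0 derivM derivX mulr1 rmorphD rmorphM /= fX.
have [inv invP] := choice RQ.
have cancelA n (a : ker_alg D) : a *+ n.+1 = 0 -> a = 0.
  move=> e; have := congr1 (fun b => inv n *: b) e.
  by rewrite scaler0 -scaler_nat scalerA mulrC invP scale1r.
have prim q : exists q1 : {poly ker_alg D}, q1^`() = q.
  exists (\poly_(i < (size q).+1) (inv i.-1 *: q`_i.-1)); apply/polyP => i.
  rewrite coef_deriv coef_poly ltnS; case: ltnP => [_|le] /=; last first.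
    by rewrite mul0rn nth_default.
  by rewrite -scaler_nat scalerA invP scale1r.
have inj : injective f.
  suff ker q : f q = 0 -> q = 0.
    by move=> x y e; apply/subr0_eq/ker; rewrite rmorphB /= e subrr.
  have [n] := ubnP (size q); elim: n q => // n IH q lt fq.
  have [sz|sz] := leqP (size q) 1.
    move: fq; rewrite (size1_polyC sz) fC => e.
    by have -> : q`_0 = 0 by apply: kval_inj; rewrite e rmorph0.
  have dq : q^`() = 0.
    apply: IH; last by rewrite -Df fq linear0.
    rewrite -ltnS (leq_trans _ lt) // ltnS lt_size_deriv //.
    by rewrite -size_poly_gt0 ltnW.
  have := congr1 (fun r : {poly ker_alg D} => r`_(size q).-2) dq.
  rewrite coef_deriv coef0 => /cancelA.
  have -> : (size q).-2.+1 = (size q).-1 by case: (size q) sz => [|[]].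
  rewrite -lead_coefE => /eqP; rewrite lead_coef_eq0 => /eqP q0.
  by rewrite q0 size_poly0 in sz.
have surj x : exists q, f q = x.
  have [n en] := lnd x; elim: n x en => [|n IH] x en.
    by exists 0; rewrite rmorph0 [x]en.
  have [|q eq] := IH (D x); first by rewrite -iterSr.
  have [q1 dq1] := prim q.
  have [|a ea] := @kval_onto _ _ D (x - f q1).
    by rewrite linearB /= Df dq1 eq subrr.
  by exists (q1 + a%:P); rewrite rmorphD /= fC ea addrC subrK.
have [g gP] := choice surj.
exists f; split; last exact: fC.
by exists g => x; [apply: inj; rewrite gP|rewrite gP].
Qed.

End SliceTheorem.

(** * The main theorem *)

Section Irreducibility.
Variables (R : idomainType) (B : comAlgType R) (D : derivation B).
Variable p : prime_idealr R.

Lemma den_notin (u : denom p) : den u \notin p. Proof. exact: (valP u). Qed.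

Lemma irr_at_irreducible : irr_at D p -> der_irreducible (loc_map (p := p) D).
Proof.
move=> irr [b [nb bD]]; apply: nb.
rewrite -(frac_repr b) in bD *; set b0 := num_of b in bD *; set s := den_of b in bD *.
have [|t tp [c ec]] := irr b0.
  move=> x; have [y] := bD (frac x (denom1 p)).
  rewrite loc_map_frac -(frac_repr y) frac_mul => /eq_frac[w /= e].
  exists (den w * (den s * den (den_of y))).
    by rewrite !prime_notinM // den_notin.
  by exists ((den w * 1) *: num_of y); rewrite e scalerAr.
exists (frac (den s *: c : B) (Denom tp)); rewrite frac_mul.
apply/eq_frac; exists (denom1 p) => /=.
rewrite -scalerAr -ec !scalerA; congr (_ *: _); ring.
Qed.

Lemma irreducible_irr_at : der_irreducible (loc_map (p := p) D) -> irr_at D p.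
Proof.
move=> irr b bD; apply: contrapT => nu; apply: irr.
exists (frac b (denom1 p)); split.
  move=> [c]; rewrite -(frac_repr c) frac_mul => /eq_frac[w /= e].
  apply: nu; exists (den w * (1 * den (den_of c))).
    by rewrite mul1r prime_notinM // den_notin.
  by exists ((den w * 1) *: num_of c); rewrite -scalerAr e.
move=> x; rewrite -(frac_repr x) loc_map_frac.
have [t tp [y e]] := bD (num_of x).
exists (frac y (denomM (Denom tp) (den_of x))).
rewrite frac_mul; apply/eq_frac; exists (denom1 p) => /=.
rewrite -e !scalerA; congr (_ *: _); ring.
Qed.

End Irreducibility.

Section MainTheorem.
Variables (R : idomainType) (M : lmodType R).
Variables (B : comAlgType R) (sy : {linear M -> B}).
Hypothesis symB : is_symalg sy.
Variable D : derivation B.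
Hypothesis noeth : noetherian_ring R.
Hypothesis RQ : forall n, exists y : R, n.+1%:R * y = 1.
Hypothesis fgM : fin_gen M.
Hypothesis lnd : locally_nilpotent D.
Hypothesis rank2 : has_rank M 2.
Local Notation DB := (ideal_gen (range D)).
Let Q := fraction_frac R.

Lemma basis_of_rank (p : prime_idealr R) :
  exists s m1 m2 (la mu : M -> R), [/\ s \notin p,
    forall m, s *: m = la m *: m1 + mu m *: m2 &
    forall a b, a *: m1 + b *: m2 = 0 -> a = 0 /\ b = 0].
Proof. exact: rank2_basis fgM (rank2 p). Qed.
Let basis := basis_of_rank.

(** A coefficient in the generic chart has bounded denominators, so a multiple of it takes values in
    R. *)
Lemma separating_functional (x : B) : x <> 0 ->
  exists l : {linear B -> R^o}, l x <> 0.
Proof.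
move=> x0; have [i ch] := prechart_exists Q symB basis (zero_prime R).
have [j [k nz]] : exists j k, (i x)`_j`_k <> 0.
  apply: contrapT => none; apply: x0; apply: (prechart_inj symB noeth basis ch).
  rewrite rmorph0; apply/polyP => j; apply/polyP => k; rewrite !coef0.
  by apply: contrapT => nz; apply: none; exists j, k.
have [r r0 [l lP]] := chart_coef ch j k.
have l_lin : linear (l : B -> R^o).
  move=> a y z; apply: (@ff_inj _ Q).
  transitivity (ff_in Q a * ff_in Q (l y) + ff_in Q (l z)); last first.
    by rewrite -rmorphM -rmorphD.
  rewrite !lP rmorphD (chartZ ch) !coefD !coefCM mulrDr; congr (_ + _).
  by rewrite mulrCA.
pose L : {linear B -> R^o} :=
  HB.pack (l : B -> R^o) (GRing.isLinear.Build R B R^o *:%R l l_lin).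
exists L => e; have : l x = 0 := e.
move/(congr1 (ff_in Q))/eqP; rewrite lP rmorph0 mulf_eq0 ff_eq0 (negPf r0).
by move/eqP.
Qed.

Lemma augmentation : exists eps : {rmorphism B -> R},
  forall a x, eps (a *: x) = a * eps x.
Proof.
have [|eps [_ epsZ]] := symalg_eval symB (phi := idfun : {rmorphism R -> R})
  (f := fun _ => 0); last by exists eps.
by move=> a m n; rewrite mulr0 addr0.
Qed.

Lemma grade_iff :
  (grade_is DB (Some 2%N) \/ grade_is DB None) <->
  (exists I : submodClosed R^o, invertible_ideal I /\
      exists f : {lrmorphism ker_alg D -> Sym (submod I)}, bijective f) /\
  (forall p : prime_idealr R, der_irreducible (loc_map (p := p) D)).
Proof.
split=> [h|[[I [inv [f fbij]]] irr]].
  have {}h : (exists a b, [/\ DB a, DB b & regular_pair a b]) \/ DB 1.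
    by case: h => [/pair_of_grade2|/DB_setT]; [left|right].
  split; last first.
    by move=> p; apply/irr_at_irreducible/(irr_of_depth Q symB noeth basis).
  have [eps epsZ] := augmentation.
  have [||I [inv iso]] := kernel_iso_sym epsZ noeth (B_tf Q symB noeth basis)
      separating_functional (D := D).
  - by move=> p; apply: (local_gen_exists Q symB noeth RQ lnd basis).
  - exact: loc_global noeth.
  exists I; split=> //; exact: iso (Sym_is_symalg _).
have gen := local_gen_of_iso (Sym_is_symalg _) fbij inv.
have irr' p : irr_at D p by apply: irreducible_irr_at.
have depth := depth_global Q symB noeth RQ lnd basis gen irr'.
have nz := irr_at_neq0 Q symB noeth basis (irr' (zero_prime R)).
have [D1|D1] := pselect (DB 1); first by right; apply/DB_setT.
left; have [a [b [Da Db reg]]] := exists_regular_pair symB noeth RQ fgM depth nz.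
exact: (grade2_of_pair Q symB noeth RQ lnd basis D1 Da Db reg).
Qed.

Lemma grade_infinite : grade_is DB None ->
  exists f : {rmorphism {poly ker_alg D} -> B},
    bijective f /\ forall a : ker_alg D, f a%:P = \val a.
Proof.
move=> /DB_setT D1.
have [s Ds] := slice_exists Q symB noeth RQ lnd basis D1.
exact: slice_theorem RQ lnd _ Ds.
Qed.

End MainTheorem.

Theorem proposition4p2 (R : idomainType) (M : lmodType R)
    (D : derivation (Sym M)) :
  noetherian_ring R ->
  (exists iota : {rmorphism rat -> R}, injective iota) ->
  fin_gen M -> projective M -> has_rank M 2 ->
  locally_nilpotent D ->
  (grade_is (ideal_gen (range D)) (Some 2%N) \/
   grade_is (ideal_gen (range D)) None
   <->
   (exists I : submodClosed R^o, invertible_ideal I /\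
      exists f : {lrmorphism ker_alg D -> Sym (submod I)}, bijective f) /\
   (forall p : prime_idealr R, der_irreducible (loc_map (p := p) D)))
  /\
  (grade_is (ideal_gen (range D)) None ->
   exists f : {rmorphism {poly ker_alg D} -> Sym M},
     bijective f /\ forall a : ker_alg D, f a%:P = \val a).
Proof.
move=> noeth [iota _] fgM _ rank2 lnd.
have RQ n : exists y : R, n.+1%:R * y = 1.
  exists (iota (n.+1%:R)^-1).
  by rewrite -(rmorph_nat iota) -rmorphM mulfV ?rmorph1 // Num.Theory.pnatr_eq0.
split; first exact: (grade_iff (Sym_is_symalg M) noeth RQ fgM lnd rank2).
exact: (grade_infinite (Sym_is_symalg M) noeth RQ fgM lnd rank2).
Qed.
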